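(* Let $L_1,L_2$ be countable metric languages, let $X\subseteq\mathrm{Mod}_\omega(L_1)$ and $Y\subseteq\mathrm{Mod}_\omega(L_2)$ be analytic subsets, and let $K\colon X\to Y$ be an analytic map such that for all $A,B\in X$, $$K(A)\cong K(B)\iff A\cong B.$$ Then there exist maps $\theta\colon\omega_1\to\omega_1$ and $\theta'\colon\omega_1\to\omega_1$ such that for all $A,B\in X$ and all $\alpha<\omega_1$, $$K(A)\equiv_{\theta(\alpha)}K(B)\Rightarrow A\equiv_\alpha B\qquad\text{and}\qquad A\equiv_{\theta'(\alpha)}B\Rightarrow K(A)\equiv_\alpha K(B).$$
   Context: **Metric logic.** A modulus of continuity is a continuous, non-decreasing, subadditive $\Delta\colon[0,\infty)^n\to[0,\infty)$ with $\Delta(0)=0$; a map $g$ of $n$ arguments respects $\Delta$ if $d(g(x),g(x'))\le\Delta(d(x_1,x_1'),\dots,d(x_n,x_n'))$. A metric language $L$ consists of sorts; for each sort $s$ a binary symbol $d_s$ and a bound $D_s>0$; relation symbols $R$ with an arity (tuple of sorts), a compact interval $I_R\subseteq\mathbb R$ and a modulus $\Delta_R$; function symbols $f$ with an arity, a target sort and a modulus $\Delta_f$; constant symbols with a sort. An $L$-structure interprets each sort as a complete metric space of diameter $\le D_s$ with metric $d_s$, each $R$ as an $I_R$-valued function respecting $\Delta_R$, each $f$ as a map respecting $\Delta_f$, and each constant as an element of its sort. Finitary quantifier-free formulas are built from atomic formulas $R(\tau_1,\dots,\tau_n)$ (terms $\tau_i$; the $d_s$ count as relation symbols) using uniformly continuous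 connectives $u\colon\mathbb R^n\to\mathbb R$. Every formula $\varphi$ carries a canonical compact value interval $I_\varphi$ and modulus $\Delta_\varphi$, obtained inductively. The $L_{\omega_1,\omega}$-formulas and their quantifier rank $\mathrm{qr}$ (a countable ordinal) are: (i) finitary quantifier-free formulas have rank $0$; (ii) $u(\varphi_1,\dots,\varphi_n)$ with $u$ uniformly continuous has rank $\max_i\mathrm{qr}(\varphi_i)$; (iii) $\sup_x\varphi$ and $\inf_x\varphi$ have rank $\mathrm{qr}(\varphi)+1$; (iv) if $(\varphi_i)_{i<\omega}$ are formulas in the same finitely many free variables, all taking values in one bounded interval and all respecting one common modulus $\Delta$ (i.e. $\Delta_{\varphi_i}\le\Delta$), then the countable supremum and countable infimum of the $\varphi_i$ are formulas, of rank $\sup_i\mathrm{qr}(\varphi_i)$. For $L$-structures $A,B$ and $\alpha<\omega_1$, $A\equiv_\alpha B$ means $\sigma^A=\sigma^B$ for every $L_{\omega_1,\omega}$-sentence $\sigma$ with $\mathrm{qr}(\sigma)\le\alpha$; $A\cong B$ means there is a bijection (sort by sort) preserving the values of all $L$-formulas. **Coding.** For a countable one-sorted $L=(d;(R_i)_i;(f_j)_j;(c_k)_k)$ with arities $n_i,m_j$, let $X_L=\mathbb R^{\omega^2}\times\prod_i\mathbb R^{\omega^{n_i}}\times\prod_j\omega^{\omega^{m_j}}\times\prod_k\omega$ with the product Polish topology. $\mathrm{Mod}_\omega(L)\subseteq X_L$ is the set of tuples such that $d$ is a pseudometric on $\omega$ of diameter at most $D$ (the diameter bound in $L$), each $R_i$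 takes values in $I_{R_i}$ and respects $\Delta_{R_i}$, and each $f_j$ respects $\Delta_{f_j}$ (all with respect to $d$). With countably many sorts one uses a copy of $\omega$ for each sort. $A\in\mathrm{Mod}_\omega(L)$ codes the separable $L$-structure $\widehat A$ obtained by completing with respect to $d$ and extending relations and functions continuously. In the claim, $A$ is identified with $\widehat A$ (so $\cong$ and $\equiv_\alpha$ refer to the coded structures). A subset of a standard Borel space is analytic if it is a Borel image of a Borel set; a map between analytic sets is analytic if its graph is analytic in the product. *)

(* Defs.v *)
From HB Require Import structures.
From mathcomp Require Import all_boot all_order all_algebra generic_quotient.
From mathcomp Require Import ring lra.
From mathcomp Require Import all_classical all_reals all_analysis.

Set Implicit Arguments.
Unset Strict Implicit.
Unset Printing Implicit Defensive.

Import Order.TTheory GRing.Theory Num.Theory.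
Import numFieldNormedType.Exports.

Local Open Scope classical_set_scope.
Local Open Scope ring_scope.

(* Notations for countable ordinals: each is obtained from 0 by successors and
   countable suprema.  The quotient [omega1] identifies the notations of the same
   ordinal. *)
Inductive onotation : Type :=
| ONzero
| ONsucc of onotation
| ONsup of (nat -> onotation).

(* |a| <= |b|; the inner fixpoint is |a'| < |b|, i.e. |a'| + 1 <= |b|. *)
Fixpoint on_le (a : onotation) : onotation -> Prop :=
  match a with
  | ONzero => fun=> True
  | ONsucc a' => fix on_lt (b : onotation) : Prop :=
      match b with
      | ONzero => False
      | ONsucc b' => on_le a' b'
      | ONsup g => exists n, on_lt (g n)
      end
  | ONsup f => fun b => forall n, on_le (f n) b
  end.

Lemma on_le_sup a g n : on_le a (g n) -> on_le a (ONsup g).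
Proof.
by elim: a g n => [|a _|f IH] g n //=; [exists n | move=> h k; exact: IH (h k)].
Qed.

Lemma on_le_refl a : on_le a a.
Proof. by elim: a => //= f IH n; exact: on_le_sup (IH n). Qed.

Lemma on_leS a b : on_le (ONsucc a) b -> on_le a b.
Proof.
elim: b a => [|b IHb|g IHg] a //; last first.
  by move=> [n /IHg]; exact: on_le_sup.
elim: a => [|a _|f IH] //= h.
  exact: IHb.
by move=> n; apply: IH => /=; exact: h.
Qed.

Lemma on_le_trans b a c : on_le a b -> on_le b c -> on_le a c.
Proof.
elim: a b c => [|a IHa|f IHf] b c //; last first.
  by move=> h bc n; exact: IHf (h n) bc.
elim: b c => [|b IHb|g IHg] c //; last first.
  by move=> [n h] gc; exact: IHg h (gc n).
move=> ab; elim: c => [|c _|k IHk] //=; first exact: IHa.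
by move=> [n /IHk h]; exists n.
Qed.

Lemma on_le_total a b : on_le a b \/ on_le (ONsucc b) a.
Proof.
elim: a b => [|a IHa|f IHf] b; first by left.
- elim: b => [|b _|g IHg]; first by right.
  + exact: IHa.
  + have [[n h]|h] := pselect (exists n, on_le (ONsucc a) (g n)).
      by left; exists n.
    by right => /= n; case: (IHg n) => // ?; case: h; exists n.
- have [[n h]|h] := pselect (exists n, on_le (ONsucc b) (f n)).
    by right; exists n.
  by left => n; case: (IHf n b) => // ?; case: h; exists n.
Qed.

Lemma on_lt_wf : well_founded (fun a b => on_le (ONsucc a) b).
Proof.
suff h a b : on_le b a -> Acc (fun a b => on_le (ONsucc a) b) b.
  by move=> a; exact: h (on_le_refl a).
elim: a b => [|a IH|f IH] b ba; apply: Acc_intro => c cb;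
  have := on_le_trans cb ba.
- by case.
- exact: IH.
- by case=> n cf; exact: IH (on_leS cf).
Qed.

Lemma on_lt_irr a : ~ on_le (ONsucc a) a.
Proof. by elim/(well_founded_ind on_lt_wf): a => a IH h; exact: (IH a h h). Qed.

HB.instance Definition _ := gen_eqMixin onotation.
HB.instance Definition _ := gen_choiceMixin onotation.

Definition on_eqv (a b : onotation) : bool := `[< on_le a b /\ on_le b a >].

Lemma on_eqv_refl : reflexive on_eqv.
Proof. by move=> a; apply/asboolP; split; exact: on_le_refl. Qed.

Lemma on_eqv_sym : symmetric on_eqv.
Proof. by move=> a b; apply/asboolP/asboolP => -[]. Qed.

Lemma on_eqv_trans : transitive on_eqv.
Proof.
move=> b a c /asboolP[ab ba] /asboolP[bc cb]; apply/asboolP.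
by split; [exact: on_le_trans ab bc|exact: on_le_trans cb ba].
Qed.

Canonical on_eqv_equiv := EquivRel on_eqv on_eqv_refl on_eqv_sym on_eqv_trans.

(* omega_1: a well-order with countable proper initial segments in which every
   countable family has a supremum (osuccP, osupP, omega1_wf and
   omega1_countable_segment below). *)
Definition omega1 : Type := {eq_quot on_eqv}%qT.
HB.instance Definition _ := Choice.on omega1.

Definition notation_of (x : omega1) : onotation := repr (x : {eq_quot on_eqv}%qT).
Definition ordinal_of (a : onotation) : omega1 := (\pi_{eq_quot on_eqv} a)%qT.

Lemma ordinal_ofK x : ordinal_of (notation_of x) = x.
Proof. exact: reprK. Qed.

Lemma on_ofK a : on_le a (notation_of (ordinal_of a)) /\
  on_le (notation_of (ordinal_of a)) a.
Proof.
have /eqmodP/asboolP[? ?] : (notation_of (ordinal_of a) = a %[mod {eq_quot on_eqv}])%qT.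
  exact: reprK.
by [].
Qed.

Definition omega1_le (x y : omega1) : bool :=
  `[< on_le (notation_of x) (notation_of y) >].
Definition omega1_lt (x y : omega1) : bool :=
  `[< on_le (ONsucc (notation_of x)) (notation_of y) >].

Lemma omega1_leP a b : omega1_le (ordinal_of a) (ordinal_of b) <-> on_le a b.
Proof.
have [a1 a2] := on_ofK a; have [b1 b2] := on_ofK b.
split=> [/asboolP h|h]; [|apply/asboolP].
  exact: on_le_trans a1 (on_le_trans h b2).
exact: on_le_trans a2 (on_le_trans h b1).
Qed.

Lemma omega1_anti : antisymmetric omega1_le.
Proof.
move=> x y /andP[/asboolP xy /asboolP yx].
by rewrite -(ordinal_ofK x) -(ordinal_ofK y); apply/eqmodP/asboolP.
Qed.

Lemma omega1_trans : transitive omega1_le.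
Proof.
by move=> y x z /asboolP xy /asboolP yz; apply/asboolP; exact: on_le_trans xy yz.
Qed.

Lemma omega1_total : total omega1_le.
Proof.
move=> x y; apply/orP.
case: (on_le_total (notation_of x) (notation_of y)) => [h|/on_leS h].
  by left; apply/asboolP.
by right; apply/asboolP.
Qed.

Lemma omega1_lt_def x y : omega1_lt x y = (y != x) && omega1_le x y.
Proof.
apply/asboolP/andP => [h|[yx /asboolP xy]].
  split; last by apply/asboolP; exact: on_leS.
  by apply/eqP => yx; move: h; rewrite yx => /on_lt_irr.
case: (on_le_total (notation_of y) (notation_of x)) => // h.
by case/eqP: yx; apply: omega1_anti; rewrite /omega1_le !asboolT.
Qed.

HB.instance Definition _ := Order.isOrder.Build Order.default_display omega1
  omega1_lt_def (fun _ _ => erefl) (fun _ _ => erefl)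
  omega1_anti omega1_trans omega1_total.

Definition osucc (x : omega1) : omega1 := ordinal_of (ONsucc (notation_of x)).
Definition osup (f : nat -> omega1) : omega1 :=
  ordinal_of (ONsup (fun n => notation_of (f n))).
Definition ozero : omega1 := ordinal_of ONzero.

Lemma osuccP (x y : omega1) : (x < y)%O = (osucc x <= y)%O.
Proof.
rewrite /Order.lt/= /Order.le/=; apply/asboolP/idP => h.
  by rewrite -(ordinal_ofK y); apply/omega1_leP.
by move: h; rewrite -{1}(ordinal_ofK y) => /omega1_leP.
Qed.

Lemma osupP (f : nat -> omega1) (y : omega1) :
  (osup f <= y)%O <-> forall n, (f n <= y)%O.
Proof.
rewrite /Order.le/= -{1}(ordinal_ofK y); split=> [/omega1_leP h n|h].
  by apply/asboolP; exact: h.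
by apply/omega1_leP => n; have /asboolP := h n.
Qed.

Lemma omega1_wf : well_founded (fun x y : omega1 => (x < y)%O).
Proof.
move=> x; rewrite -(ordinal_ofK x).
elim/(well_founded_ind on_lt_wf): (notation_of x) => a IH.
apply: Acc_intro => y ya; rewrite -(ordinal_ofK y); apply: IH.
by move: ya; rewrite osuccP => /omega1_leP.
Qed.

Lemma omega1_countable_segment (x : omega1) : countable [set y | (y < x)%O].
Proof.
rewrite -(ordinal_ofK x); elim: (notation_of x) => [|a IH|f IH].
- apply: (sub_countable (B := set0)) => //; apply: subset_card_le => y /=.
  by rewrite osuccP => /omega1_leP.
- apply: (sub_countable (B := [set ordinal_of a] `|` [set y | (y < ordinal_of a)%O])).
    apply: subset_card_le => y /=; rewrite osuccP => /omega1_leP /= ya.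
    have : (y <= ordinal_of a)%O by rewrite -(ordinal_ofK y); apply/omega1_leP.
    by rewrite le_eqVlt => /orP[/eqP ->|]; [left|right].
  by rewrite -bigcup2E; apply: bigcup_countable => // -[|[|i]] _ //=.
- apply: (sub_countable (B := \bigcup_n [set y | (y < ordinal_of (f n))%O])).
    apply: subset_card_le => y /=; rewrite osuccP => /omega1_leP /= [n yf].
    by exists n => //=; rewrite osuccP; apply/omega1_leP.
  by apply: bigcup_countable.
Qed.

(* A modulus of continuity on [0, oo)^n; values outside the nonnegative orthant
   are irrelevant. *)
Definition orthant (R : realType) n : set 'rV[R]_n :=
  [set x | forall i, 0 <= x 0 i].
Arguments orthant : clear implicits.

Record modulus (R : realType) n := Modulus {
  modulus_fun :> 'rV[R]_n -> R;
  modulus_ge0 : forall x, orthant R n x -> 0 <= modulus_fun x;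
  modulus_continuous : {within orthant R n, continuous modulus_fun};
  modulus_homo : forall x y : 'rV[R]_n, orthant R n x -> (forall i, x 0 i <= y 0 i) ->
    modulus_fun x <= modulus_fun y;
  modulus_subadd : forall x y, orthant R n x -> orthant R n y ->
    modulus_fun (x + y) <= modulus_fun x + modulus_fun y;
  modulus0 : modulus_fun 0 = 0 }.

(* The distance symbols are not listed among the relation symbols: there is one
   for each sort, with interval [0, sort_diam s] and modulus (x, y) |-> x + y. *)
Record language (R : realType) := Language {
  lsort : Type;
  sort_diam : lsort -> R;
  sort_diam_gt0 : forall s, 0 < sort_diam s;
  relsym : Type;
  rel_arity : relsym -> nat;
  rel_dom : forall r, 'I_(rel_arity r) -> lsort;
  rel_lo : relsym -> R;
  rel_hi : relsym -> R;
  rel_lo_le_hi : forall r, rel_lo r <= rel_hi r;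
  rel_mod : forall r, modulus R (rel_arity r);
  funsym : Type;
  func_arity : funsym -> nat;
  func_dom : forall f, 'I_(func_arity f) -> lsort;
  func_cod : funsym -> lsort;
  func_mod : forall f, modulus R (func_arity f);
  constsym : Type;
  const_sort : constsym -> lsort }.

Arguments rel_dom {R l} r i.
Arguments func_dom {R l} f i.

Definition countable_language (R : realType) (L : language R) : Prop :=
  [/\ countable [set: lsort L], countable [set: relsym L],
      countable [set: funsym L] & countable [set: constsym L]].

Definition complete_metric (R : realType) (Z : metricType R) : Prop :=
  forall F : set_system Z, ProperFilter F -> cauchy F -> exists z : Z, F --> z.

(* Structures are required to be nonempty, so that real suprema and infima over
   a sort are meaningful. *)
Record structure (R : realType) (L : language R) := Structure {
  carrier :> lsort L -> metricType R;
  carrier_inhabited : forall s, [set: carrier s] !=set0;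
  carrier_complete : forall s, complete_metric (carrier s);
  carrier_diam : forall s (x y : carrier s), mdist x y <= sort_diam s;
  rel_int : forall r : relsym L, (forall i, carrier (rel_dom r i)) -> R;
  rel_int_itv : forall r x, rel_lo r <= @rel_int r x <= rel_hi r;
  rel_int_mod : forall r x y, `|@rel_int r x - @rel_int r y| <=
    rel_mod r (\row_i mdist (x i) (y i));
  func_int : forall f : funsym L, (forall i, carrier (func_dom f i)) ->
    carrier (func_cod f);
  func_int_mod : forall f x y, mdist (@func_int f x) (@func_int f y) <=
    func_mod f (\row_i mdist (x i) (y i));
  const_int : forall c : constsym L, carrier (const_sort c) }.

Arguments rel_int {R L} M r x : rename.
Arguments func_int {R L} M f x : rename.

Section formulas.
Context {R : realType} (L : language R).

(* A context of n free variables is the family of their sorts. *)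
Definition ctx n := 'I_n -> lsort L.

(* Extension of a context, or of a vector, by a new variable of index 0. *)
Definition ctx_cons n (s : lsort L) (G : ctx n) : ctx n.+1 :=
  fun i => oapp G s (unlift ord0 i).

Definition row_cons n (a : R) (x : 'rV[R]_n) : 'rV[R]_n.+1 :=
  \row_i oapp (x 0) a (unlift ord0 i).

Definition ctx0 : ctx 0 :=
  fun i => match i with Ordinal _ lt0 => False_rect _ (notF lt0) end.

Inductive term n (G : ctx n) : lsort L -> Type :=
| TVar (i : 'I_n) : term G (G i)
| TConst (c : constsym L) : term G (const_sort c)
| TApp (f : funsym L) (t : forall i, term G (func_dom f i)) : term G (func_cod f).

(* Preformulas with free variables in G (de Bruijn style: the quantified variable
   has index 0); [wf] below singles out the formulas. *)
Inductive preformula n (G : ctx n) : Type :=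
| FRel (r : relsym L) (t : forall i, term G (rel_dom r i))
| FDist (s : lsort L) (t1 t2 : term G s)
| FConn k (u : 'rV[R]_k -> R) (phi : 'I_k -> preformula G)
| FSup (s : lsort L) (phi : preformula (ctx_cons s G))
| FInf (s : lsort L) (phi : preformula (ctx_cons s G))
| FCsup (phi : nat -> preformula G)
| FCinf (phi : nat -> preformula G).

Fixpoint term_mod n (G : ctx n) s (t : term G s) (x : 'rV[R]_n) : R :=
  match t with
  | TVar i => x 0 i
  | TConst _ => 0
  | TApp f t => func_mod f (\row_i term_mod (t i) x)
  end.

Definition box k (I : 'I_k -> R * R) : set 'rV[R]_k :=
  [set y : 'rV[R]_k | forall i, (I i).1 <= y 0 i <= (I i).2].

(* The interval I_phi = [(fitv phi).1, (fitv phi).2]; that of u(phi_1, ..., phi_k)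
   is the image of the box of the I_(phi_i), that of a countable supremum or
   infimum is the least interval containing all the I_(phi_i). *)
Fixpoint fitv n (G : ctx n) (phi : preformula G) : R * R :=
  match phi with
  | FRel r _ => (rel_lo r, rel_hi r)
  | FDist s _ _ => (0, sort_diam s)
  | FConn k u phi =>
      let img := u @` box (fun i => fitv (phi i)) in (inf img, sup img)
  | FSup _ phi | FInf _ phi => fitv phi
  | FCsup phi | FCinf phi =>
      (inf (range (fun i => (fitv (phi i)).1)), sup (range (fun i => (fitv (phi i)).2)))
  end.

(* The modulus Delta_phi; connectives contribute their least modulus on the box
   of the values of their arguments. *)
Fixpoint fmod n (G : ctx n) (phi : preformula G) : 'rV[R]_n -> R :=
  match phi with
  | FRel r t => fun x => rel_mod r (\row_i term_mod (t i) x)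
  | FDist s t1 t2 => fun x => term_mod t1 x + term_mod t2 x
  | FConn k u phi => fun x =>
      sup [set z | exists y y', let B := box (fun i => fitv (phi i)) in
        [/\ B y, B y', forall i, `|y 0 i - y' 0 i| <= fmod (phi i) x &
            z = `|u y - u y'|]]
  | FSup _ phi | FInf _ phi => fun x => fmod phi (row_cons 0 x)
  | FCsup phi | FCinf phi => fun x => sup (range (fun i => fmod (phi i) x))
  end.

Definition common_bounds n (G : ctx n) (phi : nat -> preformula G) : Prop :=
  (exists a b, forall i, a <= (fitv (phi i)).1 /\ (fitv (phi i)).2 <= b) /\
  (exists D : modulus R n, forall i x, orthant R n x -> fmod (phi i) x <= D x).

Fixpoint wf n (G : ctx n) (phi : preformula G) : Prop :=
  match phi with
  | FRel _ _ | FDist _ _ _ => True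
  | FConn k u phi => unif_continuous u /\ forall i, wf (phi i)
  | FSup _ phi | FInf _ phi => wf phi
  | FCsup phi | FCinf phi => (forall i, wf (phi i)) /\ common_bounds phi
  end.

(* The finitary quantifier-free formulas are those obtained from FRel and FDist by
   FConn; this gives them rank 0. *)
Fixpoint qr n (G : ctx n) (phi : preformula G) : omega1 :=
  match phi with
  | FRel _ _ | FDist _ _ _ => ozero
  | FConn k u phi => \big[Order.max/ozero]_(i < k) qr (phi i)
  | FSup _ phi | FInf _ phi => osucc (qr phi)
  | FCsup phi | FCinf phi => osup (fun i => qr (phi i))
  end.

Section semantics.
Variable M : structure L.

Definition env n (G : ctx n) := forall i, M (G i).

Definition env_cons n (G : ctx n) s (a : M s) (e : env G) : env (ctx_cons s G) :=
  fun i => match unlift ord0 i as o return M (oapp G s o) with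
           | Some j => e j
           | None => a
           end.

Definition env0 : env ctx0 :=
  fun i => match i with Ordinal _ lt0 => False_rect _ (notF lt0) end.

Fixpoint teval n (G : ctx n) s (t : term G s) (e : env G) : M s :=
  match t with
  | TVar i => e i
  | TConst c => const_int M c
  | TApp f t => func_int M f (fun i => teval (t i) e)
  end.

Fixpoint feval n (G : ctx n) (phi : preformula G) : env G -> R :=
  match phi with
  | FRel r t => fun e => rel_int M r (fun i => teval (t i) e)
  | FDist s t1 t2 => fun e => mdist (teval t1 e) (teval t2 e)
  | FConn k u phi => fun e => u (\row_i feval (phi i) e)
  | FSup s phi => fun e => sup (range (fun a => feval phi (env_cons a e)))
  | FInf s phi => fun e => inf (range (fun a => feval phi (env_cons a e)))
  | FCsup phi => fun e => sup (range (fun i => feval (phi i) e))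
  | FCinf phi => fun e => inf (range (fun i => feval (phi i) e))
  end.

End semantics.

Definition equiv_rank (alpha : omega1) (M N : structure L) : Prop :=
  forall sigma : preformula ctx0, wf sigma -> (qr sigma <= alpha)%O ->
  feval sigma (env0 M) = feval sigma (env0 N).

Definition isomorphic (M N : structure L) : Prop :=
  exists h : forall s, M s -> N s, (forall s, bijective (h s)) /\
  forall n (G : ctx n) (phi : preformula G), wf phi ->
  forall e : env M G, feval phi e = feval phi (fun i => h _ (e i)).

End formulas.

Definition is_pseudometric (R : realType) (T : Type) (d : T -> T -> R) : Prop :=
  [/\ forall x, d x x = 0, forall x y, 0 <= d x y, forall x y, d x y = d y x &
      forall x y z, d x z <= d x y + d y z].

Section codes.
Context {R : realType} (L : language R).

(* The space X_L, with the product topology (nat is discrete). *)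
Definition coding_space : topologicalType :=
  (prod_topology (fun _ : lsort L => {ptws nat * nat -> R}) *
   prod_topology (fun r : relsym L => {ptws ('I_(rel_arity r) -> nat) -> R}) *
   prod_topology (fun f : funsym L => {ptws ('I_(func_arity f) -> nat) -> nat}) *
   prod_topology (fun _ : constsym L => nat))%type.

Definition code_dist (A : coding_space) (s : lsort L) (i j : nat) : R := A.1.1.1 s (i, j).
Definition code_rel (A : coding_space) (r : relsym L) : ('I_(rel_arity r) -> nat) -> R :=
  A.1.1.2 r.
Definition code_func (A : coding_space) (f : funsym L) :
  ('I_(func_arity f) -> nat) -> nat :=
  A.1.2 f.
Definition code_const (A : coding_space) (c : constsym L) : nat := A.2 c.

End codes.

Arguments code_rel {R L} A r x.
Arguments code_func {R L} A f x.

Section coding.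
Context {R : realType} (L : language R).

(* Mod_omega(L) *)
Definition Mod : set (coding_space L) := [set A |
  [/\ forall s, is_pseudometric (code_dist A s) /\
        forall i j, code_dist A s i j <= sort_diam s,
      forall r x, rel_lo r <= code_rel A r x <= rel_hi r,
      forall r x y, `|code_rel A r x - code_rel A r y| <=
        rel_mod r (\row_i code_dist A (rel_dom r i) (x i) (y i)) &
      forall f x y, code_dist A (func_cod f) (code_func A f x) (code_func A f y) <=
        func_mod f (\row_i code_dist A (func_dom f i) (x i) (y i))]].

(* M is the completion of the countable prestructure A; the interpretations in M
   are continuous, hence determined by their values on the dense image of nat. *)
Definition is_completion (A : coding_space L) (M : structure L) : Prop :=
  exists iota : forall s, nat -> M s,
  [/\ forall s i j, mdist (iota s i) (iota s j) = code_dist A s i j,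
      forall s, dense (range (iota s)),
      forall r x, rel_int M r (fun i => iota (rel_dom r i) (x i)) = code_rel A r x,
      forall f x, func_int M f (fun i => iota (func_dom f i) (x i)) =
        iota (func_cod f) (code_func A f x) &
      forall c, const_int M c = iota (const_sort c) (code_const A c)].

End coding.

Arguments Mod {R} L.

Section modulus_small.
Context {R : realType} n (D : modulus R n).

Lemma modulus_small (e : R) : 0 < e -> exists2 d : R, 0 < d &
  forall x : 'rV[R]_n, orthant R n x -> (forall i, x 0 i <= d) -> D x <= e.
Proof.
move=> e0.
have o0 : orthant R n 0 by move=> i; rewrite mxE.
have /subspace_continuousP/(_ _ o0) := @modulus_continuous _ _ D.
move=> /cvgrPdist_le /(_ e e0); rewrite near_withinE => /nbhs_ballP[d /= d0 hd].
exists (d / 2); first by rewrite divr_gt0.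
move=> x xo xd; have bx : ball (0 : 'rV[R]_n) d x.
  split=> // i j; rewrite ord1 !mxE /ball /= sub0r normrN ger0_norm ?xo//.
  by rewrite (le_lt_trans (xd j))// ltr_pdivrMr// ltr_pMr// ltr1n.
by have := hd x bx xo; rewrite /from_subspace modulus0 sub0r normrN;
  exact/le_trans/ler_norm.
Qed.
End modulus_small.

Section extension.
Context {R : realType} n (P : 'I_n -> metricType R) (iota : forall i, nat -> P i).
Hypothesis diota : forall i, dense (range (iota i)).
Context (N : metricType R).
Hypothesis cN : complete_metric N.
Variables (D : modulus R n) (f : ('I_n -> nat) -> N).
Hypothesis fD : forall x y, mdist (f x) (f y) <=
  D (\row_i mdist (iota i (x i)) (iota i (y i))).

Let near_pt (p : forall i, P i) (d : R) : set ('I_n -> nat) :=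
  [set x | forall i, mdist (p i) (iota i (x i)) <= d].

Let near_pt_ex p d : 0 < d -> near_pt p d !=set0.
Proof.
move=> d0.
have h i : exists k, mdist (p i) (iota i k) <= d.
  have [] := @diota i (ball (p i) d)°.
  - exists (p i); exact: nbhsx_ballx (p i) d d0.
  - exact: open_interior.
  - move=> z [/interior_subset + [k _ kz]]; rewrite -kz ballEmdist => /= /ltW ?.
    by exists k.
by exists (fun i => sval (cid (h i))) => i; exact: svalP (cid (h i)).
Qed.

Lemma row_orthant (p q : forall i, P i) : orthant R n (\row_i mdist (p i) (q i)).
Proof. by move=> i; rewrite mxE mdist_ge0. Qed.

Let near_filter p : ProperFilter (filter_from [set d | 0 < d] (near_pt p)).
Proof.
apply: filter_from_proper => [|d d0]; last exact: near_pt_ex.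
apply: filter_from_filter; first by exists 1 => /=; exact: ltr01.
move=> a b /= a0 b0; exists (Num.min a b); first by rewrite /= lt_min a0.
move=> x /= xab; split=> i; apply: le_trans (xab i) _.
  by rewrite ge_min lexx.
by rewrite ge_min lexx orbT.
Qed.

Let osc p e : 0 < e -> exists2 d, 0 < d & forall x y,
  near_pt p d x -> near_pt p d y -> mdist (f x) (f y) <= e.
Proof.
move=> e0; have [d d0 hd] := modulus_small D e0.
exists (d / 2); first by rewrite divr_gt0.
move=> x y px py; apply: le_trans (fD _ _) _; apply: hd.
  exact: row_orthant.
move=> i; rewrite mxE; apply: le_trans (metric_triangle _ (p i) _) _.
by rewrite [leRHS]splitr lerD// metric_sym.
Qed.

Let lim_ex p : exists l : N, forall e, 0 < e -> exists2 d, 0 < d &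
  forall x, near_pt p d x -> mdist l (f x) <= e.
Proof.
pose F : set_system N := f @ (filter_from [set d | 0 < d] (near_pt p)).
have FP : ProperFilter F by apply: fmap_proper_filter; exact: near_filter.
have [|l Fl] := cN FP.
  apply/cauchyP => e e0; have [d d0 hd] := osc p (divr_gt0 e0 (ltr0n _ 2)).
  have [x px] := near_pt_ex p d0.
  exists (f x); exists d => // y py; rewrite /= ballEmdist /=.
  by rewrite (le_lt_trans (hd _ _ px py))// ltr_pdivrMr// ltr_pMr// ltr1n.
exists l => e e0; have [|d d0 hd] := Fl (ball l e).
  exact: nbhsx_ballx l e e0.
by exists d => // x px; have := hd x px; rewrite /= ballEmdist => /ltW.
Qed.

Lemma extension : exists g : (forall i, P i) -> N,
  [/\ forall x, g (fun i => iota i (x i)) = f x,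
      forall p q, mdist (g p) (g q) <= D (\row_i mdist (p i) (q i)) &
      forall p e, 0 < e -> exists x, mdist (g p) (f x) <= e].
Proof.
pose g p := sval (cid (lim_ex p)).
have H p : forall e, 0 < e -> exists2 d, 0 < d &
    forall x, near_pt p d x -> mdist (g p) (f x) <= e := svalP (cid (lim_ex p)).
exists g; split.
- move=> x; apply: mdist_positivity; apply/eqP; rewrite eq_le mdist_ge0 andbT.
  apply/ler_addgt0Pl => e e0; rewrite addr0.
  have [d d0 hd] := H (fun i => iota i (x i)) e e0.
  by apply: hd => i; rewrite mdistxx ltW.
- move=> p q; apply/ler_addgt0Pr => e e0.
  have e30 : 0 < e / 3 by rewrite divr_gt0.
  have [d1 d10 h1] := H p _ e30; have [d2 d20 h2] := H q _ e30.
  have [d3 d30 h3] := modulus_small D e30.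
  pose d := Num.min (Num.min d1 d2) (d3 / 2).
  have d0 : 0 < d by rewrite !lt_min d10 d20 divr_gt0.
  have dd1 : d <= d1 by rewrite !ge_min lexx.
  have dd2 : d <= d2 by rewrite !ge_min lexx orbT.
  have dd3 : d <= d3 / 2 by rewrite !ge_min lexx orbT.
  have [x px] := near_pt_ex p d0; have [y qy] := near_pt_ex q d0.
  have gx := h1 x (fun i => le_trans (px i) dd1).
  have gy := h2 y (fun i => le_trans (qy i) dd2).
  have fxy : mdist (f x) (f y) <= D (\row_i mdist (p i) (q i)) + e / 3.
    apply: le_trans (fD _ _) _.
    pose dd : 'rV[R]_n := \row_i d3.
    have odd : orthant R n dd by move=> i; rewrite mxE ltW.
    apply: (@le_trans _ _ (D (\row_i mdist (p i) (q i) + dd))).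
      apply: modulus_homo => [|i]; first exact: row_orthant.
      rewrite !mxE; apply: le_trans (metric_triangle _ (p i) _) _.
      rewrite metric_sym; apply: le_trans (lerD (px i) (metric_triangle _ (q i) _)) _.
      rewrite addrCA lerD2l; apply: le_trans (lerD dd3 (le_trans (qy i) dd3)) _.
      by rewrite -splitr.
    apply: le_trans (modulus_subadd D (row_orthant _ _) odd) _.
    by rewrite lerD2l h3// => i; rewrite mxE.
  apply: le_trans (metric_triangle _ (f x) _) _.
  apply: le_trans (lerD gx (metric_triangle _ (f y) _)) _.
  rewrite [mdist (f y) _]metric_sym.
  apply: le_trans (lerD (lexx _) (lerD fxy gy)) _.
  by rewrite addrCA -addrA lerD2l; lra.
- move=> p e e0; have [d d0 hd] := H p e e0.
  by have [x px] := near_pt_ex p d0; exists x; exact: hd.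
Qed.
End extension.

(* The completion of a bounded pseudometric on nat, as the closure of the
   distance functions d i in the sup metric. *)
Section kuratowski.
Context {R : realType}.

Record bounded_pseudometric := BoundedPseudometric {
  bp_dist :> nat -> nat -> R;
  bp_bound : R;
  bp_pseudometric : is_pseudometric bp_dist;
  bp_dist_le : forall i j, bp_dist i j <= bp_bound }.

Record kpoint (d : bounded_pseudometric) := KPoint {
  kfun :> nat -> R;
  kfunP : forall e, 0 < e -> exists i, forall j, `|kfun j - d i j| <= e }.

Variable d : bounded_pseudometric.
Local Notation point := (kpoint d).

HB.instance Definition _ := gen_eqMixin point.
HB.instance Definition _ := gen_choiceMixin point.

Definition kdist (p q : point) : R := sup (range (fun j => `|p j - q j|)).

Lemma kdist_has_sup (p q : point) : has_sup (range (fun j => `|p j - q j|)).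
Proof.
have [_ d0 _ _] := bp_pseudometric d.
split; first by exists (`|p 0 - q 0|), 0.
have [i hi] := kfunP p (@ltr01 R); have [k hk] := kfunP q (@ltr01 R).
exists (1 + (bp_bound d + bp_bound d + 1)) => _ [j _ <-].
have -> : p j - q j = (p j - d i j) + (d i j + (- d k j + (d k j - q j))) by lra.
apply: le_trans (ler_normD _ _) _; apply: lerD => //.
apply: le_trans (ler_normD _ _) _; rewrite -addrA; apply: lerD.
  by rewrite ger0_norm// bp_dist_le.
apply: le_trans (ler_normD _ _) _; apply: lerD; last by rewrite distrC.
by rewrite normrN ger0_norm// bp_dist_le.
Qed.

Lemma kdist_ge (p q : point) j : `|p j - q j| <= kdist p q.
Proof. by apply: sup_upper_bound; [exact: kdist_has_sup|exists j]. Qed.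

Lemma kdist_le (p q : point) c : (forall j, `|p j - q j| <= c) -> kdist p q <= c.
Proof.
by move=> h; apply: ge_sup => [|_ [j _ <-]//]; exact: (kdist_has_sup p q).1.
Qed.

Lemma kdistxx p : kdist p p = 0.
Proof.
apply/eqP; rewrite eq_le; apply/andP; split.
  by apply: kdist_le => j; rewrite subrr normr0.
exact: le_trans (normr_ge0 _) (kdist_ge p p 0).
Qed.

Lemma kpoint_ext (p q : point) : (forall j, p j = q j) -> p = q.
Proof.
case: p q => [p hp] [q hq] /= /funext pq; move: hp hq; rewrite pq => hp hq.
by congr KPoint; exact: Prop_irrelevance.
Qed.

Lemma kdist_positivity p q : kdist p q = 0 -> p = q.
Proof.
move=> pq; apply: kpoint_ext => j; apply/eqP; rewrite -subr_eq0 -normr_le0 -pq.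
exact: kdist_ge.
Qed.

Lemma kdist_sym p q : kdist p q = kdist q p.
Proof. by rewrite /kdist; congr sup; congr image; apply/funext => j; rewrite distrC. Qed.

Lemma kdist_triangle q p r : kdist p r <= kdist p q + kdist q r.
Proof.
apply: kdist_le => j; rewrite -(subrKA (q j)).
by apply: le_trans (ler_normD _ _) _; apply: lerD; exact: kdist_ge.
Qed.

HB.instance Definition _ := @isMetric.Build R point kdist
  kdistxx kdist_positivity kdist_sym kdist_triangle.

Lemma kiotaP i e : 0 < e -> exists k, forall j, `|d i j - d k j| <= e.
Proof. by move=> e0; exists i => j; rewrite subrr normr0 ltW. Qed.

Definition kiota (i : nat) : point := KPoint (@kiotaP i).

Lemma kiota_dist i j : mdist (kiota i) (kiota j) = d i j.
Proof.
have [dxx d0 ds dt] := bp_pseudometric d.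
apply/eqP; rewrite eq_le; apply/andP; split.
  apply: kdist_le => k /=; rewrite ler_norml lerBlDr; apply/andP; split.
    by rewrite lerBrDr addrC lerBlDr addrC [d i j]ds; exact: dt.
  exact: dt.
by apply: le_trans (kdist_ge _ _ j); rewrite /= dxx subr0 ger0_norm.
Qed.

Lemma kiota_near (p : point) e : 0 < e -> exists i, mdist p (kiota i) <= e.
Proof. by move=> /(kfunP p)[i hi]; exists i; exact: kdist_le. Qed.

Lemma kiota_dense : dense (range kiota).
Proof.
move=> U [p Up] oU.
have /nbhs_ballP[e /= e0 eU] : nbhs p U by exact: open_nbhs_nbhs.
have [i hi] := kiota_near p (divr_gt0 e0 (ltr0n _ 2)).
exists (kiota i); split; last by exists i.
apply: eU; rewrite ballEmdist /=.
by rewrite (le_lt_trans hi)// ltr_pdivrMr// ltr_pMr// ltr1n.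
Qed.

Lemma kpoint_complete : complete_metric point.
Proof.
move=> F FF /cauchyP Fc.
have Fx (e : R) : 0 < e -> exists x : point, F [set p | mdist x p <= e].
  move=> e0; have [x] := Fc e e0; rewrite ballEmdist => h; exists x.
  by apply: filterS h => p /= /ltW.
have cvgj j : exists l : R, (fun p : point => p j) @ F --> l.
  apply/cvg_ex/cauchy_cvgP/cauchyP => e e0.
  have [x hx] := Fx _ (divr_gt0 e0 (ltr0n _ 2)).
  exists (x j); suff : F [set p : point | ball (x j) e (p j)] by [].
  apply: filterS hx => p /= xp.
  rewrite /ball /=; apply: le_lt_trans (kdist_ge x p j) _.
  by rewrite (le_lt_trans xp)// ltr_pdivrMr// ltr_pMr// ltr1n.
pose l j := sval (cid (cvgj j)).
have hl j : (fun p : point => p j) @ F --> l j := svalP (cid (cvgj j)).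
have lx e x : F [set p | mdist x p <= e] -> forall j, `|l j - x j| <= e.
  move=> h j; apply/ler_addgt0Pr => r r0.
  have /cvgrPdist_le/(_ r r0) hr := hl j.
  have [p [/= p1 p2]] := filter_ex (filterI h hr).
  rewrite -(subrKA (p j)) addrC; apply: le_trans (ler_normD _ _) _.
  apply: lerD p2; rewrite distrC; exact: le_trans (kdist_ge x p j) p1.
have lP e : 0 < e -> exists i, forall j, `|l j - d i j| <= e.
  move=> e0; have e20 := divr_gt0 e0 (ltr0n R 2).
  have [x hx] := Fx _ e20; have [i hi] := kfunP x e20.
  exists i => j; rewrite -(subrKA (x j)) (splitr e).
  by apply: le_trans (ler_normD _ _) _; apply: lerD => //; exact: lx.
exists (KPoint lP) => U /nbhs_ballP[e /= e0 eU].
have e30 : 0 < e / 3 by rewrite divr_gt0.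
have [x hx] := Fx _ e30.
apply: filterS (hx) => p /= xp; apply: eU; rewrite ballEmdist /=.
apply: le_lt_trans (metric_triangle _ x _) _.
have h : mdist (KPoint lP : point) x <= e / 3.
  by apply: kdist_le => j; exact: lx hx j.
apply: le_lt_trans (lerD h xp) _.
lra.
Qed.

End kuratowski.

Section completion.
Context {R : realType} (L : language R).

Lemma complete_metric_real : complete_metric (R^o : metricType R).
Proof. by move=> F FF Fc; apply/cvg_ex; exact: (@cauchy_cvg R F FF Fc). Qed.

Lemma completion_exists (A : Mod L) : exists M, is_completion (sval A) M.
Proof.
move: (sval A) (set_valP A : Mod L (sval A)) => {}A [Ad Ai Ar Af].
pose P s := BoundedPseudometric (Ad s).1 (Ad s).2.
pose M s : metricType R := kpoint (P s).
pose iota s : nat -> M s := @kiota R (P s).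
have iotaE s i j : mdist (iota s i) (iota s j) = code_dist A s i j.
  exact: kiota_dist.
have relE r := extension (fun i => @kiota_dense R (P (rel_dom r i)))
  complete_metric_real (D := rel_mod r) (f := code_rel A r).
have {}relE r : exists g : (forall i, M (rel_dom r i)) -> R,
    [/\ forall x, g (fun i => iota _ (x i)) = code_rel A r x,
      forall p q, `|g p - g q| <= rel_mod r (\row_i mdist (p i) (q i)) &
      forall p e, 0 < e -> exists x, `|g p - code_rel A r x| <= e].
  case: (relE r) => [x y|g [g1 g2 g3]].
    rewrite /mdist /= distrC; apply: le_trans (Ar r x y) _.
    rewrite le_eqVlt; apply/orP; left; apply/eqP; congr (rel_mod r _).
    by apply/rowP => i; rewrite !mxE; exact/esym/iotaE.
  exists g; split=> // [p q|p e e0].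
    by have := g2 p q; rewrite {1}/mdist /= distrC.
  by have [x b] := g3 p e e0; exists x; move: b; rewrite {1}/mdist /= distrC.
have funE f : exists g : (forall i, M (func_dom f i)) -> M (func_cod f),
    (forall x, g (fun i => iota _ (x i)) = iota _ (code_func A f x)) /\
    forall p q, mdist (g p) (g q) <= func_mod f (\row_i mdist (p i) (q i)).
  have [x y|g [g1 g2 _]] := extension (fun i => @kiota_dense R (P (func_dom f i)))
    (@kpoint_complete R (P (func_cod f))) (D := func_mod f)
    (f := fun x => iota _ (code_func A f x)).
    rewrite iotaE; apply: le_trans (Af f x y) _.
    rewrite le_eqVlt; apply/orP; left; apply/eqP; congr (func_mod f _).
    by apply/rowP => i; rewrite !mxE; exact/esym/iotaE.
  by exists g.
pose ri r := sval (cid (relE r)); pose fi f := sval (cid (funE f)).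
have riP r := svalP (cid (relE r)); have fiP f := svalP (cid (funE f)).
have Minh s : [set: M s] !=set0 by exists (iota s 0).
have Mcompl s : complete_metric (M s) by exact: kpoint_complete.
have Mdiam s (x y : M s) : mdist x y <= sort_diam s.
  apply/ler_addgt0Pr => e e0; have e20 := divr_gt0 e0 (ltr0n R 2).
  have [i xi] := kiota_near x e20; have [j yj] := kiota_near y e20.
  apply: le_trans (metric_triangle _ (iota s i) _) _.
  apply: le_trans (lerD xi (metric_triangle _ (iota s j) _)) _.
  have : mdist (iota s i) (iota s j) <= sort_diam s by rewrite iotaE (Ad s).2.
  rewrite metric_sym in yj.
  have {}yj : mdist (iota s j) y <= e / 2 by [].
  lra.
have Mitv r x : rel_lo r <= ri r x <= rel_hi r.
  have [_ _ h] := riP r; apply/andP; split; apply/ler_addgt0Pr => e e0.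
    have [y] := h x e e0; have /andP[] := Ai r y; rewrite ler_norml /ri.
    by move=> h1 h2 /andP[h3 h4]; lra.
  have [y] := h x e e0; have /andP[] := Ai r y; rewrite ler_norml /ri.
  by move=> h1 h2 /andP[h3 h4]; lra.
have Mrel r x y : `|ri r x - ri r y| <= rel_mod r (\row_i mdist (x i) (y i)).
  by have [_ + _] := riP r; exact.
have Mfun f x y : mdist (fi f x) (fi f y) <= func_mod f (\row_i mdist (x i) (y i)).
  by have [_] := fiP f; exact.
exists (Structure Minh Mcompl Mdiam Mitv Mrel Mfun
  (fun c => iota _ (code_const A c))), iota; split=> //=.
- by move=> s; exact: kiota_dense.
- by move=> r x; have [+ _ _] := riP r; exact.
- by move=> f x; have [+ _] := fiP f; exact.
Qed.

Definition completion (A : Mod L) : structure L := projT1 (cid (completion_exists A)).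

Lemma completionP (A : Mod L) : is_completion (sval A) (completion A).
Proof. exact: projT2 (cid (completion_exists A)). Qed.

End completion.

Section analytic.
Variable R : realType.

Definition borel (T : topologicalType) : set (set T) := <<s [set U | open U] >>.

Definition borel_map (T U : topologicalType) (B : set T) (f : T -> U) : Prop :=
  forall V, borel V -> borel (B `&` f @^-1` V).

Definition separable_space (Z : topologicalType) : Prop :=
  exists2 D : set Z, countable D & dense D.

(* A is a Borel image of a Borel set; standard Borel spaces are the Borel spaces of
   complete separable metric spaces. *)
Definition analytic (T : topologicalType) (A : set T) : Prop :=
  exists Z : metricType R, [/\ complete_metric Z, separable_space Z &
  exists (B : set Z) (f : Z -> T), [/\ borel B, borel_map B f & A = f @` B]].

End analytic.

(* Main.v *)
Require Import Defs.
From mathcomp Require Import all_boot all_order all_algebra.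
From mathcomp Require Import ring lra.
From mathcomp Require Import all_classical all_reals all_analysis.

(** Both implications are instances of one statement about an analytic set of pairs of
codes, the graph of K, read in its two directions: [graph_transfer].  Fix [alpha] and suppose that no [theta] serves it: for every [beta] there
are A and B that are not [alpha]-equivalent although K(A) and K(B) are
[beta]-equivalent.  A boundedness argument then produces A and B, still separated at
level [alpha], with K(A) and K(B) isomorphic; so A and B are isomorphic, which is
absurd.

The relation of [alpha]-equivalence quantifies over uncountably many sentences, so its
complement is not visibly analytic.  It is replaced by a back-and-forth game of length
[alpha] played on codes, [bf].  A metric structure need not contain exact answers, so
each round also moves the earlier elements by a prescribed amount.  The induction
in [bf_feval] shows that a formula cannot vary along a position of the game by more than
its modulus allows; in particular [bf_equiv_rank] passes from the game to
equivalence, while isomorphic structures always survive the game [isomorphic_bf].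
Since [bf] is obtained from the values of the codes by countable Boolean operations
and every Borel set is Suslin, the pairs that lose the game form the projection of
a closed relation [suslin_refine], [bisuslin_bf].

For K(A) and K(B) one looks at the tree whose nodes are finite pieces of a witness
for that projection, together with finite plays (a_i), (b_i) in the two structures.
Two tuples of length n are indistinguishable at level [beta], [indist], when no formula
of rank at most [beta] with values between 0 and 1 and modulus at most [play_mod n] is 0 at
one of them and 1 at the other.  If they are so at level [beta + 1], every further
element on one side has an answer on the other side that keeps them so at
level [beta] ([indist_forth]: otherwise the infimum over the new variable of the
supremum of the countably many distinguishing formulas has rank [beta + 1], and its
modulus does not mention the new variable).  There are only countably many nodes, so a
node that is good for every [beta] has a successor that is good for every [beta],
whence an infinite branch [tree_branch].

The modulus allotted to the i-th element grows with i.  Each element of the two dense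
sets is played infinitely often, and its later copies are tested more and more
severely, so that their answers form a Cauchy sequence; the limits define
an isomorphism [limit_isomorphic].  No element is ever moved on this side, which is what
keeps the formulas of [indist_forth] elementary. *)

Set Implicit Arguments.
Unset Strict Implicit.
Unset Printing Implicit Defensive.

Import Order.TTheory GRing.Theory Num.Theory.
Import numFieldNormedType.Exports.

Local Open Scope classical_set_scope.
Local Open Scope ring_scope.

(** * Suprema, infima and uniformly continuous connectives *)

Section real_bounds.
Context {R : realType}.

Lemma sup_le_ge0 (S : set R) c : 0 <= c -> ubound S c -> sup S <= c.
Proof.
move=> c0 Sc; have [->|/set0P S0] := eqVneq S set0; first by rewrite sup0.
exact: ge_sup.
Qed.

Lemma inf_ge0 (S : set R) : lbound S 0 -> 0 <= inf S.
Proof.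
move=> Sc; have [->|/set0P S0] := eqVneq S set0; first by rewrite inf0.
exact: lb_le_inf.
Qed.

Lemma range_sup_ub (T : Type) (f : T -> R) c t : (forall t, f t <= c) ->
  f t <= sup (range f).
Proof. by move=> h; apply: ub_le_sup; [exists c => _ [? _ <-]|exists t]. Qed.

Lemma range_inf_lb (T : Type) (f : T -> R) c t : (forall t, c <= f t) ->
  inf (range f) <= f t.
Proof. by move=> h; apply: ge_inf; [exists c => _ [? _ <-]|exists t]. Qed.

Lemma range_sup_le (T : Type) (f : T -> R) c : [set: T] !=set0 ->
  (forall t, f t <= c) -> sup (range f) <= c.
Proof. by move=> [t _] h; apply: ge_sup; [exists (f t), t|move=> _ [? _ <-]]. Qed.

Lemma range_inf_ge (T : Type) (f : T -> R) c : [set: T] !=set0 ->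
  (forall t, c <= f t) -> c <= inf (range f).
Proof. by move=> [t _] h; apply: lb_le_inf; [exists (f t), t|move=> _ [? _ <-]]. Qed.

Lemma sup_dist_le (T U : Type) (f : T -> R) (g : U -> R) b c :
  [set: T] !=set0 -> [set: U] !=set0 ->
  (forall t, f t <= b) -> (forall u, g u <= b) ->
  (forall t e, 0 < e -> exists u, `|f t - g u| <= c + e) ->
  (forall u e, 0 < e -> exists t, `|f t - g u| <= c + e) ->
  `|sup (range f) - sup (range g)| <= c.
Proof.
move=> T0 U0 fb gb fg gf.
have h1 : sup (range g) <= sup (range f) + c.
  apply/ler_addgt0Pr => e e0; apply: range_sup_le => // u.
  have [t] := gf u e e0; rewrite ler_norml => /andP[h _].
  have := range_sup_ub t fb; lra.
have h2 : sup (range f) <= sup (range g) + c.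
  apply/ler_addgt0Pr => e e0; apply: range_sup_le => // t.
  have [u] := fg t e e0; rewrite ler_norml => /andP[_ h].
  have := range_sup_ub u gb; lra.
by rewrite ler_norml; apply/andP; split; lra.
Qed.

Lemma inf_rangeN (T : Type) (f : T -> R) :
  inf (range f) = - sup (range (fun t => - f t)).
Proof.
rewrite /inf; congr (- sup _); rewrite eqEsubset; split=> [_ [_ [t _ <-] <-]|_ [t _ <-]].
  by exists t.
by exists (f t) => //; exists t.
Qed.

Lemma inf_dist_le (T U : Type) (f : T -> R) (g : U -> R) b c :
  [set: T] !=set0 -> [set: U] !=set0 ->
  (forall t, b <= f t) -> (forall u, b <= g u) ->
  (forall t e, 0 < e -> exists u, `|f t - g u| <= c + e) ->
  (forall u e, 0 < e -> exists t, `|f t - g u| <= c + e) ->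
  `|inf (range f) - inf (range g)| <= c.
Proof.
move=> T0 U0 fb gb fg gf; rewrite !inf_rangeN -opprD normrN.
apply: (@sup_dist_le _ _ _ _ (- b)) => // [t|u|t e e0|u e e0]; rewrite ?lerN2 //.
  by have [u h] := fg t e e0; exists u; rewrite -opprD normrN.
by have [t h] := gf u e e0; exists t; rewrite -opprD normrN.
Qed.

Lemma fin_pos k (P : 'I_k -> R -> Prop) :
  (forall i d d', 0 < d' -> d' <= d -> P i d -> P i d') ->
  (forall i, exists2 d, 0 < d & P i d) -> exists2 d, 0 < d & forall i, P i d.
Proof.
move=> Pd Pe; have [f f0 fP] : exists2 f : 'I_k -> R, forall i, 0 < f i & forall i, P i (f i).
  exists (fun i => sval (cid2 (Pe i))) => i; first exact: s2valP (cid2 (Pe i)).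
  exact: s2valP' (cid2 (Pe i)).
have d0 : 0 < \big[Num.min/1]_i f i by apply: lt_bigmin => //; exact: ltr01.
by exists (\big[Num.min/1]_i f i) => // i; apply: Pd (fP i) => //; exact: bigmin_le.
Qed.

Lemma conn_unif k (u : 'rV[R]_k -> R) : unif_continuous u ->
  forall e, 0 < e -> exists2 d, 0 < d & forall y y' : 'rV[R]_k,
    (forall i, `|y 0 i - y' 0 i| <= d) -> `|u y - u y'| <= e.
Proof.
move=> uc e e0.
have : entourage [set xy : R * R | ball xy.1 e xy.2].
  by rewrite -entourage_ballE; exists e.
move=> /uc; rewrite nbhs_simpl /= -entourage_ballE => -[d /= d0 h].
exists (d / 2); first by rewrite divr_gt0.
move=> y y' yy'; have /h : [set xy : 'rV[R]_k * 'rV[R]_k | ball xy.1 d xy.2] (y, y').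
  split=> // i j; rewrite ord1 /ball /=; apply: le_lt_trans (yy' j) _.
  by rewrite ltr_pdivrMr// ltr_pMr// ltr1n.
by rewrite /ball /= => /ltW.
Qed.

Lemma lipschitz_conn (c : R) (u : R -> R) : 0 <= c ->
  (forall s t, `|u s - u t| <= c * `|s - t|) ->
  unif_continuous (fun y : 'rV[R]_1 => u (y 0 0)).
Proof.
move=> c0 hu A; rewrite nbhs_simpl /= -entourage_ballE => -[e /= e0 h].
rewrite -entourage_ballE; exists (e / (c + 1)).
  by rewrite /= divr_gt0// ltr_wpDl.
move=> [y y'] /= [_ yy']; apply: h; rewrite /ball /=.
apply: le_lt_trans (hu _ _) _; have := yy' 0 0; rewrite /ball /= => yy.
have c1 : 0 < c + 1 by rewrite ltr_wpDl.
move: yy; rewrite ltr_pdivlMr// => yy; apply: le_lt_trans yy.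
by rewrite mulrC ler_wpM2l// lerDl.
Qed.

(** A box is compact, so a uniformly continuous connective is bounded on it. This
   makes the suprema that define intervals and moduli of connectives finite. *)
Lemma conn_bounded k (u : 'rV[R]_k -> R) I : unif_continuous u ->
  exists b, forall y, box I y -> `|u y| <= b.
Proof.
move=> uc.
have cu : continuous u.
  move=> x V /nbhs_ballP[e /= e0 eV]; have e20 := divr_gt0 e0 (ltr0n R 2).
  have [d d0 h] := conn_unif uc e20.
  apply/nbhs_ballP; exists d => //= y [_ xy]; apply: eV; rewrite /ball /=.
  apply: (@le_lt_trans _ _ (e / 2)); last by rewrite ltr_pdivrMr// ltr_pMr// ltr1n.
  by apply: h => i; apply/ltW; exact: (xy 0 i).
have cb : compact (box I).
  have := rV_compact (A := fun i => `[(I i).1, (I i).2]%classic)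
    (fun i => @segment_compact R _ _).
  congr compact; apply/seteqP; split=> y hy i; have := hy i;
    by rewrite /= in_itv.
have /compact_bounded[M [_ hM]] := continuous_compact (continuous_subspaceT cu) cb.
exists (M + 1) => y By; apply: hM; first by rewrite ltrDl.
by exists y.
Qed.

End real_bounds.

(** * Values and moduli of formulas *)

Section formula_bounds.
Context {R : realType} (L : language R).

Lemma orthant_row_cons n a (x : 'rV[R]_n) : 0 <= a -> orthant R n x ->
  orthant R n.+1 (row_cons a x).
Proof. by move=> a0 x0 i; rewrite mxE; case: (unlift _ _) => /=. Qed.

Lemma term_mod_ge0 n (G : ctx L n) s (t : term G s) x :
  orthant R n x -> 0 <= term_mod t x.
Proof.
move=> x0; elim: t => //= f t IH; apply: modulus_ge0 => i; rewrite mxE.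
exact: IH.
Qed.

Lemma term_mod_orthant n (G : ctx L n) k (s : 'I_k -> lsort L)
  (t : forall i, term G (s i)) x :
  orthant R n x -> orthant R k (\row_i term_mod (t i) x).
Proof. by move=> x0 i; rewrite mxE term_mod_ge0. Qed.

Lemma term_mod_homo n (G : ctx L n) s (t : term G s) (x y : 'rV[R]_n) :
  orthant R n x -> (forall i, x 0 i <= y 0 i) -> term_mod t x <= term_mod t y.
Proof.
move=> x0 xy; elim: t => //= f t IH; apply: modulus_homo => [|i].
  exact: term_mod_orthant.
by rewrite !mxE.
Qed.

Lemma terms_small n (G : ctx L n) k (s : 'I_k -> lsort L)
  (t : forall i, term G (s i)) (D : modulus R k) :
  (forall i e, 0 < e -> exists2 d, 0 < d & forall x, orthant R n x ->
    (forall j, x 0 j <= d) -> term_mod (t i) x <= e) ->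
  forall e, 0 < e -> exists2 d, 0 < d & forall x, orthant R n x ->
    (forall i, x 0 i <= d) -> D (\row_i term_mod (t i) x) <= e.
Proof.
move=> ts e e0; have [d d0 hd] := modulus_small D e0.
have [|i|r r0 hr] := @fin_pos R k (fun i r => forall x, orthant R n x ->
    (forall j, x 0 j <= r) -> term_mod (t i) x <= d).
- by move=> i r r' _ r'r h x x0 xr; apply: h => // j; exact: le_trans (xr j) r'r.
- exact: ts.
- exists r => // x x0 xr; apply: hd => [|i]; first exact: term_mod_orthant.
  by rewrite mxE; exact: hr.
Qed.

Lemma term_mod_small n (G : ctx L n) s (t : term G s) e : 0 < e ->
  exists2 d, 0 < d & forall x, orthant R n x -> (forall i, x 0 i <= d) ->
    term_mod t x <= e.
Proof.
elim: t e => [i|c|f t IH] e e0 /=.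
- by exists e.
- by exists 1; [exact: ltr01|move=> *; exact: ltW].
- exact: terms_small.
Qed.

Lemma teval_mod (M : structure L) n (G : ctx L n) s (t : term G s) (e e' : env M G) :
  mdist (teval t e) (teval t e') <= term_mod t (\row_i mdist (e i) (e' i)).
Proof.
elim: t => [i|c|f t IH] /=; first by rewrite mxE.
  by rewrite mdistxx.
apply: le_trans (func_int_mod _ _) _; apply: modulus_homo => i; rewrite !mxE.
  exact: mdist_ge0.
exact: IH.
Qed.

Lemma row_cons_mdist (M : structure L) n (G : ctx L n) s (a b : M s)
  (e e' : env M G) :
  \row_i mdist (env_cons a e i) (env_cons b e' i) =
  row_cons (mdist a b) (\row_i mdist (e i) (e' i)).
Proof.
apply/rowP => i; rewrite !mxE /env_cons /ctx_cons.
by case: (unlift ord0 i) => //= j; rewrite mxE.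
Qed.

Lemma dist_orthant (M : structure L) n (G : ctx L n) (e e' : env M G) :
  orthant R n (\row_i mdist (e i) (e' i)).
Proof. by move=> i; rewrite mxE mdist_ge0. Qed.

(** The oscillations of a connective whose supremum is its modulus. *)
Definition osc_set n (G : ctx L n) k (u : 'rV[R]_k -> R)
    (phi : 'I_k -> preformula G) (x : 'rV[R]_n) :=
  [set z | exists y y', let B := box (fun i => fitv (phi i)) in
        [/\ B y, B y', forall i, `|y 0 i - y' 0 i| <= fmod (phi i) x &
            z = `|u y - u y'|]].

Lemma osc_set_ub n (G : ctx L n) k (u : 'rV[R]_k -> R)
    (phi : 'I_k -> preformula G) : unif_continuous u ->
  exists c, forall x, ubound (osc_set u phi x) c.
Proof.
move=> uc; have [b hb] := conn_bounded (fun i => fitv (phi i)) uc.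
exists (b + b) => x _ [y [y' [By By' _ ->]]].
by apply: le_trans (ler_normB _ _) _; apply: lerD; exact: hb.
Qed.

Lemma fmod_homo n (G : ctx L n) (phi : preformula G) : wf phi ->
  forall x y : 'rV[R]_n, orthant R n x -> (forall i, x 0 i <= y 0 i) ->
  fmod phi x <= fmod phi y.
Proof.
have rc m (x y : 'rV[R]_m) : (forall i, x 0 i <= y 0 i) ->
    forall i, row_cons 0 x 0 i <= row_cons 0 y 0 i.
  by move=> xy i; rewrite !mxE; case: (unlift _ _) => /=.
elim: phi => {n G} [n G r t|n G s t1 t2|n G k u phi IH|n G s phi IH|n G s phi IH
  |n G phi IH|n G phi IH] /=.
- move=> _ x y x0 xy; apply: modulus_homo => [|i]; first exact: term_mod_orthant.
  by rewrite !mxE; exact: term_mod_homo.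
- by move=> _ x y x0 xy; apply: lerD; exact: term_mod_homo.
- move=> [uc wphi] x y x0 xy; have [c hc] := osc_set_ub phi uc.
  apply: sup_le_ge0 => [|z [v [v' [Bv Bv' vv' zE]]]].
    change (0 <= sup (osc_set u phi y)).
    have [->|/set0P[z Sz]] := eqVneq (osc_set u phi y) set0; first by rewrite sup0.
    apply: (@le_trans _ _ z); last by apply: ub_le_sup => //; exists c; exact: hc.
    by move: Sz => [v [v' [_ _ _ ->]]].
  apply: ub_le_sup; first by exists c; exact: (hc y).
  by exists v, v'; split => // i; apply: le_trans (vv' i) _; exact: IH.
- by move=> wphi x y x0 xy; apply: IH => //;
    [exact: orthant_row_cons|exact: rc].
- by move=> wphi x y x0 xy; apply: IH => //;
    [exact: orthant_row_cons|exact: rc].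
- move=> [wphi [_ [D hD]]] x y x0 xy.
  have y0 : orthant R n y by move=> i; exact: le_trans (x0 i) (xy i).
  apply: range_sup_le => [|i]; first by exists 0%N.
  apply: le_trans (range_sup_ub i (fun i => hD i y y0)); exact: IH.
- move=> [wphi [_ [D hD]]] x y x0 xy.
  have y0 : orthant R n y by move=> i; exact: le_trans (x0 i) (xy i).
  apply: range_sup_le => [|i]; first by exists 0%N.
  apply: le_trans (range_sup_ub i (fun i => hD i y y0)); exact: IH.
Qed.

(** For countable suprema and infima this is where a common modulus of the family is
   indispensable: it gives one radius for all members. *)
Lemma fmod_small n (G : ctx L n) (phi : preformula G) : wf phi ->
  forall e, 0 < e -> exists2 d, 0 < d & forall x, orthant R n x ->
    (forall i, x 0 i <= d) -> fmod phi x <= e.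
Proof.
have quant m (H : ctx L m) s (psi : preformula (ctx_cons s H)) :
    (forall e, 0 < e -> exists2 d, 0 < d & forall x, orthant R m.+1 x ->
    (forall i, x 0 i <= d) -> fmod psi x <= e) ->
    forall e, 0 < e -> exists2 d, 0 < d & forall x, orthant R m x ->
    (forall i, x 0 i <= d) -> fmod psi (row_cons 0 x) <= e.
  move=> IH e /IH[d d0 h]; exists d => // x x0 xd; apply: h => [|i].
    exact: orthant_row_cons.
  by rewrite mxE; case: (unlift _ _) => //=; exact: ltW.
have csup m (H : ctx L m) (psi : nat -> preformula H) (D : modulus R m) :
    (forall i x, orthant R m x -> fmod (psi i) x <= D x) ->
    forall e, 0 < e -> exists2 d, 0 < d & forall x, orthant R m x ->
    (forall i, x 0 i <= d) -> sup (range (fun i => fmod (psi i) x)) <= e.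
  move=> hD e /(modulus_small D)[d d0 h]; exists d => // x x0 xd.
  apply: range_sup_le => [|i]; first by exists 0%N.
  by apply: le_trans (hD _ _ x0) _; exact: h.
elim: phi => {n G} [n G r t|n G s t1 t2|n G k u phi IH|n G s phi IH|n G s phi IH
  |n G phi IH|n G phi IH] /=.
- move=> _ e e0; apply: terms_small => // i d d0; exact: term_mod_small.
- move=> _ e e0; have e20 : 0 < e / 2 by rewrite divr_gt0.
  have [d1 d10 h1] := term_mod_small t1 e20.
  have [d2 d20 h2] := term_mod_small t2 e20.
  exists (Num.min d1 d2) => [|x x0 xd]; first by rewrite lt_min d10.
  rewrite [leRHS]splitr; apply: lerD.
    by apply: h1 => // i; apply: le_trans (xd i) _; rewrite ge_min lexx.
  by apply: h2 => // i; apply: le_trans (xd i) _; rewrite ge_min lexx orbT.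
- move=> [uc wphi] e e0; have [d d0 hd] := conn_unif uc e0.
  have [|i|r r0 hr] := @fin_pos R k (fun i r => forall x, orthant R n x ->
      (forall j, x 0 j <= r) -> fmod (phi i) x <= d).
  + by move=> i r r' _ r'r h x x0 xr; apply: h => // j; exact: le_trans (xr j) r'r.
  + exact: IH.
  + exists r => // x x0 xr; apply: sup_le_ge0 => [|z [v [v' [Bv Bv' vv' ->]]]].
      exact: ltW.
    by apply: hd => i; apply: le_trans (vv' i) _; exact: hr.
- by move=> /IH; exact: quant.
- by move=> /IH; exact: quant.
- by move=> [_ [_ [D hD]]]; exact: csup hD.
- by move=> [_ [_ [D hD]]]; exact: csup hD.
Qed.

Variable M : structure L.

Lemma feval_itv n (G : ctx L n) (phi : preformula G) : wf phi ->
  forall e : env M G, (fitv phi).1 <= feval phi e <= (fitv phi).2.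
Proof.
elim: phi => {n G} [n G r t|n G s t1 t2|n G k u phi IH|n G s phi IH|n G s phi IH
  |n G phi IH|n G phi IH] /=.
- by move=> _ e; exact: rel_int_itv.
- by move=> _ e; rewrite mdist_ge0 carrier_diam.
- move=> [uc wphi] e; have [b hb] := conn_bounded (fun i => fitv (phi i)) uc.
  have Be : box (fun i => fitv (phi i)) (\row_i feval (phi i) e).
    by move=> i; rewrite mxE; exact: IH.
  apply/andP; split; [apply: ge_inf|apply: ub_le_sup]; try by exists (\row_i feval (phi i) e).
    by exists (- b) => _ [y By <-]; have := hb y By; rewrite ler_norml => /andP[].
  by exists b => _ [y By <-]; have := hb y By; rewrite ler_norml => /andP[].
- move=> /IH{}IH e; have {}IH a := IH (env_cons a e).
  have [a _] := carrier_inhabited M s.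
  have h1 b : feval phi (env_cons b e) <= (fitv phi).2 by case/andP: (IH b).
  apply/andP; split; last by apply: range_sup_le => //; exists a.
  by apply: le_trans (range_sup_ub a h1); case/andP: (IH a).
- move=> /IH{}IH e; have {}IH a := IH (env_cons a e).
  have [a _] := carrier_inhabited M s.
  have h1 b : (fitv phi).1 <= feval phi (env_cons b e) by case/andP: (IH b).
  apply/andP; split; first by apply: range_inf_ge => //; exists a.
  by apply: le_trans (range_inf_lb a h1) _; case/andP: (IH a).
- move=> [wphi [[a [b ab]] _]] e.
  have lo i : a <= (fitv (phi i)).1 by case: (ab i).
  have hi i : (fitv (phi i)).2 <= b by case: (ab i).
  have hi' i : feval (phi i) e <= b.
    by case/andP: (IH i (wphi i) e) => _ /le_trans; apply.
  apply/andP; split.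
    apply: le_trans (range_inf_lb 0%N lo) _; apply: le_trans (range_sup_ub 0%N hi').
    by case/andP: (IH 0%N (wphi 0%N) e).
  apply: range_sup_le => [|i]; first by exists 0%N.
  by apply: le_trans (range_sup_ub i hi); case/andP: (IH i (wphi i) e).
- move=> [wphi [[a [b ab]] _]] e.
  have lo i : a <= (fitv (phi i)).1 by case: (ab i).
  have hi i : (fitv (phi i)).2 <= b by case: (ab i).
  have lo' i : a <= feval (phi i) e.
    by case/andP: (IH i (wphi i) e) => + _; exact: le_trans.
  apply/andP; split; last first.
    apply: le_trans (range_sup_ub 0%N hi); apply: le_trans (range_inf_lb 0%N lo') _.
    by case/andP: (IH 0%N (wphi 0%N) e).
  apply: range_inf_ge => [|i]; first by exists 0%N.
  by apply: le_trans (range_inf_lb i lo) _; case/andP: (IH i (wphi i) e).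
Qed.

Lemma feval_mod n (G : ctx L n) (phi : preformula G) : wf phi ->
  forall e e' : env M G,
  `|feval phi e - feval phi e'| <= fmod phi (\row_i mdist (e i) (e' i)).
Proof.
elim: phi => {n G} [n G r t|n G s t1 t2|n G k u phi IH|n G s phi IH|n G s phi IH
  |n G phi IH|n G phi IH] /=.
- move=> _ e e'; apply: le_trans (rel_int_mod _ _) _.
  apply: modulus_homo => i; rewrite !mxE; first exact: mdist_ge0.
  exact: teval_mod.
- move=> _ e e'.
  have h1 := teval_mod t1 e e'; have h2 := teval_mod t2 e e'.
  have := metric_triangle (teval t1 e) (teval t1 e') (teval t2 e).
  have := metric_triangle (teval t1 e') (teval t2 e') (teval t2 e).
  have := metric_triangle (teval t1 e') (teval t1 e) (teval t2 e').
  have := metric_triangle (teval t1 e) (teval t2 e) (teval t2 e').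
  rewrite [mdist (teval t1 e') (teval t1 e)]metric_sym.
  rewrite [mdist (teval t2 e') (teval t2 e)]metric_sym ler_norml.
  move=> *; apply/andP; split; lra.
- move=> [uc wphi] e e'; have [c hc] := osc_set_ub phi uc.
  apply: ub_le_sup; first by eexists; exact: hc.
  exists (\row_i feval (phi i) e), (\row_i feval (phi i) e'); split=> // [i|i|i].
  + by rewrite mxE; exact: feval_itv.
  + by rewrite mxE; exact: feval_itv.
  + by rewrite !mxE; exact: IH.
- move=> wphi e e'; have [a _] := carrier_inhabited M s.
  have h b : `|feval phi (env_cons b e) - feval phi (env_cons b e')| <=
      fmod phi (row_cons 0 (\row_i mdist (e i) (e' i))).
    by have := IH wphi (env_cons b e) (env_cons b e'); rewrite row_cons_mdist mdistxx.
  apply: (@sup_dist_le _ _ _ _ _ (fitv phi).2); try by exists a.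
  + by move=> b; case/andP: (feval_itv wphi (env_cons b e)).
  + by move=> b; case/andP: (feval_itv wphi (env_cons b e')).
  + by move=> b d d0; exists b; apply: ler_wpDr => //; exact: ltW.
  + by move=> b d d0; exists b; apply: ler_wpDr => //; exact: ltW.
- move=> wphi e e'; have [a _] := carrier_inhabited M s.
  have h b : `|feval phi (env_cons b e) - feval phi (env_cons b e')| <=
      fmod phi (row_cons 0 (\row_i mdist (e i) (e' i))).
    by have := IH wphi (env_cons b e) (env_cons b e'); rewrite row_cons_mdist mdistxx.
  apply: (@inf_dist_le _ _ _ _ _ (fitv phi).1); try by exists a.
  + by move=> b; case/andP: (feval_itv wphi (env_cons b e)).
  + by move=> b; case/andP: (feval_itv wphi (env_cons b e')).
  + by move=> b d d0; exists b; apply: ler_wpDr => //; exact: ltW.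
  + by move=> b d d0; exists b; apply: ler_wpDr => //; exact: ltW.
- move=> [wphi [[a [b ab]] [D hD]]] e e'.
  have hi (e1 : env M G) i : feval (phi i) e1 <= b.
    by case/andP: (feval_itv (wphi i) e1) => _ /le_trans; apply; case: (ab i).
  have hm i : `|feval (phi i) e - feval (phi i) e'| <=
      sup (range (fun i => fmod (phi i) (\row_j mdist (e j) (e' j)))).
    apply: le_trans (IH i (wphi i) e e') _.
    exact: (range_sup_ub i (fun i => hD i _ (dist_orthant e e'))).
  apply: (@sup_dist_le _ _ _ _ _ b) => //; try by exists 0%N.
  + by move=> i d d0; exists i; apply: ler_wpDr (hm i); exact: ltW.
  + by move=> i d d0; exists i; apply: ler_wpDr (hm i); exact: ltW.
- move=> [wphi [[a [b ab]] [D hD]]] e e'.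
  have lo (e1 : env M G) i : a <= feval (phi i) e1.
    by case/andP: (feval_itv (wphi i) e1) => + _; apply: le_trans; case: (ab i).
  have hm i : `|feval (phi i) e - feval (phi i) e'| <=
      sup (range (fun i => fmod (phi i) (\row_j mdist (e j) (e' j)))).
    apply: le_trans (IH i (wphi i) e e') _.
    exact: (range_sup_ub i (fun i => hD i _ (dist_orthant e e'))).
  apply: (@inf_dist_le _ _ _ _ _ a) => //; try by exists 0%N.
  + by move=> i d d0; exists i; apply: ler_wpDr (hm i); exact: ltW.
  + by move=> i d d0; exists i; apply: ler_wpDr (hm i); exact: ltW.
Qed.

End formula_bounds.

(** * The back-and-forth game on codes *)

Section code_semantics.
Context {R : realType} (L : language R).

(** The precisions of the game are these countably many numbers, so that quantifying
   over a precision is a countable operation. *)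
Definition eps (k : nat) : R := k.+1%:R^-1.

Lemma eps_gt0 k : 0 < eps k. Proof. by rewrite invr_gt0 ltr0n. Qed.

Lemma eps_le m n : (m <= n)%N -> eps n <= eps m.
Proof. by move=> mn; rewrite lef_pV2 ?posrE ?ltr0n// ler_nat. Qed.

Lemma eps_small e : 0 < e -> exists k, eps k < e.
Proof.
move=> e0; have [k hk] := ltr_add_invr e0; exists k.
by move: hk; rewrite add0r.
Qed.

(** The property of [is_completion] for a given dense enumeration. *)
Definition completes (A : coding_space L) (M : structure L)
    (iota : forall s, nat -> M s) : Prop :=
  [/\ forall s i j, mdist (iota s i) (iota s j) = code_dist A s i j,
      forall s, dense (range (iota s)),
      forall r x, rel_int M r (fun i => iota (rel_dom r i) (x i)) = code_rel A r x,
      forall f x, func_int M f (fun i => iota (func_dom f i) (x i)) =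
        iota (func_cod f) (code_func A f x) &
      forall c, const_int M c = iota (const_sort c) (code_const A c)].

Inductive atom n (G : ctx L n) : Type :=
| ARel (r : relsym L) (t : forall i, term G (rel_dom r i))
| ADist (s : lsort L) (t1 t2 : term G s).

Definition atom_formula n (G : ctx L n) (p : atom G) : preformula G :=
  match p with ARel _ t => FRel t | ADist _ t1 t2 => FDist t1 t2 end.

Lemma wf_atom n (G : ctx L n) (p : atom G) : wf (atom_formula p).
Proof. by case: p. Qed.

Fixpoint code_term (A : coding_space L) n (G : ctx L n) s (t : term G s)
    (a : 'I_n -> nat) : nat :=
  match t with
  | TVar i => a i
  | TConst c => code_const A c
  | TApp f t => code_func A f (fun i => code_term A (t i) a)
  end.

Definition code_atom (A : coding_space L) n (G : ctx L n) (p : atom G)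
    (a : 'I_n -> nat) : R :=
  match p with
  | ARel r t => code_rel A r (fun i => code_term A (t i) a)
  | ADist s t1 t2 => code_dist A s (code_term A t1 a) (code_term A t2 a)
  end.

Definition cons_nat n (c : nat) (a : 'I_n -> nat) : 'I_n.+1 -> nat :=
  fun i => oapp a c (unlift ord0 i).

Definition code_env (M : structure L) (iota : forall s, nat -> M s)
    n (G : ctx L n) (a : 'I_n -> nat) : env M G := fun i => iota (G i) (a i).

Lemma code_env_cons (M : structure L) (iota : forall s, nat -> M s)
    n (G : ctx L n) s c (a : 'I_n -> nat) :
  code_env iota (ctx_cons s G) (cons_nat c a) =
  env_cons (iota s c) (code_env iota G a).
Proof.
apply: functional_extensionality_dep => i.
by rewrite /code_env /env_cons /ctx_cons /cons_nat; case: (unlift ord0 i).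
Qed.

Section completes.
Context (A : coding_space L) (M : structure L) (iota : forall s, nat -> M s).
Hypothesis cM : completes A iota.

Lemma completes_dist s i j : mdist (iota s i) (iota s j) = code_dist A s i j.
Proof. by case: cM. Qed.

Lemma completes_dense s (x : M s) e : 0 < e -> exists i, mdist x (iota s i) < e.
Proof.
move=> e0; case: cM => _ + _ _ _ => /(_ s (ball x e)°)[||z].
- by exists x; exact: nbhsx_ballx x e e0.
- exact: open_interior.
- by move=> [/interior_subset + [k _ kz]]; rewrite -kz ballEmdist => /= ?; exists k.
Qed.

Lemma code_termE n (G : ctx L n) s (t : term G s) a :
  teval t (code_env iota G a) = iota s (code_term A t a).
Proof.
case: cM => _ _ _ cf cc; elim: t => //= f t IH; rewrite -cf; congr func_int.
exact: functional_extensionality_dep.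
Qed.

Lemma code_atomE n (G : ctx L n) (p : atom G) a :
  feval (atom_formula p) (code_env iota G a) = code_atom A p a.
Proof.
case: cM => cd _ cr _ _; case: p => [r t|s t1 t2] /=; last by rewrite !code_termE cd.
by rewrite -cr; congr rel_int; apply: functional_extensionality_dep => i;
  exact: code_termE.
Qed.

End completes.

Definition code_near (A : coding_space L) n (G : ctx L n) (a b : 'I_n -> nat)
    (k : nat) : Prop :=
  forall i, code_dist A (G i) (a i) (b i) <= eps k.

Lemma feval_near (A : coding_space L) (M : structure L) (iota : forall s, nat -> M s)
    (cM : completes A iota) n (G : ctx L n) (phi : preformula G) a b k :
  wf phi -> code_near A G a b k ->
  `|feval phi (code_env iota G a) - feval phi (code_env iota G b)| <=
    fmod phi (const_mx (eps k)).
Proof.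
move=> wphi ab; apply: le_trans (feval_mod wphi _ _) _.
apply: fmod_homo => // [|i]; first exact: dist_orthant.
by rewrite !mxE (completes_dist cM).
Qed.

(** Moving the parameters of a quantified formula costs its own modulus, because the
   bound variable does not move. *)
Lemma feval_near_cons (A : coding_space L) (M : structure L)
    (iota : forall s, nat -> M s)
    (cM : completes A iota) n (G : ctx L n) s (phi : preformula (ctx_cons s G)) x a b k :
  wf phi -> code_near A G a b k ->
  `|feval phi (env_cons x (code_env iota G a)) -
    feval phi (env_cons x (code_env iota G b))| <=
    fmod phi (row_cons 0 (const_mx (eps k))).
Proof.
move=> wphi ab; apply: le_trans (feval_mod wphi _ _) _.
rewrite row_cons_mdist mdistxx; apply: fmod_homo => // [|i].
  by apply: orthant_row_cons => //; exact: dist_orthant.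
rewrite !mxE; case: (unlift _ _) => //= j.
by rewrite !mxE (completes_dist cM).
Qed.

Lemma feval_dense (A : coding_space L) (M : structure L)
    (iota : forall s, nat -> M s)
    (cM : completes A iota) n (G : ctx L n) s (phi : preformula (ctx_cons s G))
    (x : M s) e d : wf phi -> 0 < d ->
  exists c, `|feval phi (env_cons x e) - feval phi (env_cons (iota s c) e)| <= d.
Proof.
move=> wphi d0; have [r r0 hr] := fmod_small wphi d0.
have [c xc] := completes_dense cM x r0; exists c.
apply: le_trans (feval_mod wphi _ _) _; apply: hr; first exact: dist_orthant.
rewrite row_cons_mdist => i; rewrite !mxE; case: (unlift _ _) => /= [j|].
  by rewrite mxE mdistxx ltW.
exact: ltW.
Qed.

End code_semantics.

Section back_and_forth.
Context {R : realType} (L : language R) (A A' : coding_space L).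

(** The game of length [beta] from the position (a, b) with tolerance [eps k]. In a
   round a player extends one tuple by an element; the answer extends the other tuple,
   after moving it by at most [eps k], and the game continues with an arbitrarily
   small tolerance. At the end, after a last move within the tolerance, any given
   atomic formula must take almost the same values. The element chosen and the new
   tolerance range over countable sets, which makes the relation Borel. *)
Fixpoint bf (beta : onotation) n (G : ctx L n) (a b : 'I_n -> nat) (k : nat) : Prop :=
  match beta with
  | ONzero => forall (p : atom G) k', exists2 b', code_near A' G b b' k &
      `|code_atom A p a - code_atom A' p b'| <= eps k'
  | ONsucc beta => [/\ bf beta G a b k,
      forall s c k', exists b' d, code_near A' G b b' k /\
        bf beta (ctx_cons s G) (cons_nat c a) (cons_nat d b') k' &
      forall s d k', exists a' c, code_near A G a a' k /\
        bf beta (ctx_cons s G) (cons_nat c a') (cons_nat d b) k']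
  | ONsup f => forall m, bf (f m) G a b k
  end.

Lemma bf_zero beta n (G : ctx L n) a b k : bf beta G a b k -> bf ONzero G a b k.
Proof. by elim: beta => [|beta IH|f IH] // => [[/IH]|/(_ 0%N)/IH]. Qed.

Context (M N : structure L) (iota : forall s, nat -> M s) (iota' : forall s, nat -> N s).
Hypotheses (cM : completes A iota) (cN : completes A' iota').

Lemma eps_near n d : 0 < d -> exists k, forall i, (const_mx (@eps R k) : 'rV[R]_n) 0 i <= d.
Proof. by move=> /eps_small[k hk]; exists k => i; rewrite mxE ltW. Qed.

Lemma const_orthant n k : orthant R n (const_mx (eps k)).
Proof. by move=> i; rewrite mxE ltW// eps_gt0. Qed.

(** The answer b', d of the game is exact up to the modulus of [phi] at a tolerance
   that may be taken as small as one likes; coming back from b' to b costs the modulus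
   of the quantified formula. *)
Lemma bf_forth beta n (G : ctx L n) s (phi : preformula (ctx_cons s G)) a b k :
  wf phi -> bf (ONsucc beta) G a b k ->
  (forall a b k, bf beta (ctx_cons s G) a b k ->
    `|feval phi (code_env iota _ a) - feval phi (code_env iota' _ b)| <=
      fmod phi (const_mx (eps k))) ->
  (forall x e, 0 < e -> exists y, `|feval phi (env_cons x (code_env iota G a)) -
      feval phi (env_cons y (code_env iota' G b))| <=
      fmod phi (row_cons 0 (const_mx (eps k))) + e) /\
  (forall y e, 0 < e -> exists x, `|feval phi (env_cons x (code_env iota G a)) -
      feval phi (env_cons y (code_env iota' G b))| <=
      fmod phi (row_cons 0 (const_mx (eps k))) + e).
Proof.
move=> wphi [_ forth back] IH; split=> x e e0; have e20 : 0 < e / 2 by rewrite divr_gt0.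
all: have [r r0 hr] := fmod_small wphi e20; have [k' hk'] := eps_near n.+1 r0.
- have [c hc] := feval_dense cM x (code_env iota G a) wphi e20.
  have [b' [d [bb' /IH]]] := forth s c k'; rewrite !code_env_cons => h.
  exists (iota' s d).
  have h1 := feval_near_cons cN (iota' s d) wphi bb'.
  have h2 := hr _ (@const_orthant _ k') hk'.
  move: hc h h1; rewrite !ler_norml => /andP[? ?] /andP[? ?] /andP[? ?].
  by apply/andP; split; lra.
- have [d hd] := feval_dense cN x (code_env iota' G b) wphi e20.
  have [a' [c [aa' /IH]]] := back s d k'; rewrite !code_env_cons => h.
  exists (iota s c).
  have h1 := feval_near_cons cM (iota s c) wphi aa'.
  have h2 := hr _ (@const_orthant _ k') hk'.
  move: hd h h1; rewrite !ler_norml => /andP[? ?] /andP[? ?] /andP[? ?].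
  by apply/andP; split; lra.
Qed.

(** The bound is the modulus itself, with no loss at each step of the formula; so it
   survives countable suprema without consuming any round, and the length of the game
   only has to match the quantifier rank. *)
Lemma bf_feval n (G : ctx L n) (phi : preformula G) : wf phi ->
  forall beta a b k, on_le (notation_of (qr phi)) beta -> bf beta G a b k ->
  `|feval phi (code_env iota G a) - feval phi (code_env iota' G b)| <=
    fmod phi (const_mx (eps k)).
Proof.
have atomic m (H : ctx L m) (p : atom H) beta a b k : bf beta H a b k ->
    `|feval (atom_formula p) (code_env iota H a) -
      feval (atom_formula p) (code_env iota' H b)| <=
    fmod (atom_formula p) (const_mx (eps k)).
  move=> /bf_zero h; apply/ler_addgt0Pr => e /eps_small[k' k'e].
  have [b' bb'] := h p k'; rewrite -(code_atomE cM) -(code_atomE cN) => h1.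
  have h2 := feval_near cN (wf_atom p) bb'.
  move: h1 h2; rewrite !ler_norml => /andP[? ?] /andP[? ?].
  by apply/andP; split; lra.
have quant m (H : ctx L m) s (psi : preformula (ctx_cons s H)) beta :
    (forall beta a b k, on_le (notation_of (qr psi)) beta -> bf beta (ctx_cons s H) a b k ->
      `|feval psi (code_env iota _ a) - feval psi (code_env iota' _ b)| <=
      fmod psi (const_mx (eps k))) ->
    on_le (notation_of (osucc (qr psi))) beta -> forall a b k, bf beta H a b k ->
    exists2 beta', bf (ONsucc beta') H a b k & on_le (notation_of (qr psi)) beta'.
  move=> IH hb a b k; have {hb} : on_le (ONsucc (notation_of (qr psi))) beta.
    apply: on_le_trans hb; exact: (on_ofK _).1.
  elim: beta => [|beta _|f IHf] //= hb; first by exists beta.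
  by move: hb => [i hi] h; exact: IHf hi (h i).
elim: phi => {n G} [n G r t|n G s t1 t2|n G j u phi IH|n G s phi IH|n G s phi IH
  |n G phi IH|n G phi IH].
- by move=> _ beta a b k _; exact: (atomic _ _ (ARel t)).
- by move=> _ beta a b k _; exact: (atomic _ _ (ADist t1 t2)).
- move=> [uc wphi] beta a b k hb h /=; have [c hc] := osc_set_ub phi uc.
  apply: ub_le_sup; first by eexists; exact: hc.
  exists (\row_i feval (phi i) (code_env iota G a)).
  exists (\row_i feval (phi i) (code_env iota' G b)); split=> // [i|i|i].
  + by rewrite mxE; exact: (feval_itv (wphi i)).
  + by rewrite mxE; exact: (feval_itv (wphi i)).
  + rewrite !mxE; apply: (IH i (wphi i) beta a b k _ h); apply: on_le_trans hb.
    apply/omega1_leP; rewrite !ordinal_ofK.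
    exact: (@le_bigmax _ _ _ ozero (fun i => qr (phi i))).
- move=> /= wphi beta a b k /(quant _ _ _ _ _ (IH wphi)) hb /hb[beta' h qb].
  have [h1 h2] := bf_forth wphi h (fun a b k => IH wphi beta' a b k qb).
  apply: (@sup_dist_le _ _ _ _ _ (fitv phi).2).
  + exact: carrier_inhabited.
  + exact: carrier_inhabited.
  + by move=> x; case/andP: (feval_itv wphi (env_cons x (code_env iota G a))).
  + by move=> x; case/andP: (feval_itv wphi (env_cons x (code_env iota' G b))).
  + exact: h1.
  + exact: h2.
- move=> /= wphi beta a b k /(quant _ _ _ _ _ (IH wphi)) hb /hb[beta' h qb].
  have [h1 h2] := bf_forth wphi h (fun a b k => IH wphi beta' a b k qb).
  apply: (@inf_dist_le _ _ _ _ _ (fitv phi).1).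
  + exact: carrier_inhabited.
  + exact: carrier_inhabited.
  + by move=> x; case/andP: (feval_itv wphi (env_cons x (code_env iota G a))).
  + by move=> x; case/andP: (feval_itv wphi (env_cons x (code_env iota' G b))).
  + exact: h1.
  + exact: h2.
- move=> [wphi [[lo [hi ab]] [D hD]]] beta a b k hb h /=.
  have bd (P : structure L) (e : env P G) i : feval (phi i) e <= hi.
    by case/andP: (feval_itv (wphi i) e) => _ /le_trans; apply; case: (ab i).
  have hm i : `|feval (phi i) (code_env iota G a) - feval (phi i) (code_env iota' G b)| <=
      sup (range (fun i => fmod (phi i) (const_mx (eps k)))).
    apply: le_trans (range_sup_ub i (fun i => hD i _ (@const_orthant _ _))).
    apply: (IH i (wphi i) beta a b k _ h); apply: on_le_trans hb.
    apply/omega1_leP; rewrite !ordinal_ofK; exact: ((osupP (fun i => qr (phi i)) _).1 (lexx _) i).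
  apply: (@sup_dist_le _ _ _ _ _ hi) => //; try by exists 0%N.
  + by move=> i d d0; exists i; apply: ler_wpDr (hm i); exact: ltW.
  + by move=> i d d0; exists i; apply: ler_wpDr (hm i); exact: ltW.
- move=> [wphi [[lo [hi ab]] [D hD]]] beta a b k hb h /=.
  have bd (P : structure L) (e : env P G) i : lo <= feval (phi i) e.
    by case/andP: (feval_itv (wphi i) e) => + _; apply: le_trans; case: (ab i).
  have hm i : `|feval (phi i) (code_env iota G a) - feval (phi i) (code_env iota' G b)| <=
      sup (range (fun i => fmod (phi i) (const_mx (eps k)))).
    apply: le_trans (range_sup_ub i (fun i => hD i _ (@const_orthant _ _))).
    apply: (IH i (wphi i) beta a b k _ h); apply: on_le_trans hb.
    apply/omega1_leP; rewrite !ordinal_ofK; exact: ((osupP (fun i => qr (phi i)) _).1 (lexx _) i).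
  apply: (@inf_dist_le _ _ _ _ _ lo) => //; try by exists 0%N.
  + by move=> i d d0; exists i; apply: ler_wpDr (hm i); exact: ltW.
  + by move=> i d d0; exists i; apply: ler_wpDr (hm i); exact: ltW.
Qed.

Definition empty_tuple : 'I_0 -> nat := fun=> 0%N.

Lemma bf_equiv_rank alpha k : bf (notation_of alpha) (@ctx0 R L) empty_tuple empty_tuple k ->
  equiv_rank alpha M N.
Proof.
move=> h sigma ws qs.
have e0 (P : structure L) (e e' : env P (@ctx0 R L)) : e = e'.
  by apply: functional_extensionality_dep; case.
rewrite (e0 M (env0 M) (code_env iota _ empty_tuple)) (e0 N (env0 N) (code_env iota' _ empty_tuple)).
apply/eqP; rewrite -subr_eq0 -normr_le0; apply/ler_addgt0Pr => e e_gt0; rewrite add0r.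
have [d d0 hd] := fmod_small ws e_gt0.
have qsa : on_le (notation_of (qr sigma)) (notation_of alpha).
  by apply/omega1_leP; rewrite !ordinal_ofK.
apply: le_trans (bf_feval ws qsa h) _; apply: hd; first exact: const_orthant.
by case.
Qed.

Section isomorphism.
Variables (h : forall s, M s -> N s) (g : forall s, N s -> M s).
Hypotheses (gK : forall s, cancel (@g s) (@h s)).
Hypothesis hphi : forall n (G : ctx L n) (phi : preformula G), wf phi ->
  forall e : env M G, feval phi e = feval phi (fun i => h (e i)).

Lemma iso_dist s (x y : M s) : mdist (h x) (h y) = mdist x y.
Proof.
pose G : ctx L 2 := fun=> s.
have := @hphi 2 G (FDist (TVar G ord0) (TVar G ord_max)) I
  (fun i => if i == ord0 then x else y).
by [].
Qed.

(** A point close to [x] can be approximated by the dense set without leaving a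
   prescribed neighbourhood of [b], as the inequalities are strict. *)
Lemma near_refine (P : structure L) (B : coding_space L) (j : forall s, nat -> P s)
    (cP : completes B j) n (G : ctx L n) (x : env P G) (b : 'I_n -> nat) k r : 0 < r ->
  (forall i, mdist (x i) (j (G i) (b i)) < eps k) ->
  exists2 b', code_near B G b b' k & forall i, mdist (x i) (j (G i) (b' i)) < r.
Proof.
move=> r0 xb.
have H i : exists c, code_dist B (G i) (b i) c <= eps k /\ mdist (x i) (j (G i) c) < r.
  have : 0 < Num.min r (eps k - mdist (x i) (j (G i) (b i))).
    by rewrite lt_min r0 subr_gt0 xb.
  move=> /(completes_dense cP (x i))[c]; rewrite lt_min => /andP[c1 c2]; exists c.
  split=> //; rewrite -(completes_dist cP); apply: le_trans (metric_triangle _ (x i) _) _.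
  by rewrite metric_sym; move: c2; lra.
exists (fun i => sval (cid (H i))) => i; by have [] := svalP (cid (H i)).
Qed.

(** The answers are approximations of the images under the isomorphism; the position
   stays within the tolerance of the graph of [h]. *)
Lemma iso_bf beta n (G : ctx L n) a b k :
  (forall i, mdist (h (iota (G i) (a i))) (iota' (G i) (b i)) < eps k) ->
  bf beta G a b k.
Proof.
elim: beta n G a b k => [|beta IH|f IH] n G a b k ab /=; last by move=> m; exact: IH.
- move=> p k'; have [r r0 hr] := fmod_small (wf_atom p) (eps_gt0 k').
  have [b' bb' ab'] := near_refine cN r0 ab; exists b' => //.
  rewrite -(code_atomE cM) -(code_atomE cN) hphi; last exact: wf_atom.
  apply: le_trans (feval_mod (wf_atom p) _ _) _; apply: hr; first exact: dist_orthant.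
  by move=> i; rewrite mxE; apply/ltW; exact: ab'.
- split; first exact: IH.
  + move=> s c k'; have [b' bb' ab'] := near_refine cN (eps_gt0 k') ab.
    have [d cd] := completes_dense cN (h (iota s c)) (eps_gt0 k').
    exists b', d; split=> //; apply: IH => i; rewrite /cons_nat /ctx_cons.
    by case: (unlift ord0 i) => [j|] /=.
  + move=> s d k'.
    have ba i : mdist (g (iota' (G i) (b i))) (iota (G i) (a i)) < eps k.
      by rewrite -iso_dist gK metric_sym.
    have [a' aa' ba'] := near_refine cM (eps_gt0 k') ba.
    have [c cd] := completes_dense cM (g (iota' s d)) (eps_gt0 k').
    exists a', c; split=> //; apply: IH => i; rewrite /cons_nat /ctx_cons.
    case: (unlift ord0 i) => [j|] /=; rewrite -[iota' _ _]gK iso_dist metric_sym //.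
Qed.

End isomorphism.

Lemma isomorphic_bf beta k : isomorphic M N -> bf beta (@ctx0 R L) empty_tuple empty_tuple k.
Proof.
move=> [h [hb hphi]].
have Hg s : exists g, cancel g (h s) by case: (hb s) => g _ gK; exists g.
by apply: (@iso_bf h (fun s => sval (cid (Hg s)))) => [s||[]//]; first exact: svalP (cid (Hg s)).
Qed.

End back_and_forth.

(** * Isomorphisms from infinite plays *)

Section atomic_isomorphism.
Context {R : realType} (L : language R) (M N : structure L).
Variable h : forall s, M s -> N s.
Hypothesis hbij : forall s, bijective (@h s).
Hypothesis hdist : forall s (x y : M s), mdist (h x) (h y) = mdist x y.
Hypothesis hrel : forall r x, rel_int N r (fun i => h (x i)) = rel_int M r x.
Hypothesis hfun : forall f x, func_int N f (fun i => h (x i)) = h (func_int M f x).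
Hypothesis hconst : forall c, const_int N c = h (const_int M c).

Lemma iso_teval n (G : ctx L n) s (t : term G s) (e : env M G) :
  teval t (fun i => h (e i)) = h (teval t e).
Proof.
elim: t => //= f t IH; rewrite -hfun; congr func_int.
exact: functional_extensionality_dep.
Qed.

Lemma iso_env_cons n (G : ctx L n) s (x : M s) (e : env M G) :
  (fun i => h (env_cons x e i)) = env_cons (h x) (fun i => h (e i)).
Proof.
apply: functional_extensionality_dep => i; rewrite /env_cons /ctx_cons.
by case: (unlift ord0 i).
Qed.

(** A bijection that preserves distances and symbols preserves every formula, since
   ranges of quantified variables correspond. *)
Lemma atomic_isomorphic : isomorphic M N.
Proof.
exists h; split=> // n G phi _.
have range_h m (H : ctx L m) s (psi : preformula (ctx_cons s H)) (e : env M H) :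
    (forall e : env M (ctx_cons s H), feval psi e = feval psi (fun i => h (e i))) ->
    range (fun a => feval psi (env_cons a e)) =
    range (fun a => feval psi (env_cons a (fun i => h (e i)))).
  move=> IH; apply/seteqP; split=> [_ [x _ <-]|_ [y _ <-]].
    by exists (h x) => //; rewrite -iso_env_cons -IH.
  have [g gK hK] := hbij s.
  by exists (g y) => //; rewrite IH iso_env_cons hK.
elim: phi => {n G} [n G r t|n G s t1 t2|n G j u phi IH|n G s phi IH|n G s phi IH
  |n G phi IH|n G phi IH] e /=.
- rewrite -hrel; congr rel_int; apply: functional_extensionality_dep => i.
  by rewrite iso_teval.
- by rewrite !iso_teval hdist.
- by congr u; apply/rowP => i; rewrite !mxE IH.
- by rewrite (range_h _ _ _ _ _ IH).
- by rewrite (range_h _ _ _ _ _ IH).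
- have -> : (fun i => feval (phi i) e) = (fun i => feval (phi i) (fun j => h (e j))) by apply/funext => i; exact: IH.
  by [].
- have -> : (fun i => feval (phi i) e) = (fun i => feval (phi i) (fun j => h (e j))) by apply/funext => i; exact: IH.
  by [].
Qed.

End atomic_isomorphism.

Section limit_relation.
Context {R : realType} (L : language R) (S : nat -> lsort L).
Implicit Types (M N : structure L) (A : coding_space L) (a b : nat -> nat).

(** Arbitrarily late stages of the play approximate both points at once. On the
   completions this relation is the graph of the isomorphism sought. *)
Definition matched M N (iota : forall s, nat -> M s) (iota' : forall s, nat -> N s)
    a b s (x : M s) (y : N s) : Prop :=
  forall e m, 0 < e -> exists i, [/\ (m <= i)%N, S i = s,
    mdist x (iota s (a i)) <= e & mdist y (iota' s (b i)) <= e].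

Definition dist_close A A' a b : Prop := forall m i j s, (m <= i)%N -> (m <= j)%N ->
  S i = s -> S j = s ->
  `|code_dist A s (a i) (a j) - code_dist A' s (b i) (b j)| <= eps m.

Definition recurrent a : Prop := forall s c m, exists i, [/\ (m <= i)%N, S i = s & a i = c].

(** Take stages whose left elements converge to x; the right elements are then Cauchy
   because late distances agree. *)
Lemma matched_ex A A' M N (iota : forall s, nat -> M s) (iota' : forall s, nat -> N s) a b :
  completes A iota -> completes A' iota' -> dist_close A A' a b -> recurrent a ->
  forall s (x : M s), exists y : N s, matched iota iota' a b x y.
Proof.
move=> cM cN hd ha s x.
have H n : exists i, [/\ (n <= i)%N, S i = s & mdist x (iota s (a i)) <= eps n].
  have [c xc] := completes_dense cM x (@eps_gt0 R n).
  by have [i [ni Si ai]] := ha s c n; exists i; split=> //; rewrite ai ltW.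
pose f n := sval (cid (H n)); pose u n := iota' s (b (f n)).
have fP n : [/\ (n <= f n)%N, S (f n) = s & mdist x (iota s (a (f n))) <= eps n]
  := svalP (cid (H n)).
have uc m n k : (m <= n)%N -> (m <= k)%N -> mdist (u n) (u k) <= 3 * eps m.
  move=> mn mk; have [nf Sn xn] := fP n; have [kf Sk xk] := fP k.
  have := hd m (f n) (f k) s (leq_trans mn nf) (leq_trans mk kf) Sn Sk.
  rewrite -(completes_dist cM) -(completes_dist cN) ler_norml => /andP[].
  have := metric_triangle (iota s (a (f n))) x (iota s (a (f k))).
  rewrite [mdist (iota s (a (f n))) x]metric_sym /u.
  have := @eps_le R _ _ mn; have := @eps_le R _ _ mk; lra.
have [l ul] : exists l : N s, u @ \oo --> l.
  apply: carrier_complete; apply/cauchyP => e e0.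
  have [m] := eps_small (divr_gt0 e0 (ltr0n R 4)); rewrite ltr_pdivlMr// => me.
  exists (u m); exists m => // n /= mn; rewrite ballEmdist /=.
  apply: le_lt_trans (uc m m n (leqnn _) mn) _.
  by have := @eps_gt0 R m; lra.
exists l => e m e0; have [k ke] := eps_small e0.
have [K _ hK] : \forall n \near \oo, ball l e (u n) by apply: ul; exact: nbhsx_ballx.
pose n := maxn m (maxn k K).
have [nf Sn xn] := fP n.
exists (f n); split=> //.
- by apply: leq_trans nf; rewrite leq_maxl.
- apply: le_trans xn _; apply: le_trans (ltW ke); apply: eps_le.
  by rewrite !leq_max leqnn orbT.
- have /hK : (K <= n)%N by rewrite !leq_max leqnn !orbT.
  by rewrite ballEmdist /= => /ltW.
Qed.

Lemma matched_sym M N (iota : forall s, nat -> M s) (iota' : forall s, nat -> N s)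
    a b s (x : M s) (y : N s) :
  matched iota iota' a b x y -> matched iota' iota b a y x.
Proof. by move=> h e m e0; have [i [? ? ? ?]] := h e m e0; exists i. Qed.

Section limit.
Variables (A A' : coding_space L) (M N : structure L).
Variables (iota : forall s, nat -> M s) (iota' : forall s, nat -> N s).
Hypotheses (cM : completes A iota) (cN : completes A' iota').
Variables a b : nat -> nat.
Hypothesis hd : dist_close A A' a b.
Hypothesis hr : forall r m, exists m0, forall i : 'I_(rel_arity r) -> nat,
  (forall l, (m0 <= i l)%N) -> (forall l, S (i l) = rel_dom r l) ->
  `|code_rel A r (a \o i) - code_rel A' r (b \o i)| <= eps m.
Hypothesis hf : forall f m, exists m0, forall (i : 'I_(func_arity f) -> nat) j,
  (forall l, (m0 <= i l)%N) -> (forall l, S (i l) = func_dom f l) ->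
  (m0 <= j)%N -> S j = func_cod f ->
  `|code_dist A (func_cod f) (code_func A f (a \o i)) (a j) -
    code_dist A' (func_cod f) (code_func A' f (b \o i)) (b j)| <= eps m.
Hypothesis hc : forall c m j, (m <= j)%N -> S j = const_sort c ->
  `|code_dist A (const_sort c) (code_const A c) (a j) -
    code_dist A' (const_sort c) (code_const A' c) (b j)| <= eps m.
Hypotheses (ha : recurrent a) (hb : recurrent b).

Local Notation matched := (matched iota iota' a b).

Lemma matched_dist s (x x' : M s) (y y' : N s) :
  matched x y -> matched x' y' -> mdist x x' = mdist y y'.
Proof.
move=> xy xy'; apply/eqP; rewrite -subr_eq0 -normr_le0.
apply/ler_addgt0Pr => e e0; rewrite add0r; have e50 : 0 < e / 5 by rewrite divr_gt0.
have [m me] := eps_small e50.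
have [i [mi Si xi yi]] := xy _ m e50; have [j [mj Sj xj yj]] := xy' _ m e50.
have := hd mi mj Si Sj; rewrite -(completes_dist cM) -(completes_dist cN) ler_norml => /andP[].
have := metric_triangle x (iota s (a i)) x'.
have := metric_triangle (iota s (a i)) (iota s (a j)) x'.
have := metric_triangle (iota s (a i)) x (iota s (a j)).
have := metric_triangle x x' (iota s (a j)).
have := metric_triangle y (iota' s (b i)) y'.
have := metric_triangle (iota' s (b i)) (iota' s (b j)) y'.
have := metric_triangle (iota' s (b i)) y (iota' s (b j)).
have := metric_triangle y y' (iota' s (b j)).
rewrite [mdist (iota s (a j)) x']metric_sym [mdist (iota s (a i)) x]metric_sym.
rewrite [mdist (iota' s (b j)) y']metric_sym [mdist (iota' s (b i)) y]metric_sym.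
by rewrite ler_norml => *; apply/andP; split; lra.
Qed.

Lemma matched_tuple k (s : 'I_k -> lsort L) (x : forall l, M (s l)) (y : forall l, N (s l))
    (D : modulus R k) : (forall l, matched (x l) (y l)) -> forall e m, 0 < e ->
  exists i : 'I_k -> nat, [/\ forall l, (m <= i l)%N, forall l, S (i l) = s l,
    D (\row_l mdist (x l) (iota (s l) (a (i l)))) <= e &
    D (\row_l mdist (y l) (iota' (s l) (b (i l)))) <= e].
Proof.
move=> xy e m e0; have [d d0 hD] := modulus_small D e0.
pose i l := sval (cid (xy l d m d0)).
have iP l : [/\ (m <= i l)%N, S (i l) = s l, mdist (x l) (iota (s l) (a (i l))) <= d &
   mdist (y l) (iota' (s l) (b (i l))) <= d] := svalP (cid (xy l d m d0)).
exists i; split=> [l|l||]; try by case: (iP l).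
- apply: hD => l; rewrite mxE; first exact: mdist_ge0.
  by case: (iP l).
- apply: hD => l; rewrite mxE; first exact: mdist_ge0.
  by case: (iP l).
Qed.

Lemma matched_rel r (x : forall l, M (rel_dom r l)) (y : forall l, N (rel_dom r l)) :
  (forall l, matched (x l) (y l)) -> rel_int N r y = rel_int M r x.
Proof.
move=> xy; apply/eqP; rewrite -subr_eq0 -normr_le0.
apply/ler_addgt0Pr => e e0; rewrite add0r; have e30 : 0 < e / 3 by rewrite divr_gt0.
have [m me] := eps_small e30; have [m0 h] := hr r m.
have [i [mi Si xi yi]] := matched_tuple (rel_mod r) xy m0 e30.
have := h i mi Si.
case: (cM) => _ _ <- _ _; case: (cN) => _ _ <- _ _.
have := le_trans (rel_int_mod _ _) xi; have := le_trans (rel_int_mod _ _) yi.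
rewrite /comp !ler_norml => /andP[? ?] /andP[? ?] /andP[? ?].
by apply/andP; split; lra.
Qed.

(** Late stages compare the distance from f(x) to its partner with that from f(y) to
   v; the former tends to 0. *)
Lemma matched_fun f (x : forall l, M (func_dom f l)) (y : forall l, N (func_dom f l)) v :
  (forall l, matched (x l) (y l)) -> matched (func_int M f x) v -> func_int N f y = v.
Proof.
move=> xy fv; apply: mdist_positivity; apply/eqP; rewrite eq_le mdist_ge0 andbT.
apply/ler_addgt0Pr => e e0; rewrite add0r; have e50 : 0 < e / 5 by rewrite divr_gt0.
have [m me] := eps_small e50; have [m0 h] := hf f m.
have [i [mi Si xi yi]] := matched_tuple (func_mod f) xy m0 e50.
have [j [mj Sj xj yj]] := fv _ m0 e50.
have := h i j mi Si mj Sj; rewrite -(completes_dist cM) -(completes_dist cN).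
case: (cM) => _ _ _ <- _; case: (cN) => _ _ _ <- _.
have h1 := le_trans (func_int_mod _ _) xi; have h2 := le_trans (func_int_mod _ _) yi.
move: h1 h2 xj yj; rewrite /comp.
set p := func_int M f x; set p' := func_int M f _.
set q := func_int N f y; set q' := func_int N f _ => h1 h2 h3 h4.
rewrite ler_norml => /andP[? ?].
have := metric_triangle p' p (iota (func_cod f) (a j)); rewrite [mdist p' p]metric_sym.
have := metric_triangle q q' v.
have := metric_triangle q' (iota' (func_cod f) (b j)) v.
rewrite [mdist (iota' (func_cod f) (b j)) v]metric_sym; lra.
Qed.

Lemma matched_const c v : matched (const_int M c) v -> const_int N c = v.
Proof.
move=> fv; apply: mdist_positivity; apply/eqP; rewrite eq_le mdist_ge0 andbT.
apply/ler_addgt0Pr => e e0; rewrite add0r; have e30 : 0 < e / 3 by rewrite divr_gt0.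
have [m me] := eps_small e30; have [j [mj Sj]] := fv _ m e30.
have := hc mj Sj; rewrite -(completes_dist cM) -(completes_dist cN).
case: (cM) => _ _ _ _ <-; case: (cN) => _ _ _ _ <-.
have := metric_triangle (const_int N c) (iota' (const_sort c) (b j)) v.
rewrite [mdist (iota' _ (b j)) v]metric_sym ler_norml => ? /andP[? ?]; lra.
Qed.

(** An infinite play with ever better agreement of the symbols is the trace of an
   isomorphism: the relation [matched] is the graph of an isometric bijection. *)
Lemma limit_isomorphic : isomorphic M N.
Proof.
have Mex := matched_ex cM cN hd ha.
have hd' : dist_close A' A b a.
  by move=> m i j s mi mj Si Sj; rewrite distrC; exact: hd.
have Nex := matched_ex cN cM hd' hb.
pose h s x := sval (cid (Mex s x)).
have hP s x : matched x (h s x) := svalP (cid (Mex s x)).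
pose g s y := sval (cid (Nex s y)).
have gP s y : matched (g s y) y := matched_sym (svalP (cid (Nex s y))).
apply: (@atomic_isomorphic _ _ _ _ h) => [s|s x y|r x|f x|c].
- exists (g s) => x; apply: mdist_positivity.
    by rewrite (matched_dist (gP s (h s x)) (hP s x)) mdistxx.
  by rewrite -(matched_dist (hP s (g s x)) (gP s x)) mdistxx.
- exact/esym/matched_dist.
- exact: matched_rel.
- exact: matched_fun.
- exact: matched_const.
Qed.

End limit.
End limit_relation.

(** * Moduli of continuity and the weights of a play *)

Section moduli.
Context {R : realType}.

Section mk_modulus.
Variables (n : nat) (D : 'rV[R]_n -> R).
Hypothesis D_ge0 : forall x, orthant R n x -> 0 <= D x.
Hypothesis D_homo : forall x y : 'rV[R]_n, orthant R n x -> (forall i, x 0 i <= y 0 i) ->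
  D x <= D y.
Hypothesis D_subadd : forall x y, orthant R n x -> orthant R n y -> D (x + y) <= D x + D y.
Hypothesis D0 : D 0 = 0.
Hypothesis D_small : forall e, 0 < e -> exists2 d, 0 < d &
  forall x, orthant R n x -> (forall i, x 0 i <= d) -> D x <= e.

(** By subadditivity and monotonicity D x <= D y + D |x - y|, so smallness near 0
   gives continuity on the whole orthant. *)
Lemma mk_modulus_continuous : {within orthant R n, continuous D}.
Proof.
apply/subspace_continuousP => x x0; apply/cvgrPdist_le => e e0.
have [d d0 hd] := D_small e0; rewrite near_withinE.
apply/nbhs_ballP; exists d => //= y [_ xy] y0.
have key (u v : 'rV[R]_n) : orthant R n u -> orthant R n v ->
    (forall i, `|u 0 i - v 0 i| <= d) -> D u <= D v + e.
  move=> u0 v0 uv; pose w : 'rV[R]_n := \row_i `|u 0 i - v 0 i|.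
  have w0 : orthant R n w by move=> i; rewrite mxE.
  apply: (@le_trans _ _ (D (v + w))).
    apply: D_homo => // i; rewrite !mxE; have := ler_norm (u 0 i - v 0 i); lra.
  apply: le_trans (D_subadd v0 w0) _; rewrite lerD2l; apply: hd => // i.
  by rewrite mxE.
have h1 : D x <= D y + e.
  by apply: key => // i; apply: ltW; exact: xy.
have h2 : D y <= D x + e.
  by apply: key => // i; rewrite distrC; apply: ltW; exact: xy.
by change (`|D x - D y| <= e); rewrite ler_norml; apply/andP; split; lra.
Qed.

Lemma mk_modulus : exists D' : modulus R n, forall x, D' x = D x.
Proof. by exists (Modulus D_ge0 mk_modulus_continuous D_homo D_subadd D0). Qed.

End mk_modulus.

Lemma modulus_zero n : exists D : modulus R n, forall x, D x = 0.
Proof.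
apply: (@mk_modulus n (fun=> 0)) => //.
by move=> e e0; exists 1 => // *; exact: ltW.
Qed.

Lemma modulus_coord n (i : 'I_n) : exists D : modulus R n, forall x, D x = x 0 i.
Proof.
apply: (@mk_modulus n (fun x => x 0 i)) => //.
- by move=> x y _ _; rewrite mxE.
- by rewrite mxE.
- by move=> e e0; exists e.
Qed.

Lemma modulus_add n (D1 D2 : modulus R n) :
  exists D : modulus R n, forall x, D x = D1 x + D2 x.
Proof.
apply: (@mk_modulus n (fun x => D1 x + D2 x)) => //.
- by move=> x x0; rewrite addr_ge0 ?modulus_ge0.
- by move=> x y x0 xy; rewrite lerD ?modulus_homo.
- by move=> x y x0 y0; rewrite addrACA lerD ?modulus_subadd.
- by rewrite !modulus0 addr0.
- move=> e e0; have e20 : 0 < e / 2 by rewrite divr_gt0.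
  have [d1 d10 h1] := modulus_small D1 e20; have [d2 d20 h2] := modulus_small D2 e20.
  exists (Num.min d1 d2) => [|x x0 xd]; first by rewrite lt_min d10.
  rewrite [leRHS]splitr lerD//.
    by apply: h1 => // i; apply: le_trans (xd i) _; rewrite ge_min lexx.
  by apply: h2 => // i; apply: le_trans (xd i) _; rewrite ge_min lexx orbT.
Qed.

Lemma modulus_scale n c (D1 : modulus R n) : 0 < c ->
  exists D : modulus R n, forall x, D x = c * D1 x.
Proof.
move=> c0; have c0' := ltW c0.
apply: (@mk_modulus n (fun x => c * D1 x)) => //.
- by move=> x x0; rewrite mulr_ge0 ?modulus_ge0.
- by move=> x y x0 xy; rewrite ler_wpM2l ?modulus_homo.
- by move=> x y x0 y0; rewrite -mulrDr ler_wpM2l ?modulus_subadd.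
- by rewrite modulus0 mulr0.
- move=> e e0; have [d d0 h] := modulus_small D1 (divr_gt0 e0 c0).
  by exists d => // x x0 xd; rewrite mulrC -ler_pdivlMr// h.
Qed.

Lemma modulus_reindex n m (rho : 'I_m -> 'I_n) (D1 : modulus R m) :
  exists D : modulus R n, forall x, D x = D1 (\row_i x 0 (rho i)).
Proof.
have o x : orthant R n x -> orthant R m (\row_i x 0 (rho i)).
  by move=> x0 i; rewrite mxE; exact: x0.
apply: (@mk_modulus n (fun x => D1 (\row_i x 0 (rho i)))) => //.
- by move=> x /o; exact: modulus_ge0.
- by move=> x y /o x0 xy; apply: modulus_homo => // i; rewrite !mxE.
- move=> x y /o x0 /o y0; apply: le_trans (modulus_subadd _ x0 y0).
  by have -> : \row_i (x + y) 0 (rho i) = \row_i x 0 (rho i) + \row_i y 0 (rho i)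
    by apply/rowP => i; rewrite !mxE.
- have -> : \row_i (0 : 'rV[R]_n) 0 (rho i) = 0 by apply/rowP => i; rewrite !mxE.
  exact: modulus0.
- move=> e e0; have [d d0 h] := modulus_small D1 e0.
  by exists d => // x /o x0 xd; apply: h => // i; rewrite mxE.
Qed.

Lemma modulus_sum n (D : nat -> modulus R n) k :
  exists D' : modulus R n, forall x, D' x = \sum_(i < k) D i x.
Proof.
elim: k => [|k [D' hD']].
  by have [D' h] := modulus_zero n; exists D' => x; rewrite big_ord0.
have [D'' h] := modulus_add D' (D k).
by exists D'' => x; rewrite big_ord_recr /= h hD'.
Qed.

End moduli.

Lemma countable_enumeration (T : Type) : countable [set: T] ->
  exists e : nat -> option T, forall t, exists j, e j = Some t.
Proof.
move=> /countable_injP[f fi].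
exists (fun j => if pselect (exists t, f t = j) is left H then Some (sval (cid H)) else None).
move=> t; exists (f t); case: pselect => [H|]; last by case; exists t.
by congr Some; apply: fi; rewrite ?inE//; exact: svalP (cid H).
Qed.

Section weights.
Context {R : realType} (L : language R).

(** [w i] is the modulus allotted to the i-th element of the play. Each symbol may be
   tested on all late elements, with a factor that tends to infinity with the
   stage. *)
Record weights (w : nat -> modulus R 1) : Prop := Weights {
  w_dist : forall i z, 0 <= z -> i.+1%:R * (z + z) <= w i (const_mx z);
  w_rel : forall r : relsym L, exists m, forall i z, (m <= i)%N -> 0 <= z ->
    i.+1%:R * rel_mod r (const_mx z) <= w i (const_mx z);
  w_fun : forall f : funsym L, exists m, forall i z, (m <= i)%N -> 0 <= z ->
    i.+1%:R * (func_mod f (const_mx z) + z) <= w i (const_mx z) }.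

Lemma const_mx_orthant n (z : R) : 0 <= z -> orthant R n (const_mx z).
Proof. by move=> z0 i; rewrite mxE. Qed.

(** The i-th weight adds up the diagonal moduli of the first i symbols, multiplied by
   i + 1. *)
Lemma weights_exist : countable_language L -> exists w, weights w.
Proof.
move=> [_ cr cf _].
have [er hr] := countable_enumeration cr; have [ef hf] := countable_enumeration cf.
have Hr j : exists D : modulus R 1, forall r, er j = Some r ->
    forall z, D (const_mx z) = rel_mod r (const_mx z).
  case: (er j) => [r|]; last by have [D _] := @modulus_zero R 1; exists D.
  have [D hD] := modulus_reindex (fun=> ord0 : 'I_1) (rel_mod r).
  exists D => _ [<-] z; rewrite hD; congr (rel_mod r _).
  by apply/rowP => i; rewrite !mxE.
have Hf j : exists D : modulus R 1, forall f, ef j = Some f ->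
    forall z, D (const_mx z) = func_mod f (const_mx z).
  case: (ef j) => [f|]; last by have [D _] := @modulus_zero R 1; exists D.
  have [D hD] := modulus_reindex (fun=> ord0 : 'I_1) (func_mod f).
  exists D => _ [<-] z; rewrite hD; congr (func_mod f _).
  by apply/rowP => i; rewrite !mxE.
pose Dr j := sval (cid (Hr j)); pose Df j := sval (cid (Hf j)).
have Hw i : exists D : modulus R 1, forall x, D x = i.+1%:R *
    (x 0 0 + x 0 0 + (\sum_(j < i) Dr j x + \sum_(j < i) Df j x)).
  have [D1 h1] := @modulus_coord R 1 0.
  have [D2 h2] := modulus_add D1 D1.
  have [D3 h3] := modulus_sum Dr i; have [D4 h4] := modulus_sum Df i.
  have [D5 h5] := modulus_add D3 D4; have [D6 h6] := modulus_add D2 D5.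
  have i0 : 0 < i.+1%:R :> R by rewrite ltr0n.
  have [D7 h7] := modulus_scale D6 i0.
  by exists D7 => x; rewrite h7 h6 h5 h4 h3 h2 !h1.
exists (fun i => sval (cid (Hw i))).
have sum_ge (D : nat -> modulus R 1) i j z : 0 <= z -> (j < i)%N ->
    D j (const_mx z) <= \sum_(j < i) D j (const_mx z).
  move=> z0 ji; rewrite (bigD1 (Ordinal ji)) //= lerDl sumr_ge0// => k _.
  by rewrite modulus_ge0//; exact: const_mx_orthant.
have sum_ge0 (D : nat -> modulus R 1) i z : 0 <= z ->
    0 <= \sum_(j < i) D j (const_mx z).
  by move=> z0; rewrite sumr_ge0// => k _; rewrite modulus_ge0//; exact: const_mx_orthant.
split=> [i z z0|r|f].
- rewrite (svalP (cid (Hw i))) ler_wpM2l ?ler0n// !mxE.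
  by have := sum_ge0 Dr i z z0; have := sum_ge0 Df i z z0; lra.
- have [j jr] := hr r; exists j.+1 => i z ji z0.
  rewrite (svalP (cid (Hw i))) ler_wpM2l ?ler0n// !mxE.
  have := sum_ge Dr i j z z0 ji; rewrite (svalP (cid (Hr j)) r jr).
  by have := sum_ge0 Df i z z0; lra.
- have [j jf] := hf f; exists j.+1 => i z ji z0.
  rewrite (svalP (cid (Hw i))) ler_wpM2l ?ler0n// !mxE.
  have := sum_ge Df i j z z0 ji; rewrite (svalP (cid (Hf j)) f jf).
  by have := sum_ge0 Dr i z z0; lra.
Qed.

End weights.

(** * Formulas with prescribed moduli along a play *)

Section bounded_formulas.
Context {R : realType} (L : language R) (S : nat -> lsort L) (w : nat -> modulus R 1).

Fixpoint play_ctx n : ctx L n :=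
  if n is m.+1 then ctx_cons (S m) (@play_ctx m) else @ctx0 R L.
Arguments play_ctx n _ : clear implicits.

Fixpoint play_tuple (a : nat -> nat) n : 'I_n -> nat :=
  if n is m.+1 then cons_nat (a m) (@play_tuple a m) else empty_tuple.
Arguments play_tuple a n _ : clear implicits.

(** The sum of the weights of the elements; adding a variable leaves the part that
   concerns the earlier ones unchanged. *)
Fixpoint play_mod n : modulus R n :=
  if n is m.+1 then
    sval (cid (modulus_add (sval (cid (modulus_reindex (fun=> ord0) (w m))))
                           (sval (cid (modulus_reindex (lift ord0) (play_mod m))))))
  else sval (cid (@modulus_zero R 0)).

Lemma play_modS n (x : 'rV[R]_n.+1) :
  play_mod n.+1 x = w n (const_mx (x 0 0)) + play_mod n (\row_i x 0 (lift ord0 i)).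
Proof.
rewrite /= (svalP (cid (modulus_add _ _))) (svalP (cid (modulus_reindex _ _))).
rewrite (svalP (cid (modulus_reindex _ _))); congr (w n _ + _).
by apply/rowP => i; rewrite !mxE.
Qed.

Lemma play_mod_row_cons n y (x : 'rV[R]_n) :
  play_mod n.+1 (row_cons y x) = w n (const_mx y) + play_mod n x.
Proof.
rewrite play_modS !mxE unlift_none /=; congr (_ + play_mod n _).
by apply/rowP => i; rewrite !mxE liftK.
Qed.

(** The bound on the modulus is what lets late elements be tested severely and early
   ones only mildly. *)
Definition testable (beta : omega1) n (phi : preformula (play_ctx n)) : Prop :=
  [/\ wf phi, (qr phi <= beta)%O, 0 <= (fitv phi).1, (fitv phi).2 <= 1 &
      forall x, orthant R n x -> fmod phi x <= play_mod n x].

Lemma osc_le_fmod n (G : ctx L n) k (u : 'rV[R]_k -> R) (phi : 'I_k -> preformula G) x c :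
  0 <= c -> (forall y y' : 'rV[R]_k, (forall i, `|y 0 i - y' 0 i| <= fmod (phi i) x) ->
    `|u y - u y'| <= c) -> fmod (FConn u phi) x <= c.
Proof. by move=> c0 h; apply: sup_le_ge0 => // _ [y [y' [_ _ yy' ->]]]; exact: h. Qed.

Lemma fitv_conn_bounds n (G : ctx L n) k (u : 'rV[R]_k -> R) (phi : 'I_k -> preformula G) :
  (forall y, box (fun i => fitv (phi i)) y -> 0 <= u y <= 1) ->
  0 <= (fitv (FConn u phi)).1 /\ (fitv (FConn u phi)).2 <= 1.
Proof.
move=> h; split=> /=.
  by apply: inf_ge0 => _ [y /h /andP[? _] <-].
by apply: sup_le_ge0 => // _ [y /h /andP[_ ?] <-].
Qed.

Lemma ozero_le (x : omega1) : (ozero <= x)%O.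
Proof. by rewrite -(ordinal_ofK x); apply/omega1_leP. Qed.

Lemma qr_conn1_le n (G : ctx L n) (u : 'rV[R]_1 -> R) (phi : preformula G) beta :
  (qr phi <= beta)%O -> (qr (FConn u (fun=> phi)) <= beta)%O.
Proof. by move=> h /=; apply: bigmax_le => //; exact: ozero_le. Qed.

(** Replacing [phi] by [1 - phi] makes one-sided tests symmetric. *)
Lemma testable_compl beta n (phi : preformula (play_ctx n)) : testable beta phi ->
  testable beta (FConn (fun y : 'rV[R]_1 => 1 - y 0 0) (fun=> phi)).
Proof.
move=> [wphi qphi lo hi hm].
have [lo' hi'] := @fitv_conn_bounds n _ 1 (fun y => 1 - y 0 0) (fun=> phi)
  (fun y hy => ltac:(by have /andP[? ?] := hy 0; apply/andP; split; lra)).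
split=> //=.
- split=> //; apply: (@lipschitz_conn R 1 (fun t => 1 - t)) => // s t.
  by rewrite mul1r distrC; have -> : 1 - t - (1 - s) = s - t by ring.
- exact: (qr_conn1_le (fun y => 1 - y 0 0) qphi).
- move=> x x0; apply: osc_le_fmod => [|y y' h]; first exact: modulus_ge0.
  apply: le_trans (hm x x0); have -> : 1 - y 0 0 - (1 - y' 0 0) = - (y 0 0 - y' 0 0) by ring.
  by rewrite normrN.
Qed.

(** Thresholds instead of equal values, because an exact answer to a move need not
   exist in a metric structure. *)
Definition indist beta n (M N : structure L) (iota : forall s, nat -> M s)
    (iota' : forall s, nat -> N s) (a b : 'I_n -> nat) : Prop :=
  forall phi : preformula (play_ctx n), testable beta phi ->
    feval phi (code_env iota _ a) = 0 -> feval phi (code_env iota' _ b) < 1.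

Lemma indist_sym beta n (M N : structure L) (iota : forall s, nat -> M s)
    (iota' : forall s, nat -> N s) (a b : 'I_n -> nat) :
  indist beta iota iota' a b -> indist beta iota' iota b a.
Proof.
move=> h phi tphi b0; rewrite lt_neqAle; apply/andP; split; last first.
  by have [wphi _ _ hi _] := tphi; have /andP[_ /le_trans] :=
    feval_itv wphi (code_env iota _ a); exact.
apply/eqP => a1; have := h _ (testable_compl tphi).
by rewrite /= !mxE a1 b0 subrr subr0 ltxx => /(_ erefl).
Qed.

Lemma indist_le beta beta' n (M N : structure L) (iota : forall s, nat -> M s)
    (iota' : forall s, nat -> N s) (a b : 'I_n -> nat) : (beta' <= beta)%O ->
  indist beta iota iota' a b -> indist beta' iota iota' a b.
Proof.
move=> bb h phi [wphi qphi lo hi hm]; apply: h; split=> //.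
exact: le_trans bb.
Qed.

Lemma osucc_le (x y : omega1) : (x <= y)%O -> (osucc x <= osucc y)%O.
Proof.
move=> /asboolP xy; apply/omega1_leP => /=; exact: xy.
Qed.

(** If every candidate d is refuted by some [phi d], the formula inf_y sup_d phi_d(x,
   y) is 0 at a, where y = c. At b it is 1: any y is close to some d of the dense set,
   and the common modulus of the [phi d] carries the value 1 at d over to y. *)
Lemma indist_forth beta n (M N : structure L) (iota : forall s, nat -> M s)
    (iota' : forall s, nat -> N s) (B : coding_space L) (cN : completes B iota')
    (a b : 'I_n -> nat) :
  indist (osucc beta) iota iota' a b ->
  forall c, exists d, indist beta (n := n.+1) iota iota' (cons_nat c a) (cons_nat d b).
Proof.
move=> h c; apply: contrapT => /forallNP nd.
have H d : exists phi : preformula (play_ctx n.+1), [/\ testable beta phi,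
    feval phi (env_cons (iota (S n) c) (code_env iota (play_ctx n) a)) = 0 &
    1 <= feval phi (env_cons (iota' (S n) d) (code_env iota' (play_ctx n) b))].
  have /existsNP[phi /not_implyP[tphi /not_implyP[phi0 /negP phi1]]] := nd d.
  exists phi; split=> //; first by rewrite -code_env_cons.
  by rewrite -code_env_cons leNgt.
pose phi d := sval (cid (H d)).
have phiP d : [/\ testable beta (phi d),
    feval (phi d) (env_cons (iota (S n) c) (code_env iota (play_ctx n) a)) = 0 &
    1 <= feval (phi d) (env_cons (iota' (S n) d) (code_env iota' (play_ctx n) b))] := svalP (cid (H d)).
have wphi d : wf (phi d) by have [[]] := phiP d.
have lo d : 0 <= (fitv (phi d)).1 by have [[]] := phiP d.
have hi d : (fitv (phi d)).2 <= 1 by have [[]] := phiP d.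
have hm d x : orthant R n.+1 x -> fmod (phi d) x <= play_mod n.+1 x.
  by have [[_ _ _ _ +] _ _] := phiP d; exact.
have ge0 (P : structure L) (e : env P (play_ctx n.+1)) d : 0 <= feval (phi d) e.
  by case/andP: (feval_itv (wphi d) e) => + _; exact: le_trans.
have le1 (P : structure L) (e : env P (play_ctx n.+1)) d : feval (phi d) e <= 1.
  by case/andP: (feval_itv (wphi d) e) => _ /le_trans; apply.
pose chi : preformula (play_ctx n) := FInf (s := S n) (FCsup phi).
have tchi : testable (osucc beta) chi.
  split=> /=.
  + split=> //; split; first by exists 0, 1.
    by exists (play_mod n.+1).
  + apply: osucc_le; apply/osupP => d; by have [[]] := phiP d.
  + by apply: range_inf_ge => //; exists 0%N.
  + by apply: range_sup_le => //; exists 0%N.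
  + move=> x x0; apply: range_sup_le => [|d]; first by exists 0%N.
    have x1 : orthant R n.+1 (row_cons 0 x) by exact: orthant_row_cons.
    apply: le_trans (hm d _ x1) _; rewrite play_mod_row_cons.
    have -> : const_mx 0 = 0 :> 'rV[R]_1 by apply/rowP => i; rewrite !mxE.
    by rewrite modulus0 add0r.
have chi0 : feval chi (code_env iota (play_ctx n) a) = 0.
  apply/eqP; rewrite eq_le; apply/andP; split.
    apply: le_trans (range_inf_lb (c := 0) (iota (S n) c) _) _ => [x|].
      by apply: le_trans (range_sup_ub 0%N (le1 _ _)); exact: ge0.
    apply: range_sup_le => [|d]; first by exists 0%N.
    by have [_ E _] := phiP d; rewrite le_eqVlt; apply/orP; left; apply/eqP.
  apply: range_inf_ge => [|x]; first exact: carrier_inhabited.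
  by apply: le_trans (range_sup_ub 0%N (le1 _ _)); exact: ge0.
have := h chi tchi chi0; rewrite ltNge => /negP; apply.
apply: range_inf_ge => [|y].
    exact: carrier_inhabited.
  apply/ler_addgt0Pr => e e0; have [r r0 hr] := modulus_small (w n) e0.
  have [d yd] := completes_dense cN y r0.
  apply: (@le_trans _ _ (feval (phi d) (env_cons y (code_env iota' (play_ctx n) b)) + e));
    last by rewrite lerD2r; exact: (range_sup_ub d (le1 _ _)).
  have [_ _ phi1] := phiP d; apply: le_trans phi1 _.
  have := feval_mod (wphi d) (env_cons y (code_env iota' (play_ctx n) b))
    (env_cons (iota' (S n) d) (code_env iota' (play_ctx n) b)).
  rewrite row_cons_mdist; set x := row_cons _ _.
  have x0 : orthant R n.+1 x.
    by apply: orthant_row_cons; [exact: mdist_ge0|exact: dist_orthant].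
  move=> /le_trans /(_ (hm d x x0)); rewrite play_mod_row_cons.
  have -> : \row_i mdist (code_env iota' (play_ctx n) b i)
     (code_env iota' (play_ctx n) b i) = 0 by apply/rowP => i; rewrite !mxE mdistxx.
  rewrite modulus0 addr0 ler_norml => /andP[+ _].
  have := hr (const_mx (mdist y (iota' (S n) d)))
    (const_mx_orthant (mdist_ge0 _ _)) (fun i => ltac:(by rewrite mxE; exact: ltW)).
  lra.
Qed.

Lemma equiv_rank_indist beta (M N : structure L) (iota : forall s, nat -> M s)
    (iota' : forall s, nat -> N s) : equiv_rank beta M N ->
  indist beta (n := 0) iota iota' empty_tuple empty_tuple.
Proof.
move=> MN phi [wphi qphi _ _ _].
have e0 (P : structure L) (e e' : env P (@ctx0 R L)) : e = e'.
  by apply: functional_extensionality_dep; case.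
rewrite (e0 M (code_env iota _ empty_tuple) (env0 M)) (e0 N (code_env iota' _ empty_tuple) (env0 N)).
by rewrite (MN phi) // => ->; exact: ltr01.
Qed.

Section atoms.
Context (A B : coding_space L) (M N : structure L).
Context (iota : forall s, nat -> M s) (iota' : forall s, nat -> N s).
Hypotheses (cM : completes A iota) (cN : completes B iota').

(** The truncated and magnified difference min(1, (m+1)|p - q|), where q is the value
   at a, is a testable formula. *)
Lemma indist_atom beta n (a b : 'I_n -> nat) (p : atom (play_ctx n)) m :
  (forall x, orthant R n x -> m.+1%:R * fmod (atom_formula p) x <= play_mod n x) ->
  indist beta iota iota' a b -> `|code_atom A p a - code_atom B p b| <= eps m.
Proof.
move=> hm h; set q := code_atom A p a.
have m0 : 0 < m.+1%:R :> R by rewrite ltr0n.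
pose f t : R := Num.min 1 (m.+1%:R * `|t - q|).
have f_lip s t : `|f s - f t| <= m.+1%:R * `|s - t|.
  have key x y : f x <= f y + m.+1%:R * `|x - y|.
    have h1 : m.+1%:R * `|x - q| <= m.+1%:R * `|y - q| + m.+1%:R * `|x - y|.
      rewrite -mulrDr ler_pM2l// [leRHS]addrC.
      have -> : x - q = (x - y) + (y - q) by ring.
      exact: ler_normD.
    have h2 : 0 <= m.+1%:R * `|x - y| by rewrite mulr_ge0// ltW.
    rewrite /f; case: (leP 1 (m.+1%:R * `|y - q|)) => h3.
      by apply: (@le_trans _ _ 1); [rewrite ge_min lexx|rewrite lerDl].
    by apply: le_trans h1; rewrite ge_min lexx orbT.
  have := key s t; have := key t s; rewrite [`|t - s|]distrC ler_norml.
  by move=> h1 h2; apply/andP; split; lra.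
have f01 t : 0 <= f t <= 1.
  by rewrite /f le_min ler01 ge_min lexx /= mulr_ge0// ltW.
pose u (y : 'rV[R]_1) := f (y 0 0).
pose phi := FConn u (fun=> atom_formula p).
have tphi : testable beta phi.
  have [lo hi] := @fitv_conn_bounds n _ 1 u (fun=> atom_formula p) (fun y _ => f01 _).
  split=> //=.
  + split; last by move=> _; exact: wf_atom.
    by apply: (lipschitz_conn _ f_lip); exact: ltW.
  + have qp : (qr (atom_formula p) <= beta)%O by case: (p) => [r t|s t1 t2] /=; exact: ozero_le.
    exact: (qr_conn1_le u qp).
  + move=> x x0; apply: osc_le_fmod => [|y y' hy]; first exact: modulus_ge0.
    apply: le_trans (f_lip _ _) _; apply: le_trans (hm x x0).
    by rewrite ler_pM2l.
have phi0 : feval phi (code_env iota _ a) = 0.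
  by rewrite /= /u mxE (code_atomE cM) /f subrr normr0 mulr0; apply/min_idPr.
have := h phi tphi phi0; rewrite /= /u mxE (code_atomE cN) /f gt_min ltxx /= mulrC -ltr_pdivlMr// distrC div1r.
exact: ltW.
Qed.

(** The formula variable holding the i-th element of the play, with the share of the
   modulus that belongs to it. *)
Lemma play_var n i : (i < n)%N -> exists l : 'I_n, [/\ play_ctx n l = S i,
  forall a, play_tuple a n l = a i &
  forall x, orthant R n x -> w i (const_mx (x 0 l)) <= play_mod n x].
Proof.
have w0 k z : 0 <= z -> 0 <= w k (const_mx z).
  by move=> z0; rewrite modulus_ge0//; exact: const_mx_orthant.
elim: n => [|n IH]; first by rewrite ltn0.
rewrite ltnS leq_eqVlt => /predU1P[ni|/IH[l [Sl al xl]]].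
- rewrite ni; exists ord0; split=> [|a|x x0].
  + by rewrite /= /ctx_cons unlift_none.
  + by rewrite /= /cons_nat unlift_none.
  + by rewrite play_modS lerDl modulus_ge0// => j; rewrite mxE.
- exists (lift ord0 l); split=> [|a|x x0].
  + by rewrite /= /ctx_cons liftK; exact: Sl.
  + by rewrite /= /cons_nat liftK; exact: al.
  + rewrite play_modS ler_wpDl ?w0//.
    have x1 : orthant R n (\row_i x 0 (lift ord0 i)) by move=> j; rewrite mxE.
    by have := xl _ x1; rewrite mxE.
Qed.

(** A variable as a term of a sort that is only propositionally equal to its own. *)
Lemma ctx_var n (G : ctx L n) l s : G l = s -> exists t : term G s,
  (forall A v, code_term A t v = v l) /\ (forall x, term_mod t x = x 0 l).
Proof. by case: _ /; exists (TVar G l). Qed.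

Lemma play_term n i s : (i < n)%N -> S i = s -> exists (t : term (play_ctx n) s) (l : 'I_n),
  [/\ forall A a, code_term A t (play_tuple a n) = a i, forall x, term_mod t x = x 0 l &
  forall x, orthant R n x -> w i (const_mx (x 0 l)) <= play_mod n x].
Proof.
move=> /play_var[l [Sl al xl]] Si; rewrite Si in Sl.
have [t [tl tm]] := ctx_var Sl; exists t, l; split=> // A' a.
by rewrite tl al.
Qed.

Lemma play_terms n k (s : 'I_k -> lsort L) (i : 'I_k -> nat) :
  (forall j, i j < n)%N -> (forall j, S (i j) = s j) ->
  exists (t : forall j, term (play_ctx n) (s j)) (l : 'I_k -> 'I_n),
  [/\ forall A a j, code_term A (t j) (play_tuple a n) = a (i j),
      forall x j, term_mod (t j) x = x 0 (l j) &
  forall x j, orthant R n x -> w (i j) (const_mx (x 0 (l j))) <= play_mod n x].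
Proof.
move=> hi hs.
pose t j := sval (cid (play_term (hi j) (hs j))).
have H j : exists l, [/\ forall A a, code_term A (t j) (play_tuple a n) = a (i j),
  forall x, term_mod (t j) x = x 0 l &
  forall x, orthant R n x -> w (i j) (const_mx (x 0 l)) <= play_mod n x] :=
  svalP (cid (play_term (hi j) (hs j))).
pose l j := sval (cid (H j)).
exists t, l; split=> [A' a j|x j|x j x0]; have [h1 h2 h3] := svalP (cid (H j)).
- exact: h1.
- exact: h2.
- exact: h3.
Qed.

(** A symbol applied to several late elements has at most its diagonal modulus at the
   largest coordinate, and this is dominated by the weight of a single element. *)
Lemma play_mod_max n k (i : 'I_k -> nat) (l : 'I_k -> 'I_n) (m : nat) (C : R -> R) (x : 'rV[R]_n) :
  (forall j, w (i j) (const_mx (x 0 (l j))) <= play_mod n x) -> orthant R n x ->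
  (forall j, m <= i j)%N -> (forall j z, (m <= j)%N -> 0 <= z -> C z <= w j (const_mx z)) ->
  C 0 <= 0 ->
  exists z, [/\ 0 <= z, forall j, x 0 (l j) <= z & C z <= play_mod n x].
Proof.
move=> wx x0; case: k i l wx => [|k] i l wx mi hC C0.
  by exists 0; split=> //; [case|apply: le_trans C0 _; exact: modulus_ge0].
have [j _ hj] := arg_maxP (fun j => x 0 (l j)) (erefl : predT ord0).
exists (x 0 (l j)); split=> [|j'|]; [exact: x0|exact: hj|].
by apply: le_trans (wx j); apply: hC => //; exact: x0.
Qed.

Context (a b : nat -> nat) (hw : weights L w).

Lemma indist_dist beta m i j s n : (m <= i < n)%N -> (m <= j < n)%N ->
  S i = s -> S j = s -> indist beta iota iota' (play_tuple a n) (play_tuple b n) ->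
  `|code_dist A s (a i) (a j) - code_dist B s (b i) (b j)| <= eps m.
Proof.
move=> /andP[mi ni] /andP[mj nj] Si Sj.
have [t [l [ta tm wt]]] := play_term ni Si; have [t' [l' [ta' tm' wt']]] := play_term nj Sj.
move=> h; have := indist_atom (p := ADist t t') (m := m) _ h.
rewrite /= !ta !ta'; apply => x x0; rewrite tm tm'.
have sc k z : (m <= k)%N -> 0 <= z -> m.+1%:R * (z + z) <= w k (const_mx z).
  move=> mk z0; apply: le_trans (w_dist hw k z0).
  by rewrite ler_wpM2r ?addr_ge0// ler_nat.
have m0 : 0 <= m.+1%:R :> R by [].
case: (leP (x 0 l) (x 0 l')) => ll.
  apply: le_trans (wt' x x0); apply: le_trans (sc j _ mj (x0 l')).
  by rewrite ler_wpM2l// lerD2r.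
apply: le_trans (wt x x0); apply: le_trans (sc i _ mi (x0 l)).
by rewrite ler_wpM2l// lerD2l ltW.
Qed.

Lemma indist_rel beta r m m1 n (i : 'I_(rel_arity r) -> nat) :
  (forall i z, (m1 <= i)%N -> 0 <= z ->
    i.+1%:R * rel_mod r (const_mx z) <= w i (const_mx z)) ->
  (forall l, maxn m m1 <= i l < n)%N -> (forall l, S (i l) = rel_dom r l) ->
  indist beta iota iota' (play_tuple a n) (play_tuple b n) ->
  `|code_rel A r (a \o i) - code_rel B r (b \o i)| <= eps m.
Proof.
move=> hm1 hi Si.
have ni l : (i l < n)%N by case/andP: (hi l).
have mi l : (maxn m m1 <= i l)%N by case/andP: (hi l).
have [t [l [ta tm wt]]] := play_terms ni Si.
move=> h; have := indist_atom (p := ARel t) (m := m) _ h.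
have E A' a' : (fun j => code_term A' (t j) (play_tuple a' n)) = a' \o i.
  by apply/funext => j; rewrite ta.
rewrite /= !E; apply => x x0.
have [||z [z0 xz Cz]] := @play_mod_max n _ i l (maxn m m1)
  (fun z => m.+1%:R * rel_mod r (const_mx z)) x (fun j => wt x j x0) x0 mi.
- move=> j z; rewrite geq_max => /andP[mj m1j] z0; apply: le_trans (hm1 j z m1j z0).
  rewrite ler_wpM2r ?ler_nat// modulus_ge0//; exact: const_mx_orthant.
- have -> : const_mx 0 = 0 :> 'rV[R]_(rel_arity r) by apply/rowP => j; rewrite !mxE.
  by rewrite modulus0 mulr0.
apply: le_trans Cz; rewrite ler_wpM2l//; apply: modulus_homo => [j|j]; rewrite !mxE tm //.
Qed.

Lemma indist_fun beta f m m1 n (i : 'I_(func_arity f) -> nat) j :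
  (forall i z, (m1 <= i)%N -> 0 <= z ->
    i.+1%:R * (func_mod f (const_mx z) + z) <= w i (const_mx z)) ->
  (forall l, maxn m m1 <= i l < n)%N -> (forall l, S (i l) = func_dom f l) ->
  (maxn m m1 <= j < n)%N -> S j = func_cod f ->
  indist beta iota iota' (play_tuple a n) (play_tuple b n) ->
  `|code_dist A (func_cod f) (code_func A f (a \o i)) (a j) -
    code_dist B (func_cod f) (code_func B f (b \o i)) (b j)| <= eps m.
Proof.
move=> hm1 hi Si /andP[mj nj] Sj.
have ni l : (i l < n)%N by case/andP: (hi l).
have mi l : (maxn m m1 <= i l)%N by case/andP: (hi l).
have [t [l [ta tm wt]]] := play_terms ni Si.
have [t' [l' [ta' tm' wt']]] := play_term nj Sj.
move=> h; have := indist_atom (p := ADist (TApp t) t') (m := m) _ h.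
have E A' a' : (fun j => code_term A' (t j) (play_tuple a' n)) = a' \o i.
  by apply/funext => j'; rewrite ta.
rewrite /= !E !ta'; apply => x x0.
pose C (z : R) := m.+1%:R * (func_mod f (const_mx z) + z).
have CP k z : (maxn m m1 <= k)%N -> 0 <= z -> C z <= w k (const_mx z).
  rewrite geq_max => /andP[mk m1k] z0; apply: le_trans (hm1 k z m1k z0).
  rewrite ler_wpM2r ?ler_nat// addr_ge0// modulus_ge0//; exact: const_mx_orthant.
have [|z [z0 xz Cz]] := play_mod_max (fun j => wt x j x0) x0 mi CP.
  have -> : C 0 = 0; last by [].
  rewrite /C addr0; have -> : const_mx 0 = 0 :> 'rV[R]_(func_arity f).
    by apply/rowP => k; rewrite !mxE.
  by rewrite modulus0 mulr0.
have m0 : 0 <= m.+1%:R :> R by [].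
have fz z' : z <= z' -> func_mod f (\row_i term_mod (t i) x) <= func_mod f (const_mx z').
  move=> zz'; apply: modulus_homo => k; rewrite !mxE tm; first exact: x0.
  exact: le_trans (xz k) zz'.
rewrite tm'; case: (leP (x 0 l') z) => lz.
  apply: le_trans Cz; rewrite ler_wpM2l//; apply: lerD => //; exact: fz.
apply: le_trans (wt' x x0); apply: le_trans (CP j _ mj (x0 l')).
by rewrite ler_wpM2l//; apply: lerD => //; apply: fz; exact: ltW.
Qed.

Lemma indist_const beta c m n j : (m <= j < n)%N -> S j = const_sort c ->
  indist beta iota iota' (play_tuple a n) (play_tuple b n) ->
  `|code_dist A (const_sort c) (code_const A c) (a j) -
    code_dist B (const_sort c) (code_const B c) (b j)| <= eps m.
Proof.
move=> /andP[mj nj] Sj; have [t' [l' [ta' tm' wt']]] := play_term nj Sj.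
move=> h; have := indist_atom (p := ADist (TConst _ c) t') (m := m) _ h.
rewrite /= !ta'; apply => x x0; rewrite add0r tm'.
apply: le_trans (wt' x x0); apply: le_trans (w_dist hw j (x0 l')).
apply: ler_pM => //.
  by rewrite ler_nat.
by rewrite lerDl; exact: x0.
Qed.

End atoms.
End bounded_formulas.
Arguments play_ctx {R L} S n _.
Arguments play_tuple a n _ : clear implicits.

(** * Suslin sets and Borel sets *)

Section suslin.
Context (T : Type) (near : nat -> T -> T -> Prop).
Hypothesis near_le : forall m n x y, (n <= m)%N -> near m x y -> near n x y.

Definition agree n (y y' : nat -> nat) : Prop := forall i, (i < n)%N -> y i = y' i.

(** Closedness is expressed by approximation from within the relation, so that no
   topology has to be put on the parameter space. *)
Definition closed_rel (F : (nat -> nat) -> T -> Prop) : Prop := forall y x,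
  (forall n, exists y' x', [/\ agree n y y', near n x x' & F y' x']) -> F y x.

(** Projections of relations that are closed for the given nearness and for the
   topology of the Baire space. *)
Definition suslin (C : set T) : Prop :=
  exists2 F, closed_rel F & forall x, C x <-> exists y, F y x.

(** One witness encodes a sequence of witnesses. *)
Definition cap_rel (F : nat -> (nat -> nat) -> T -> Prop) y x :=
  forall k, F k (fun i => y (pickle (k, i))) x.

(** The first entry of the witness names the member of the family. *)
Definition cup_rel (F : nat -> (nat -> nat) -> T -> Prop) y x :=
  F (y 0) (fun i => y i.+1) x.

Lemma closed_cap F : (forall k, closed_rel (F k)) -> closed_rel (cap_rel F).
Proof.
move=> cF y x h k; apply: cF => n.
pose N := maxn n (\max_(i < n) (pickle (k, i : nat)).+1).
have [y' [x' [yy' xx' /(_ k) Fk]]] := h N.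
exists (fun i => y' (pickle (k, i))), x'; split=> [i ni||].
- apply: yy'; apply: leq_trans (leq_maxr _ _).
  exact: (@leq_bigmax _ (fun i : 'I_n => (pickle (k, i : nat)).+1) (Ordinal ni)).
- by apply: near_le xx'; exact: leq_maxl.
- exact: Fk.
Qed.

Lemma closed_cup F : (forall k, closed_rel (F k)) -> closed_rel (cup_rel F).
Proof.
move=> cF y x h; apply: cF => n; have [y' [x' [yy' xx' Fk]]] := h n.+1.
exists (fun i => y' i.+1), x'; split=> [i ni||].
- exact: yy'.
- exact: near_le xx'.
- by rewrite (yy' 0%N).
Qed.

Lemma cap_relE F x : (exists y, cap_rel F y x) <-> forall k, exists y, F k y x.
Proof.
split=> [[y h] k|h]; first by exists (fun i => y (pickle (k, i))); exact: h.
pose z k := sval (cid (h k)).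
exists (fun j => if unpickle j is Some (k, i) then z k i else 0%N) => k.
have -> : (fun i => if unpickle (pickle (k, i)) is Some (k', i') then z k' i' else 0%N) = z k.
  by apply/funext => i; rewrite pickleK.
exact: svalP (cid (h k)).
Qed.

Lemma cup_relE F x : (exists y, cup_rel F y x) <-> exists k y, F k y x.
Proof.
split=> [[y h]|[k [y h]]]; first by exists (y 0%N), (fun i => y i.+1).
by exists (fun i => if i is j.+1 then y j else k).
Qed.

Lemma suslin_family (C : nat -> set T) : (forall k, suslin (C k)) ->
  exists2 F : nat -> (nat -> nat) -> T -> Prop, forall k, closed_rel (F k) &
    forall k x, C k x <-> exists y, F k y x.
Proof.
move=> h; exists (fun k => sval (cid2 (h k))) => k.
  exact: s2valP (cid2 (h k)).
exact: s2valP' (cid2 (h k)).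
Qed.

Lemma suslin_forall (C : nat -> set T) : (forall k, suslin (C k)) ->
  suslin [set x | forall k, C k x].
Proof.
move=> /suslin_family[F cF hF]; exists (cap_rel F); first exact: closed_cap.
by move=> x; rewrite cap_relE; split=> h k; apply/hF.
Qed.

Lemma suslin_exists (C : nat -> set T) : (forall k, suslin (C k)) ->
  suslin [set x | exists k, C k x].
Proof.
move=> /suslin_family[F cF hF]; exists (cup_rel F); first exact: closed_cup.
by move=> x; rewrite cup_relE; split=> -[k h]; exists k; apply/hF.
Qed.

Lemma suslin_closed (C : set T) :
  (forall x, (forall n, exists2 x', near n x x' & C x') -> C x) -> suslin C.
Proof.
move=> cC; exists (fun _ => C) => [y x h|x]; last first.
  by split=> [|[]//]; exists (fun=> 0%N).
by apply: cC => n; have [_ [x' [_ xx' Cx']]] := h n; exists x'.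
Qed.

(** Intersect the given relation with, for each k, the union of the relations of the
   k-th covering; the first entry of a witness for that union, which sits at position
   [pos k] of the whole witness, names the member. *)
Lemma suslin_refine (Q : set T) (V : nat -> nat -> set T) : suslin Q ->
  (forall k m, suslin (V k m)) -> (forall x k, Q x -> exists m, V k m x) ->
  exists F (pos : nat -> nat), [/\ closed_rel F, forall x, Q x <-> exists y, F y x &
    forall y x k, F y x -> V k (y (pos k)) x].
Proof.
move=> [F cF hF] sV QV.
have [W cW hW] : exists2 W : nat -> nat -> (nat -> nat) -> T -> Prop,
    forall k m, closed_rel (W k m) & forall k m x, V k m x <-> exists y, W k m y x.
  exists (fun k => sval (cid2 (suslin_family (sV k)))) => k.
    exact: s2valP (cid2 (suslin_family (sV k))).
  exact: s2valP' (cid2 (suslin_family (sV k))).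
(* The member 0 of the conjunction is F; the k-th covering is the member k + 1. *)
pose G k := if k is j.+1 then cup_rel (W j) else F.
exists (cap_rel G), (fun k => pickle (k.+1, 0%N)); split.
- by apply: closed_cap => -[|k] //=; apply: closed_cup.
- move=> x; rewrite cap_relE; split=> [Qx [|k]|/(_ 0%N)/hF//]; first by apply/hF.
  rewrite cup_relE; have [m Vm] := QV x k Qx.
  by exists m; apply/hW.
- by move=> y x k /(_ k.+1) h; apply/hW; exists (fun i => y (pickle (k.+1, i.+1))).
Qed.

Section bisuslin.
Variable Q : set T.
Hypothesis sQ : suslin Q.

(** D and its complement are Suslin relatively to Q. These sets are closed under
   countable Boolean operations and play the part of the Borel sets. *)
Definition bisuslin (D : set T) : Prop := suslin (Q `&` D) /\ suslin (Q `\` D).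

Lemma bisuslin_not D : bisuslin D -> bisuslin (fun x => ~ D x).
Proof.
move=> [h1 h2]; split=> //.
rewrite (_ : _ `\` _ = Q `&` D)//.
by apply/seteqP; split=> x [Qx h]; split=> //; exact: contrapT.
Qed.

Lemma bisuslin_ext D D' : (forall x, Q x -> D x <-> D' x) -> bisuslin D -> bisuslin D'.
Proof.
move=> DD' [h1 h2]; split.
  rewrite (_ : _ `&` _ = Q `&` D)//.
  by apply/seteqP; split=> x [Qx Dx]; split=> //; apply/(DD' x Qx).
rewrite (_ : _ `\` _ = Q `\` D)//.
by apply/seteqP; split=> x [Qx Dx]; split=> // ?; apply: Dx; apply/(DD' x Qx).
Qed.

Lemma suslin_set0 : suslin set0.
Proof. by apply: suslin_closed => x /(_ 0%N)[]. Qed.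

Lemma bisuslin_const (P : Prop) : bisuslin (fun _ => P).
Proof.
have [HP|HP] := pselect P; split.
- by rewrite (_ : _ `&` _ = Q)//; apply/seteqP; split=> x // [].
- rewrite (_ : _ `\` _ = set0); first exact: suslin_set0.
  by apply/seteqP; split=> x // [].
- rewrite (_ : _ `&` _ = set0); first exact: suslin_set0.
  by apply/seteqP; split=> x // [].
- by rewrite (_ : _ `\` _ = Q)//; apply/seteqP; split=> x // [].
Qed.

Lemma bisuslin_exists_nat (D : nat -> set T) : (forall k, bisuslin (D k)) ->
  bisuslin (fun x => exists k, D k x).
Proof.
move=> h; split.
  rewrite (_ : _ `&` _ = (fun x => exists k, (Q `&` D k) x)).
    by apply: suslin_exists => k; case: (h k).
  apply/seteqP; split=> x /=; first by move=> [Qx [k Dk]]; exists k.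
  by move=> [k [Qx Dk]]; split=> //; exists k.
rewrite (_ : _ `\` _ = (fun x => forall k, (Q `\` D k) x)).
  by apply: suslin_forall => k; case: (h k).
apply/seteqP; split=> x /=.
  by move=> [Qx nD] k; split=> // Dk; apply: nD; exists k.
move=> h'; split; first by case: (h' 0%N).
by move=> [k Dk]; case: (h' k).
Qed.

Lemma bisuslin_exists (I : Type) (D : I -> set T) : countable [set: I] ->
  (forall i, bisuslin (D i)) -> bisuslin (fun x => exists i, D i x).
Proof.
move=> /countable_enumeration[e he] h.
apply: (@bisuslin_ext (fun x => exists k, exists2 i, e k = Some i & D i x)).
  move=> x _; split=> [[k [i _ Di]]|[i Di]]; first by exists i.
  by have [k ek] := he i; exists k, i.
apply: bisuslin_exists_nat => k; case: (e k) => [i|].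
  apply: bisuslin_ext (h i) => x _; split=> [Di|[_ [<-]]//].
  by exists i.
by apply: bisuslin_ext (bisuslin_const False) => x _; split=> // -[].
Qed.

Lemma bisuslin_forall (I : Type) (D : I -> set T) : countable [set: I] ->
  (forall i, bisuslin (D i)) -> bisuslin (fun x => forall i, D i x).
Proof.
move=> cI h; have /bisuslin_not := bisuslin_exists cI (fun i => bisuslin_not (h i)).
apply: bisuslin_ext => x _; split=> [nD i|Dx [i]]; last by apply; exact: Dx.
by apply: contrapT => nDi; apply: nD; exists i.
Qed.

Lemma bisuslin_and D D' : bisuslin D -> bisuslin D' -> bisuslin (fun x => D x /\ D' x).
Proof.
move=> h h'; apply: (@bisuslin_ext (fun x => forall b : bool, (if b then D else D') x)).
  by move=> x _; split=> [k|[? ?] []//]; split; [exact: (k true)|exact: (k false)].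
by apply: bisuslin_forall => // -[].
Qed.

End bisuslin.
End suslin.

Section borel_suslin.
Context {R : realType} (Z : metricType R).

Definition pair_near n (p q : Z * Z) : Prop :=
  mdist p.1 q.1 <= eps n /\ mdist p.2 q.2 <= @eps R n.

Lemma pair_near_le m n x y : (n <= m)%N -> pair_near m x y -> pair_near n x y.
Proof. by move=> /(@eps_le R) nm [h1 h2]; split; [exact: le_trans h1 nm|exact: le_trans h2 nm]. Qed.

Variable g : Z * Z -> Z.
Hypothesis g_near : forall n p q, pair_near n p q -> mdist (g p) (g q) <= eps n.

(** An open set is the union over k of the closed sets of points whose [eps k]-ball
   lies in it. *)
Lemma open_bisuslin U : open U -> bisuslin pair_near setT (g @^-1` U).
Proof.
move=> oU; have oU' x : U x -> exists k, forall z, mdist x z < eps k -> U z.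
  move=> Ux; have /nbhs_ballP[e /= e0 eU] : nbhs x U by exact: open_nbhs_nbhs.
  have [k ke] := eps_small e0; exists k => z xz; apply: eU.
  by rewrite ballEmdist /=; exact: lt_trans ke.
split.
  rewrite setTI (_ : _ @^-1` _ = [set p | exists k, forall z, mdist (g p) z < eps k -> U z]).
    apply: suslin_exists => [|k]; first exact: pair_near_le.
    apply: suslin_closed => p h z pz.
    have /eps_small[n hn] : 0 < eps k - mdist (g p) z by rewrite subr_gt0.
    have [p' pp' hp'] := h n; apply: hp'.
    have := g_near pp'; have := metric_triangle (g p') (g p) z.
    by rewrite [mdist (g p') (g p)]metric_sym; lra.
  apply/seteqP; split=> p; first exact: oU'.
  by move=> [k]; apply; rewrite mdistxx eps_gt0.
rewrite setTD; apply: suslin_closed => p h /oU'[k hk].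
have [p' pp' hp'] := h k.+1; apply: hp'; apply: hk.
apply: le_lt_trans (g_near pp') _.
by rewrite /eps ltf_pV2 ?posrE ?ltr0n// ltr_nat.
Qed.

(** The sets with bi-Suslin preimage form a sigma-algebra that contains the open
   sets. *)
Lemma borel_bisuslin U : borel U -> bisuslin pair_near setT (g @^-1` U).
Proof.
suff : @borel Z `<=` [set U | bisuslin pair_near setT (g @^-1` U)] by apply.
have sT : suslin pair_near setT by exact: suslin_closed.
apply: smallest_sub => [|V]; last exact: open_bisuslin.
split=> [|V hV|V hV].
- exact: (bisuslin_const sT False).
- by rewrite /= setTD; exact: bisuslin_not hV.
- apply: bisuslin_ext (bisuslin_exists_nat pair_near_le hV) => p _.
  by split=> [[k Vk]|[k _ Vk]]; exists k.
Qed.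

End borel_suslin.

(** * The back-and-forth game is Borel *)

Section countability.
Context {R : realType} (L : language R).

Lemma inj_countable (T : Type) (U : countType) (f : T -> U) : injective f ->
  countable [set: T].
Proof.
move=> fi; apply/countable_injP; exists (fun t => pickle (f t)).
by move=> x y _ _ /(pcan_inj pickleK) /fi.
Qed.

Lemma countable_inj (T : Type) : countable [set: T] -> exists f : T -> nat, injective f.
Proof. by move=> /countable_injP[f fi]; exists f => x y; apply: fi; rewrite inE. Qed.

Lemma existT_inj (I : Type) (P : I -> Type) i (x y : P i) :
  existT P i x = existT P i y -> x = y.
Proof.
have h (u v : {i & P i}) (uv : u = v) (p : projT1 u = projT1 v) :
    eq_rect _ P (projT2 u) _ p = projT2 v.
  by case: _ / uv p => p; rewrite (Prop_irrelevance p erefl).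
by move=> /h /(_ erefl).
Qed.

Lemma countable_tuple n : countable [set: 'I_n -> nat].
Proof.
apply: (@inj_countable _ {ffun 'I_n -> nat} (fun v => [ffun i => v i])) => u v /ffunP uv.
by apply/funext => i; have := uv i; rewrite !ffunE.
Qed.

Section codes.
Variables (pc : constsym L -> nat) (pf : funsym L -> nat).
Hypotheses (pcI : injective pc) (pfI : injective pf).

Fixpoint term_tree n (G : ctx L n) s (t : term G s) : GenTree.tree nat :=
  match t with
  | TVar i => GenTree.Node 0 [:: GenTree.Leaf (i : nat)]
  | TConst c => GenTree.Node 1 [:: GenTree.Leaf (pc c)]
  | TApp f t => GenTree.Node 2 (GenTree.Leaf (pf f) ::
      [seq term_tree (t i) | i <- enum 'I_(func_arity f)])
  end.

Lemma map_enum_inj k (U : Type) (u v : 'I_k -> U) :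
  [seq u i | i <- enum 'I_k] = [seq v i | i <- enum 'I_k] -> u =1 v.
Proof.
move=> /eq_in_map uv i; apply: uv; exact: mem_enum.
Qed.

(** Terms form an indexed family, so injectivity is proved for pairs of a sort and a
   term. *)
Lemma term_tree_inj n (G : ctx L n) s (t : term G s) s' (t' : term G s') :
  term_tree t = term_tree t' -> existT (term G) s t = existT (term G) s' t'.
Proof.
elim: t s' t' => [i|c|f t IH] s' [i'|c'|f' t'] //=.
- by move=> [/val_inj ->].
- by move=> [/pcI ->].
- move=> [/pfI ff']; case: _ / ff' t' => t' /map_enum_inj tt'.
  congr (existT _ _ (TApp _)).
  apply: functional_extensionality_dep => i.
  exact: existT_inj (IH i _ _ (tt' i)).
Qed.

End codes.

Lemma countable_atom n (G : ctx L n) : countable_language L -> countable [set: atom G].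
Proof.
move=> [/countable_inj[ps psI] /countable_inj[pr prI] /countable_inj[pf pfI]
  /countable_inj[pc pcI]].
pose tt := term_tree pc pf.
have ttI s (t t' : term G s) : tt _ _ _ t = tt _ _ _ t' -> t = t'.
  by move=> E; exact: existT_inj (term_tree_inj pcI pfI E).
pose f (p : atom G) : GenTree.tree nat := match p with
  | ARel r t => GenTree.Node 0 (GenTree.Leaf (pr r) ::
      [seq tt _ _ _ (t i) | i <- enum 'I_(rel_arity r)])
  | ADist s t1 t2 => GenTree.Node 1 [:: GenTree.Leaf (ps s); tt _ _ _ t1; tt _ _ _ t2]
  end.
apply: (@inj_countable _ _ f) => -[r t|s t1 t2] [r' t'|s' t1' t2'] //=.
- move=> [/prI rr']; case: _ / rr' t' => t' /map_enum_inj tt'.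
  congr ARel; apply: functional_extensionality_dep => i; exact: ttI.
- by move=> [/psI ss']; case: _ / ss' t1' t2' => t1' t2' /ttI -> /ttI ->.
Qed.

End countability.

Section bf_bisuslin.
Context {R : realType} (L : language R) (cL : countable_language L).
Context (T : Type) (near : nat -> T -> T -> Prop).
Hypothesis near_le : forall m n x y, (n <= m)%N -> near m x y -> near n x y.
Context (Q : set T) (sQ : suslin near Q).
Local Notation bisuslin := (bisuslin near Q).

(** All values of the code [c x] depend on x in a Borel way, relatively to Q. *)
Definition bisuslin_code (c : T -> coding_space L) : Prop :=
  [/\ forall s i j (q : R), bisuslin (fun x => code_dist (c x) s i j <= q),
      forall r v (q : R), bisuslin (fun x => code_rel (c x) r v <= q),
      forall f v m, bisuslin (fun x => code_func (c x) f v = m) &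
      forall k m, bisuslin (fun x => code_const (c x) k = m)].

(** An inequality between two such functions is tested by rational numbers separating
   them. *)
Lemma bisuslin_le_add (u v : T -> R) e : (forall q, bisuslin (fun x => u x <= q)) ->
  (forall q, bisuslin (fun x => v x <= q)) -> bisuslin (fun x => u x <= v x + e).
Proof.
move=> hu hv.
apply: (@bisuslin_ext _ _ _ (fun x => forall q : rat, ~ (v x <= ratr q /\ ~ u x <= ratr q + e))).
  move=> x _; split=> [h|uv q [vq]]; last by apply; apply: le_trans uv _; rewrite lerD2r.
  rewrite /= leNgt -ltrBrDr; apply/negP => /rat_in_itvoo[q]; rewrite in_itv /=.
  move=> /andP[vq qu]; apply: (h q); split; first exact: ltW.
  by apply/negP; rewrite -ltNge -ltrBrDr.
apply: (bisuslin_forall near_le sQ) => // q.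
apply: (@bisuslin_not _ _ _ (fun x => v x <= ratr q /\ ~ u x <= ratr q + e)).
apply: (bisuslin_and near_le sQ); first exact: hv.
exact: (@bisuslin_not _ _ _ (fun x => u x <= ratr q + e)).
Qed.

Lemma bisuslin_dist_le (u v : T -> R) e : (forall q, bisuslin (fun x => u x <= q)) ->
  (forall q, bisuslin (fun x => v x <= q)) -> bisuslin (fun x => `|u x - v x| <= e).
Proof.
move=> hu hv; apply: (@bisuslin_ext _ _ _ (fun x => u x <= v x + e /\ v x <= u x + e)).
  move=> x _; rewrite /= ler_norml; split=> [[h1 h2]|/andP[h1 h2]].
    by apply/andP; split; lra.
  by split; lra.
by apply: (bisuslin_and near_le sQ); exact: bisuslin_le_add.
Qed.

Section code.
Variables (c : T -> coding_space L) (hc : bisuslin_code c).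

Lemma bisuslin_term n (G : ctx L n) s (t : term G s) a m :
  bisuslin (fun x => code_term (c x) t a = m).
Proof.
elim: t m => [i|k|f t IH] m /=.
- exact: (bisuslin_const sQ (a i = m)).
- by case: hc.
- apply: (@bisuslin_ext _ _ _ (fun x => exists v : 'I_(func_arity f) -> nat,
    (forall i, code_term (c x) (t i) a = v i) /\ code_func (c x) f v = m)).
    move=> x _; split=> [[v [tv <-]]|<-].
      by congr (code_func _ _ _); exact/funext.
    by exists (fun i => code_term (c x) (t i) a).
  apply: (bisuslin_exists near_le sQ) => [|v]; first exact: countable_tuple.
  apply: (bisuslin_and near_le sQ); last by case: hc.
  by apply: (bisuslin_forall near_le sQ).
Qed.

Lemma bisuslin_atom n (G : ctx L n) (p : atom G) a q :
  bisuslin (fun x => code_atom (c x) p a <= q).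
Proof.
case: p => [r t|s t1 t2] /=.
- apply: (@bisuslin_ext _ _ _ (fun x => exists v : 'I_(rel_arity r) -> nat,
    (forall i, code_term (c x) (t i) a = v i) /\ code_rel (c x) r v <= q)).
    move=> x _; split=> [[v [tv]]|h].
      by have -> : v = (fun i => code_term (c x) (t i) a) by apply/funext => i; rewrite tv.
    by exists (fun i => code_term (c x) (t i) a).
  apply: (bisuslin_exists near_le sQ) => [|v]; first exact: countable_tuple.
  apply: (bisuslin_and near_le sQ); last by case: hc.
  by apply: (bisuslin_forall near_le sQ) => // i; exact: bisuslin_term.
- apply: (@bisuslin_ext _ _ _ (fun x => exists v : nat * nat,
    (code_term (c x) t1 a = v.1 /\ code_term (c x) t2 a = v.2) /\
    code_dist (c x) s v.1 v.2 <= q)).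
    move=> x _; split=> [[v [[-> ->]]]//|h].
    by exists (code_term (c x) t1 a, code_term (c x) t2 a).
  apply: (bisuslin_exists near_le sQ) => // v.
  apply: (bisuslin_and near_le sQ); last by case: hc.
  by apply: (bisuslin_and near_le sQ); exact: bisuslin_term.
Qed.

Lemma bisuslin_near n (G : ctx L n) a b k :
  bisuslin (fun x => code_near (c x) G a b k).
Proof. by apply: (bisuslin_forall near_le sQ) => // i; case: hc. Qed.

End code.

(** The game is built from values of atomic formulas by quantifiers over countable
   sets: elements, tuples, precisions, sorts and atomic formulas. *)
Lemma bisuslin_bf (c c' : T -> coding_space L) beta n (G : ctx L n) a b k :
  bisuslin_code c -> bisuslin_code c' ->
  bisuslin (fun x => bf (c x) (c' x) beta G a b k).
Proof.
move=> hc hc'; have [cs _ _ _] := cL.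
elim: beta n G a b k => [|beta IH|f IH] n G a b k /=; last first.
- by apply: (bisuslin_forall near_le sQ) => // m; exact: IH.
- apply: (@bisuslin_ext _ _ _ (fun x => bf (c x) (c' x) beta G a b k /\
    ((forall s i k', exists b' d, code_near (c' x) G b b' k /\
        bf (c x) (c' x) beta (ctx_cons s G) (cons_nat i a) (cons_nat d b') k') /\
     (forall s d k', exists a' i, code_near (c x) G a a' k /\
        bf (c x) (c' x) beta (ctx_cons s G) (cons_nat i a') (cons_nat d b) k')))).
    by move=> x _; split=> [[? []]|[]].
  apply: (bisuslin_and near_le sQ) => //.
  apply: (bisuslin_and near_le sQ).
    apply: (bisuslin_forall near_le sQ) => // s.
    apply: (bisuslin_forall near_le sQ) => // i.
    apply: (bisuslin_forall near_le sQ) => // k'.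
    apply: (bisuslin_exists near_le sQ) => [|b']; first exact: countable_tuple.
    apply: (bisuslin_exists near_le sQ) => // d.
    by apply: (bisuslin_and near_le sQ); [exact: bisuslin_near|exact: IH].
  apply: (bisuslin_forall near_le sQ) => // s.
  apply: (bisuslin_forall near_le sQ) => // i.
  apply: (bisuslin_forall near_le sQ) => // k'.
  apply: (bisuslin_exists near_le sQ) => [|a']; first exact: countable_tuple.
  apply: (bisuslin_exists near_le sQ) => // d.
  by apply: (bisuslin_and near_le sQ); [exact: bisuslin_near|exact: IH].
- apply: (bisuslin_forall near_le sQ) => [|p]; first exact: countable_atom.
  apply: (bisuslin_forall near_le sQ) => // k'.
  apply: (@bisuslin_ext _ _ _ (fun x => exists b', code_near (c' x) G b b' k /\
     `|code_atom (c x) p a - code_atom (c' x) p b'| <= eps k')).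
    by move=> x _; split=> [[b' []]|[b']]; exists b'.
  apply: (bisuslin_exists near_le sQ) => [|b']; first exact: countable_tuple.
  apply: (bisuslin_and near_le sQ); first exact: bisuslin_near.
  by apply: bisuslin_dist_le => q; exact: bisuslin_atom.
Qed.

End bf_bisuslin.

(** * Reading codes, and infinite branches of countable trees *)

Section coding_topology.

(** The index type has no decidable equality of its own; the classical one serves. *)
Lemma eval_continuous (I : Type) (K : I -> topologicalType) i :
  continuous (fun f : prod_topology K => f i).
Proof. exact: (@proj_continuous {classic I} K i). Qed.

Context {R : realType} (L : language R).

Lemma continuous_code_dist s i j :
  continuous (fun A : coding_space L => code_dist A s i j).
Proof.
move=> A.
apply: (@continuous_comp _ _ _ (fun A : coding_space L => A.1.1.1 s)
  (fun g : {ptws nat * nat -> R} => g (i, j))); last exact: (@eval_continuous _ (fun=> R)).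
apply: (@continuous_comp _ _ _ (fun A : coding_space L => A.1.1.1) (fun g => g s));
  last exact: (@eval_continuous _ (fun=> {ptws nat * nat -> R})).
apply: (@continuous_comp _ _ _ (fun A : coding_space L => A.1.1) fst); last exact: cvg_fst.
apply: (@continuous_comp _ _ _ (fun A : coding_space L => A.1) fst); exact: cvg_fst.
Qed.

Lemma continuous_code_rel r v :
  continuous (fun A : coding_space L => code_rel A r v).
Proof.
move=> A.
apply: (@continuous_comp _ _ _ (fun A : coding_space L => A.1.1.2 r)
  (fun g : {ptws ('I_(rel_arity r) -> nat) -> R} => g v));
  last exact: (@eval_continuous _ (fun=> R)).
apply: (@continuous_comp _ _ _ (fun A : coding_space L => A.1.1.2) (fun g => g r));
  last exact: (@eval_continuous _ (fun r : relsym L => {ptws ('I_(rel_arity r) -> nat) -> R})).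
apply: (@continuous_comp _ _ _ (fun A : coding_space L => A.1.1) snd); last exact: cvg_snd.
apply: (@continuous_comp _ _ _ (fun A : coding_space L => A.1) fst); exact: cvg_fst.
Qed.

Lemma continuous_code_func f v :
  continuous (fun A : coding_space L => code_func A f v).
Proof.
move=> A.
apply: (@continuous_comp _ _ _ (fun A : coding_space L => A.1.2 f)
  (fun g : {ptws ('I_(func_arity f) -> nat) -> nat} => g v));
  last exact: (@eval_continuous _ (fun=> nat)).
apply: (@continuous_comp _ _ _ (fun A : coding_space L => A.1.2) (fun g => g f));
  last exact: (@eval_continuous _
    (fun f : funsym L => {ptws ('I_(func_arity f) -> nat) -> nat})).
apply: (@continuous_comp _ _ _ (fun A : coding_space L => A.1) snd); last exact: cvg_snd.
exact: cvg_fst.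
Qed.

Lemma continuous_code_const c :
  continuous (fun A : coding_space L => code_const A c).
Proof.
move=> A.
apply: (@continuous_comp _ _ _ (fun A : coding_space L => A.2) (fun g => g c));
  last exact: (@eval_continuous _ (fun=> nat)).
exact: cvg_snd.
Qed.

End coding_topology.

Section borel_codes.
Context {R : realType} (L : language R) (Z : metricType R).
Context (B : set Z) (f : Z -> coding_space L) (g : Z * Z -> Z) (Q : set (Z * Z)).
Hypothesis fB : forall U, open U -> borel (B `&` f @^-1` U).
Hypothesis g_near : forall n p q, pair_near n p q -> mdist (g p) (g q) <= eps n.
Hypothesis sQ : suslin (@pair_near R Z) Q.
Hypothesis QB : forall p, Q p -> B (g p).

Lemma suslin_setI (C D : set (Z * Z)) : suslin (@pair_near R Z) C ->
  suslin (@pair_near R Z) D -> suslin (@pair_near R Z) (C `&` D).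
Proof.
move=> sC sD.
rewrite (_ : _ `&` _ = [set x | forall k : nat, (if k is 0%N then C else D) x]).
  by apply: suslin_forall => [|[|k]] //; exact: pair_near_le.
apply/seteqP; split=> x; first by move=> [Cx Dx] [].
by move=> h; split; [exact: (h 0%N)|exact: (h 1%N)].
Qed.

(** Outside B the map f is arbitrary, so the conclusion is relative to Q. *)
Lemma bisuslin_open U : open U -> bisuslin (@pair_near R Z) Q (fun p => U (f (g p))).
Proof.
move=> /fB /(borel_bisuslin g_near); rewrite /bisuslin setTI setTD => -[h1 h2]; split.
  rewrite (_ : _ `&` _ = Q `&` (g @^-1` (B `&` f @^-1` U))); first exact: suslin_setI.
  by apply/seteqP; split=> p [Qp] => [Up|[_ Up]]; split=> //; split=> //; exact: QB.
rewrite (_ : _ `\` _ = Q `&` (~` (g @^-1` (B `&` f @^-1` U)))); first exact: suslin_setI.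
apply/seteqP; split=> p [Qp nU]; split=> //; first by move=> [].
by move=> Up; apply: nU; split=> //; exact: QB.
Qed.

Lemma bisuslin_preimage_le (v : coding_space L -> R) q : continuous v ->
  bisuslin (@pair_near R Z) Q (fun p => v (f (g p)) <= q).
Proof.
move=> /continuousP /(_ _ (@open_gt R q)) /bisuslin_open /bisuslin_not.
by apply: bisuslin_ext => p _; rewrite /= ltNge; split=> [/negP /negPn|h /negP].
Qed.

Lemma bisuslin_preimage_eq (v : coding_space L -> nat) m : continuous v ->
  bisuslin (@pair_near R Z) Q (fun p => v (f (g p)) = m).
Proof.
move=> /continuousP /(_ [set m] (discrete_open _)) /bisuslin_open.
exact: bisuslin_ext.
Qed.

Lemma borel_bisuslin_code : bisuslin_code (@pair_near R Z) Q (fun p => f (g p)).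
Proof.
split=> [s i j q|r v q|h v m|k m].
- exact: bisuslin_preimage_le (@continuous_code_dist R L s i j).
- exact: bisuslin_preimage_le (@continuous_code_rel R L r v).
- exact: bisuslin_preimage_eq (@continuous_code_func R L h v).
- exact: bisuslin_preimage_eq (@continuous_code_const R L k).
Qed.

End borel_codes.

Section probes.
Context {R : realType} (L : language R).

(** A probe reads one number off a code, with finite precision if it is real.
   Countably many probes determine the code. *)
Inductive probe : Type :=
| PDist (s : lsort L) (i j n : nat)
| PRel (r : relsym L) (v : 'I_(rel_arity r) -> nat) (n : nat)
| PFun (f : funsym L) (v : 'I_(func_arity f) -> nat)
| PConst (c : constsym L).

Definition probe_answer (p : probe) (m : nat) (A : coding_space L) : Prop :=
  let q : R := if unpickle m is Some q then ratr q else 0 in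
  match p with
  | PDist s i j n => `|code_dist A s i j - q| <= eps n
  | PRel r v n => `|code_rel A r v - q| <= eps n
  | PFun f v => code_func A f v = m
  | PConst c => code_const A c = m
  end.

Lemma probe_answer_ex p A : exists m, probe_answer p m A.
Proof.
have H (x : R) n : exists m, `|x - (if unpickle m is Some q then ratr q else 0)| <= eps n.
  have : x < x + eps n by rewrite ltrDl eps_gt0.
  move=> /rat_in_itvoo[q]; rewrite in_itv /= => /andP[xq qx]; exists (pickle q).
  by rewrite pickleK ler_norml; apply/andP; split; have := @eps_gt0 R n; lra.
case: p => [s i j n|r v n|f v|c]; [exact: H|exact: H| |].
- by exists (code_func A f v).
- by exists (code_const A c).
Qed.

Lemma countable_probe : countable_language L -> countable [set: probe].
Proof.
move=> [/countable_inj[ps psI] /countable_inj[pr prI] /countable_inj[pf pfI]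
  /countable_inj[pc pcI]].
pose F p : nat * nat * nat * seq nat := match p with
  | PDist s i j n => (0%N, ps s, n, [:: i; j])
  | PRel r v n => (1%N, pr r, n, [seq v i | i <- enum 'I_(rel_arity r)])
  | PFun f v => (2%N, pf f, 0%N, [seq v i | i <- enum 'I_(func_arity f)])
  | PConst c => (3%N, pc c, 0%N, [::]) end.
apply: (@inj_countable _ _ F) => -[s i j n|r v n|f v|c] [s' i' j' n'|r' v' n'|f' v'|c'] //=.
- by move=> [/psI -> -> -> ->].
- move=> [/prI rr' -> ]; case: _ / rr' v' => v' /map_enum_inj vv'.
  by congr PRel; exact/funext.
- move=> [/pfI ff']; case: _ / ff' v' => v' /map_enum_inj vv'.
  by congr PFun; exact/funext.
- by move=> [/pcI ->].
Qed.

Context (T : Type) (near : nat -> T -> T -> Prop).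
Hypothesis near_le : forall m n x y, (n <= m)%N -> near m x y -> near n x y.
Context (Q : set T) (sQ : suslin near Q) (c : T -> coding_space L).
Hypothesis hc : bisuslin_code near Q c.

Lemma bisuslin_probe p m : bisuslin near Q (fun x => probe_answer p m (c x)).
Proof.
have [h1 h2 h3 h4] := hc.
have H (u : T -> R) q e : (forall q, bisuslin near Q (fun x => u x <= q)) ->
    bisuslin near Q (fun x => `|u x - q| <= e).
  move=> hu; apply: (bisuslin_dist_le (v := fun=> q) near_le sQ) => // q'.
  exact: (bisuslin_const sQ (q <= q')).
case: p => [s i j n|r v n|f v|k] /=; [exact: H|exact: H|exact: h3|exact: h4].
Qed.

(** Pointwise convergence of codes, as far as probes can tell; values that are natural
   numbers are eventually constant. *)
Definition code_cvg (A_ : nat -> coding_space L) (A : coding_space L) : Prop :=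
  forall p, exists m, probe_answer p m A /\ exists N, forall n, (N <= n)%N ->
    probe_answer p m (A_ n).

Section cvg.
Variables (A_ : nat -> coding_space L) (A : coding_space L).
Hypothesis AA : code_cvg A_ A.

Definition real_cvg (u : nat -> R) (x : R) : Prop :=
  forall e, 0 < e -> exists N, forall n, (N <= n)%N -> `|u n - x| <= e.

Lemma answers_cvg (u : nat -> R) x : (forall k, exists q N, `|x - q| <= eps k /\
  forall n, (N <= n)%N -> `|u n - q| <= eps k) -> real_cvg u x.
Proof.
move=> h e e0; have [k ke] := eps_small (divr_gt0 e0 (ltr0n R 2)).
have [q [N [xq uq]]] := h k; exists N => n /uq.
move: xq; rewrite !ler_norml => /andP[? ?] /andP[? ?].
by apply/andP; split; lra.
Qed.

Lemma code_cvg_dist s i j : real_cvg (fun n => code_dist (A_ n) s i j) (code_dist A s i j).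
Proof.
apply: answers_cvg => k; have [m [h [N hN]]] := AA (PDist s i j k).
by exists (if unpickle m is Some q then ratr q else 0), N; split.
Qed.

Lemma code_cvg_rel r v : real_cvg (fun n => code_rel (A_ n) r v) (code_rel A r v).
Proof.
apply: answers_cvg => k; have [m [h [N hN]]] := AA (PRel v k).
by exists (if unpickle m is Some q then ratr q else 0), N; split.
Qed.

Lemma code_cvg_func_dist f v j s :
  real_cvg (fun n => code_dist (A_ n) s (code_func (A_ n) f v) j)
    (code_dist A s (code_func A f v) j).
Proof.
have [m [/= -> [N hN]]] := AA (PFun v) => e e0.
have [N' hN'] := code_cvg_dist s m j e0; exists (maxn N N') => n.
by rewrite geq_max => /andP[/hN /= -> /hN'].
Qed.

Lemma code_cvg_const_dist c' j s :
  real_cvg (fun n => code_dist (A_ n) s (code_const (A_ n) c') j)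
    (code_dist A s (code_const A c') j).
Proof.
have [m [/= -> [N hN]]] := AA (PConst c') => e e0.
have [N' hN'] := code_cvg_dist s m j e0; exists (maxn N N') => n.
by rewrite geq_max => /andP[/hN /= -> /hN'].
Qed.

End cvg.

Lemma real_cvg_dist_le (u v : nat -> R) x y e N : real_cvg u x -> real_cvg v y ->
  (forall n, (N <= n)%N -> `|u n - v n| <= e) -> `|x - y| <= e.
Proof.
move=> ux vy uv; apply/ler_addgt0Pr => d d0; have d20 := divr_gt0 d0 (ltr0n R 2).
have [N1 h1] := ux _ d20; have [N2 h2] := vy _ d20.
pose n := maxn N (maxn N1 N2).
have := h1 n; have := h2 n; have := uv n.
rewrite !leq_max !leqnn !orbT => /(_ isT) + /(_ isT) + /(_ isT).
rewrite !ler_norml => /andP[? ?] /andP[? ?] /andP[? ?].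
by apply/andP; split; lra.
Qed.

End probes.

Section tree.

(** The nodes that are good at all levels form a tree without leaves: were each
   successor x of such a node bad at some level b x, the node would have no successor
   that is good at the supremum of the countably many levels b x. *)
Lemma tree_branch (X : countType) (P : omega1 -> seq X -> Prop) :
  (forall a b q, (a <= b)%O -> P b q -> P a q) ->
  (forall b q, P (osucc b) q -> exists x, P b (rcons q x)) ->
  (forall b, P b [::]) -> exists x : nat -> X, forall n b, P b (mkseq x n).
Proof.
move=> Pmono Pstep P0.
have step (q : {q | forall b, P b q}) : exists x, forall b, P b (rcons (sval q) x).
  case: q => q Pq /=; apply: contrapT => /forallNP nq.
  have H x : exists b, ~ P b (rcons q x) by exact/existsNP.
  pose bd n := if unpickle n is Some x then sval (cid (H x)) else ozero.
  have [x Px] := Pstep (osup bd) q (Pq _).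
  apply: (svalP (cid (H x))); apply: Pmono Px.
  have := (osupP bd _).1 (lexx _) (pickle x).
  by rewrite /bd pickleK.
pose next q := sval (cid (step q)).
have nextP q b : P b (rcons (sval q) (next q)) := svalP (cid (step q)) b.
pose s := fix s n : {q | forall b, P b q} :=
  if n is m.+1 then exist _ (rcons (sval (s m)) (next (s m))) (nextP (s m))
  else exist _ [::] P0.
exists (fun n => next (s n)) => n b.
suff -> : mkseq (fun n => next (s n)) n = sval (s n) by exact: svalP (s n) b.
by elim: n => // n IH; rewrite mkseqS IH.
Qed.

(** The exponent of 2 in i + 1 takes each value j for arbitrarily large i. *)
Lemma recurrent_enumeration (X : Type) (x0 : X) : countable [set: X] ->
  exists e : nat -> X, forall x m, exists2 i, (m <= i)%N & e i = x.
Proof.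
move=> /countable_enumeration[e he].
exists (fun i => odflt x0 (e (logn 2 i.+1))) => x m; have [j ej] := he x.
exists (2 ^ j * m.*2.+1).-1.
  rewrite -ltnS prednK ?muln_gt0 ?expn_gt0// -addnn.
  by apply: leq_trans (leq_pmull _ _); rewrite ?expn_gt0// ltnS leq_addr.
rewrite prednK ?muln_gt0 ?expn_gt0// lognM ?expn_gt0// pfactorK//.
by rewrite lognE /= dvdn2 /= odd_double addn0 ej.
Qed.

End tree.

(** * The boundedness argument *)

Section preliminaries.
Context {R : realType}.

Lemma suslin_refine_countable (T : Type) (near : nat -> T -> T -> Prop)
    (near_le : forall m n x y, (n <= m)%N -> near m x y -> near n x y)
    (K : Type) (Q : set T) (V : K -> nat -> set T) : countable [set: K] ->
  suslin near Q -> (forall k m, suslin near (V k m)) ->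
  (forall x k, Q x -> exists m, V k m x) ->
  exists F (pos : K -> nat), [/\ closed_rel near F, forall x, Q x <-> exists y, F y x &
    forall y x k, F y x -> V k (y (pos k)) x].
Proof.
move=> /countable_enumeration[e he] sQ sV QV.
pose W n m := if e n is Some k then V k m else Q.
have [|x n Qx|F [pos [cF hF FW]]] := @suslin_refine T near near_le Q W sQ.
- by move=> n m; rewrite /W; case: (e n).
- by rewrite /W; case: (e n) => [k|]; [exact: QV|exists 0%N].
exists F, (fun k => pos (sval (cid (he k)))); split=> // y x k Fyx.
by have := FW y x (sval (cid (he k))) Fyx; rewrite /W (svalP (cid (he k))).
Qed.

(** Without sorts a structure consists of the values of its nullary relation symbols,
   which are sentences of rank 0. *)
Lemma empty_sorts_isomorphic (L : language R) (M N : structure L) :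
  (lsort L -> False) -> equiv_rank ozero M N -> isomorphic M N.
Proof.
move=> ns MN; apply: (@atomic_isomorphic R L M N (fun s => match ns s with end)).
- by move=> s; case: (ns s).
- by move=> s; case: (ns s).
- move=> r x; pose t i : term (@ctx0 R L) (rel_dom r i) := match ns (rel_dom r i) with end.
  have h := MN (FRel t) I (lexx _); rewrite /= in h.
  have -> : x = (fun i => teval (t i) (env0 M)).
    by apply: functional_extensionality_dep => i; case: (ns (rel_dom r i)).
  rewrite h; congr rel_int; apply: functional_extensionality_dep => i.
  by case: (ns (rel_dom r i)).
- by move=> f; case: (ns (func_cod f)).
- by move=> c; case: (ns (const_sort c)).
Qed.

Lemma dense_sequence (Z : metricType R) (z0 : Z) : separable_space Z ->
  exists d : nat -> Z, forall z e, 0 < e -> exists m, mdist (d m) z < e.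
Proof.
move=> [D /countable_injP[f fi] dD].
pose H m := exists2 z, D z & f z = m.
exists (fun m => if pselect (H m) is left h then sval (cid2 h) else z0) => z e e0.
have [||x [bx Dx]] := dD (ball z e)°.
- by exists z; exact: nbhsx_ballx z e e0.
- exact: open_interior.
exists (f x); case: pselect => [h|]; last by case; exists x.
have -> : sval (cid2 h) = x.
  apply: fi; rewrite ?inE //; first exact: s2valP (cid2 h).
  exact: s2valP' (cid2 h).
by move: bx => /interior_subset; rewrite ballEmdist /= metric_sym.
Qed.

Lemma cauchy_limit (Z : metricType R) (z : nat -> Z) : complete_metric Z ->
  (forall n, exists c N, forall k, (N <= k)%N -> mdist c (z k) <= eps n) ->
  exists l, forall n, exists N, forall k, (N <= k)%N -> mdist l (z k) <= @eps R n.
Proof.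
move=> cZ h; have [|l zl] := cZ (z @ \oo) _.
  apply/cauchyP => e /eps_small[n ne]; have [c [N hN]] := h n.
  exists c; exists N => // k /= /hN ck; rewrite ballEmdist /=.
  exact: le_lt_trans ne.
exists l => n; have [N _ hN] := zl _ (nbhsx_ballx l _ (@eps_gt0 R n)).
by exists N => k /hN; rewrite /= ballEmdist /= => /ltW.
Qed.

Lemma play_tuple_eq (a b : nat -> nat) n : (forall m, (m < n)%N -> a m = b m) ->
  play_tuple a n = play_tuple b n.
Proof.
elim: n => //= n IH ab; rewrite ab// IH// => m mn; apply: ab; exact: ltnW.
Qed.

Definition code_iota (L : language R) (A : Mod L) : forall s, nat -> completion A s :=
  sval (cid (completionP A)).

Lemma code_iotaP (L : language R) (A : Mod L) : completes (sval A) (code_iota A).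
Proof. exact: svalP (cid (completionP A)). Qed.

End preliminaries.

Section transfer.
Context {R : realType} (L1 L2 : language R).
Hypotheses (cL1 : countable_language L1) (cL2 : countable_language L2).
Context (I : Type) (A1 : I -> Mod L1) (A2 : I -> Mod L2).
Context (Z : metricType R) (B : set Z)
  (f1 : Z -> coding_space L1) (f2 : Z -> coding_space L2).
Hypotheses (cZ : complete_metric Z) (sZ : separable_space Z) (bB : borel B).
Hypothesis f1B : forall U, open U -> borel (B `&` f1 @^-1` U).
Hypothesis f2B : forall U, open U -> borel (B `&` f2 @^-1` U).
Hypothesis cover : forall i, exists x, [/\ B x, f1 x = sval (A1 i) & f2 x = sval (A2 i)].
Hypothesis onto : forall x, B x -> exists i, f1 x = sval (A1 i) /\ f2 x = sval (A2 i).
Hypothesis iso21 : forall i j, isomorphic (completion (A2 i)) (completion (A2 j)) ->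
  isomorphic (completion (A1 i)) (completion (A1 j)).

Local Notation near := (@pair_near R Z).
Let proj (b : bool) (p : Z * Z) : Z := if b then p.1 else p.2.

Let proj_near b n p q : near n p q -> mdist (proj b p) (proj b q) <= eps n.
Proof. by case: b => -[]. Qed.

Let Q0 : set (Z * Z) := [set p | B p.1 /\ B p.2].

Let Q0B b p : Q0 p -> B (proj b p).
Proof. by case: b => -[]. Qed.

Let suslin_Q0 : suslin near Q0.
Proof.
have h b : suslin near [set p | B (proj b p)].
  by have [+ _] := borel_bisuslin (@proj_near b) bB; rewrite setTI.
exact: suslin_setI (h true) (h false).
Qed.

Let code1 b := borel_bisuslin_code f1B (@proj_near b) suslin_Q0 (@Q0B b).
Let code2 b := borel_bisuslin_code f2B (@proj_near b) suslin_Q0 (@Q0B b).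

Variable alpha : omega1.

Let Q1 : set (Z * Z) := [set p | Q0 p /\
  ~ bf (f1 p.1) (f1 p.2) (notation_of alpha) (@ctx0 R L1) empty_tuple empty_tuple 0].

Let codes p i j : Prop := [/\ f1 p.1 = sval (A1 i), f1 p.2 = sval (A1 j),
  f2 p.1 = sval (A2 i) & f2 p.2 = sval (A2 j)].

Let suslin_Q1 : suslin near Q1.
Proof.
have [_ +] := bisuslin_bf cL1 (@pair_near_le R Z) suslin_Q0 (notation_of alpha)
  (@ctx0 R L1) empty_tuple empty_tuple 0%N (code1 true) (code1 false).
by [].
Qed.

Let Q1_not_iso p i j : Q1 p -> codes p i j ->
  ~ isomorphic (completion (A1 i)) (completion (A1 j)).
Proof.
move=> [_ nbf] [pi pj _ _] h; apply: nbf; rewrite pi pj.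
exact: (isomorphic_bf (code_iotaP (A1 i)) (code_iotaP (A1 j))).
Qed.

Let Q1_not_equiv i j : ~ equiv_rank alpha (completion (A1 i)) (completion (A1 j)) ->
  exists p, Q1 p /\ codes p i j.
Proof.
move=> nij; have [x [Bx xi1 xi2]] := cover i; have [x' [Bx' xj1 xj2]] := cover j.
exists (x, x'); split=> //; split=> //= h; apply: nij; move: h; rewrite xi1 xj1.
exact: (bf_equiv_rank (code_iotaP (A1 i)) (code_iotaP (A1 j))).
Qed.

(** The witness of membership in [Q1] is refined so that it also records
   approximations of the two parameters and the answers to all probes of their second
   structures; along a branch of the tree the parameters and these codes then
   converge. *)
Let witness : (exists p, Q1 p) -> exists (d : nat -> Z) F
    (loc : bool * nat -> nat) (ans : bool * probe L2 -> nat),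
  [/\ closed_rel near F, forall p, Q1 p <-> exists y, F y p,
      forall y p b n, F y p -> mdist (d (y (loc (b, n)))) (proj b p) <= eps n &
      forall y p b k, F y p -> probe_answer k (y (ans (b, k))) (f2 (proj b p))].
Proof.
move=> [p0 _]; have [d hd] := dense_sequence p0.1 sZ.
pose K : Type := (bool * nat) + (bool * probe L2).
have cK : countable [set: K].
  have [f fi] := countable_inj (countable_probe cL2).
  apply: (@inj_countable K ((bool * nat) + (bool * nat))%type
    (fun k => match k with inl l => inl l | inr (b, p) => inr (b, f p) end)).
  by move=> [l|[b p]] [l'|[b' p']] //= [] => [->//|-> /fi ->].
pose V (k : K) m : set (Z * Z) := match k with
  | inl (b, n) => [set p | mdist (d m) (proj b p) <= eps n]
  | inr (b, k) => Q0 `&` [set p | probe_answer k m (f2 (proj b p))] end.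
have [||F [pos [cF hF FV]]] :=
    @suslin_refine_countable _ near (@pair_near_le R Z) K Q1 V cK suslin_Q1.
- move=> [[b n]|[b k]] m /=.
    apply: suslin_closed => p h; apply/ler_addgt0Pr => e /eps_small[k ke].
    have [p' pp' dp'] := h k; have := proj_near b pp'.
    have := metric_triangle (d m) (proj b p') (proj b p).
    by rewrite [mdist (proj b p') _]metric_sym; move: dp'; rewrite /mkset; lra.
  by have [] := bisuslin_probe (@pair_near_le R Z) suslin_Q0 (code2 b) k m.
- move=> p [[b n]|[b k]] Qp /=.
    by have [m dm] := hd (proj b p) _ (@eps_gt0 R n); exists m; exact: ltW.
  have [m hm] := probe_answer_ex k (f2 (proj b p)); exists m; split=> //.
  by case: Qp.
exists d, F, (fun l => pos (inl l)), (fun k => pos (inr k)); split=> //.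
- by move=> y p b n /FV h; exact: (h (inl (b, n))).
- by move=> y p b k /FV h; have [] := h (inr (b, k)).
Qed.

(** Indistinguishability bounds the variation of atomic formulas in the approximating
   codes; the bounds are closed conditions, so they pass to the limit codes. *)
Let play_isomorphic (S : nat -> lsort L2) (w : nat -> modulus R 1) (a b : nat -> nat)
    (i j : nat -> I) i0 j0 :
  weights L2 w -> recurrent S a -> recurrent S b ->
  (forall n, indist S w ozero (code_iota (A2 (i n)))
    (code_iota (A2 (j n))) (play_tuple a n) (play_tuple b n)) ->
  code_cvg (fun n => sval (A2 (i n))) (sval (A2 i0)) ->
  code_cvg (fun n => sval (A2 (j n))) (sval (A2 j0)) ->
  isomorphic (completion (A2 i0)) (completion (A2 j0)).
Proof.
move=> hw ra rb hI ci cj.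
have cM n := code_iotaP (A2 (i n)); have cN n := code_iotaP (A2 (j n)).
apply: (limit_isomorphic (code_iotaP (A2 i0)) (code_iotaP (A2 j0)) (a := a) (b := b)) => //.
- move=> m k l s mk ml Sk Sl.
  apply: (real_cvg_dist_le (N := (maxn k l).+1) (code_cvg_dist ci _ _ _)
    (code_cvg_dist cj _ _ _)) => n; rewrite gtn_max => /andP[kn ln].
  by apply: (indist_dist (cM n) (cN n) hw _ _ Sk Sl (hI n)); rewrite ?mk ?ml.
- move=> r m; have [m1 hm1] := w_rel hw r; exists (maxn m m1) => k mk Sk.
  apply: (real_cvg_dist_le (N := (\max_l k l).+1) (code_cvg_rel ci _)
    (code_cvg_rel cj _)) => n hn.
  apply: (indist_rel (cM n) (cN n) hm1 _ Sk (hI n)) => l; rewrite mk.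
  by apply: leq_ltn_trans hn; exact: leq_bigmax.
- move=> f m; have [m1 hm1] := w_fun hw f; exists (maxn m m1) => k l mk Sk ml Sl.
  apply: (real_cvg_dist_le (N := (maxn l (\max_l k l)).+1) (code_cvg_func_dist ci _ _ _)
    (code_cvg_func_dist cj _ _ _)) => n; rewrite gtn_max => /andP[ln kn].
  apply: (indist_fun (cM n) (cN n) hm1 _ Sk _ Sl (hI n)) => [l'|]; rewrite ?ml// mk.
  by apply: leq_ltn_trans kn; exact: leq_bigmax.
- move=> c m l ml Sl.
  apply: (real_cvg_dist_le (N := l.+1) (code_cvg_const_dist ci _ _ _)
    (code_cvg_const_dist cj _ _ _)) => n ln.
  by apply: (indist_const (cM n) (cN n) hw _ Sl (hI n)); rewrite ml.
Qed.

(** A node of the tree lists finite pieces of a witness and of a play. It is good at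
   level [beta] if it extends to a pair in [Q1] whose second structures are
   indistinguishable at that level along the play. The schedule [sch] makes each
   element of each sort recur on both sides. *)
Let plays_isomorphic (s0 : lsort L2) :
  (forall beta, exists i j p, [/\ Q1 p, codes p i j &
    equiv_rank beta (completion (A2 i)) (completion (A2 j))]) ->
  exists p i j, [/\ Q1 p, codes p i j &
    isomorphic (completion (A2 i)) (completion (A2 j))].
Proof.
move=> hQ; have [w hw] := weights_exist cL2.
have [|d [F [loc [ans [cF QF Floc Fans]]]]] := witness.
  by have [_ [_ [p [Qp _ _]]]] := hQ ozero; exists p.
have [sch hsch] := @recurrent_enumeration (lsort L2 * bool * nat) (s0, true, 0%N)
  (ltac:(have [/countable_inj[f fi] _ _ _] := cL2;
    by apply: (@inj_countable _ (nat * bool * nat)%type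
      (fun x => (f x.1.1, x.1.2, x.2))) => -[[s b] c] [[s' b'] c'] /= [] /fi -> -> ->)).
pose S n := (sch n).1.1; pose elt n := (sch n).2.
pose dft := (0%N, 0%N, 0%N).
pose qa (q : seq (nat * nat * nat)) n := (nth dft q n).1.2.
pose qb (q : seq (nat * nat * nat)) n := (nth dft q n).2.
pose P beta (q : seq (nat * nat * nat)) := exists y p i j,
  [/\ F y p, f2 p.1 = sval (A2 i) /\ f2 p.2 = sval (A2 j),
      forall n, (n < size q)%N -> y n = (nth dft q n).1.1,
      forall n, (n < size q)%N -> (if (sch n).1.2 then qa q n else qb q n) = elt n &
      indist S w beta (code_iota (A2 i)) (code_iota (A2 j))
        (play_tuple (qa q) (size q)) (play_tuple (qb q) (size q))].
have P_mono a b q : (a <= b)%O -> P b q -> P a q.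
  move=> ab [y [p [i [j [h1 h2 h3 h4 h5]]]]]; exists y, p, i, j; split=> //.
  exact: indist_le ab h5.
have P_nil b : P b [::].
  have [i [j [p [/QF[y Fyp] [_ _ pi pj] hb]]]] := hQ b; exists y, p, i, j; split=> //.
  exact: (equiv_rank_indist (w := w) _ hb).
have P_step b q : P (osucc b) q -> exists t, P b (rcons q t).
  move=> [y [p [i [j [h1 h2 h3 h4 h5]]]]]; pose n := size q.
  have [c [c' [hc hI]]] : exists c c', (if (sch n).1.2 then c else c') = elt n /\
      indist S w b (n := n.+1) (code_iota (A2 i)) (code_iota (A2 j))
        (cons_nat c (play_tuple (qa q) n)) (cons_nat c' (play_tuple (qb q) n)).
    case: (sch n).1.2.
      by have [c' hc'] := indist_forth (code_iotaP (A2 j)) h5 (elt n); exists (elt n), c'.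
    have [c hc] := indist_forth (code_iotaP (A2 i)) (indist_sym h5) (elt n).
    by exists c, (elt n); split=> //; exact: indist_sym.
  exists (y n, c, c'), y, p, i, j.
  have nth_lt m : (m < n)%N -> nth dft (rcons q (y n, c, c')) m = nth dft q m.
    by move=> mn; rewrite nth_rcons mn.
  have nth_n : nth dft (rcons q (y n, c, c')) n = (y n, c, c').
    by rewrite nth_rcons ltnn eqxx.
  split=> //; rewrite size_rcons.
  - move=> m; rewrite ltnS leq_eqVlt => /predU1P[->|mn]; first by rewrite nth_n.
    by rewrite nth_lt// h3.
  - move=> m; rewrite ltnS leq_eqVlt => /predU1P[->|mn].
      by rewrite /qa /qb nth_n.
    by rewrite /qa /qb nth_lt//; exact: h4.
  - rewrite /=.
    rewrite (@play_tuple_eq (qa (rcons q (y n, c, c'))) (qa q)); last first.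
      by move=> m mn; rewrite /qa nth_lt.
    rewrite (@play_tuple_eq (qb (rcons q (y n, c, c'))) (qb q)); last first.
      by move=> m mn; rewrite /qb nth_lt.
    rewrite /qa /qb nth_n; exact: hI.
have [x hx] := tree_branch P_mono P_step P_nil.
pose y' n := (x n).1.1; pose a n := (x n).1.2; pose b n := (x n).2.
have H n : exists z : (nat -> nat) * (Z * Z) * (I * I), [/\ F z.1.1 z.1.2,
    f2 z.1.2.1 = sval (A2 z.2.1) /\ f2 z.1.2.2 = sval (A2 z.2.2), agree n y' z.1.1,
    forall m, (m < n)%N -> (if (sch m).1.2 then a m else b m) = elt m &
    indist S w ozero (code_iota (A2 z.2.1)) (code_iota (A2 z.2.2))
      (play_tuple a n) (play_tuple b n)].
  have [y [p [i [j [h1 h2 h3 h4 h5]]]]] := hx n ozero.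
  rewrite size_mkseq in h3 h4 h5; exists (y, p, (i, j)); split=> //=.
  - by move=> m mn; rewrite h3// nth_mkseq.
  - by move=> m mn; rewrite -h4// /qa /qb nth_mkseq.
  - rewrite (@play_tuple_eq a (qa (mkseq x n))); last first.
      by move=> m mn; rewrite /qa nth_mkseq.
    rewrite (@play_tuple_eq b (qb (mkseq x n))); last first.
      by move=> m mn; rewrite /qb nth_mkseq.
    exact: h5.
have {H}[z hz] := choice H.
have Fz n : F (z n).1.1 (z n).1.2 by have [] := hz n.
have yz n : agree n y' (z n).1.1 by have [] := hz n.
have lim b0 : exists l, forall n, exists N, forall k, (N <= k)%N ->
    mdist l (proj b0 (z k).1.2) <= @eps R n.
  apply: cauchy_limit => // n; exists (d (y' (loc (b0, n)))), (loc (b0, n)).+1 => k nk.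
  by rewrite (yz k)//; exact: Floc.
have [[l1 hl1] [l2 hl2]] := (lim true, lim false).
pose p := (l1, l2).
have Fp : F y' p.
  apply: cF => n; have [N1 h1] := hl1 n; have [N2 h2] := hl2 n.
  pose k := maxn n (maxn N1 N2); exists (z k).1.1, (z k).1.2; split=> //.
  - by move=> m mn; apply: yz; apply: leq_trans mn _; rewrite leq_maxl.
  - split; [apply: h1|apply: h2]; by rewrite !leq_max leqnn !orbT.
have Qp : Q1 p by apply/QF; exists y'.
have [[Bp1 Bp2] _] := Qp.
have [i0 [i0E' i0E]] := onto Bp1; have [j0 [j0E' j0E]] := onto Bp2.
exists p, i0, j0; split=> //.
have sched m : (if (sch m).1.2 then a m else b m) = elt m.
  by have [_ _ _ h _] := hz m.+1; exact: h.
apply: (@play_isomorphic S w a b (fun n => (z n).2.1) (fun n => (z n).2.2)) => //.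
- move=> s c m; have [i mi si] := hsch (s, true, c) m; exists i; split=> //.
    by rewrite /S si.
  by have := sched i; rewrite /elt si.
- move=> s c m; have [i mi si] := hsch (s, false, c) m; exists i; split=> //.
    by rewrite /S si.
  by have := sched i; rewrite /elt si.
- by move=> n; have [] := hz n.
- move=> k; exists (y' (ans (true, k))); rewrite -i0E; split; first exact: (Fans _ p true).
  exists (ans (true, k)).+1 => n kn; have [Fn [<- _] yn _ _] := hz n.
  by rewrite (yn _ kn); exact: (Fans _ _ true).
- move=> k; exists (y' (ans (false, k))); rewrite -j0E; split; first exact: (Fans _ p false).
  exists (ans (false, k)).+1 => n kn; have [Fn [_ <-] yn _ _] := hz n.
  by rewrite (yn _ kn); exact: (Fans _ _ false).
Qed.

(** If no [theta] served, the separated pairs would contain pairs whose second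
   structures are equivalent at every level, hence a pair whose second structures are
   isomorphic. Sorts are needed to have something to play, so a language without sorts
   is treated apart. *)
Lemma equiv_rank_transfer : exists theta, forall i j,
  equiv_rank theta (completion (A2 i)) (completion (A2 j)) ->
  equiv_rank alpha (completion (A1 i)) (completion (A1 j)).
Proof.
apply: contrapT => /forallNP nth.
have hQ beta : exists i j p, [/\ Q1 p, codes p i j &
    equiv_rank beta (completion (A2 i)) (completion (A2 j))].
  have /existsNP[i /existsNP[j /not_implyP[h nh]]] := nth beta.
  by have [p [Qp pij]] := Q1_not_equiv nh; exists i, j, p.
have [p [i [j [Qp pij hij]]]] : exists p i j, [/\ Q1 p, codes p i j & isomorphic (completion (A2 i)) (completion (A2 j))].
  have [[s0 _]|ns] := pselect (exists s : lsort L2, True).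
    exact: plays_isomorphic hQ.
  have [i [j [p [Qp pij h]]]] := hQ ozero; exists p, i, j; split=> //.
  by apply: empty_sorts_isomorphic h => s; apply: ns; exists s.
exact: (Q1_not_iso Qp pij (iso21 hij)).
Qed.

End transfer.

(** * Transfer along an analytic graph *)

Section graph.
Context {R : realType} (L1 L2 : language R) (I : Type).

Lemma open_borel (T : topologicalType) (U : set T) : open U -> borel U.
Proof. by move=> oU; apply: sub_gen_smallest. Qed.

(** The two halves differ by the exchange of the coordinates of the graph; a Borel
   parametrisation of the graph parametrises both coordinates. *)
Lemma graph_transfer (A1 : I -> Mod L1) (A2 : I -> Mod L2) :
  countable_language L1 -> countable_language L2 ->
  analytic R [set (sval (A1 i), sval (A2 i)) | i in [set: I]] ->
  (forall i j, isomorphic (completion (A1 i)) (completion (A1 j)) <->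
    isomorphic (completion (A2 i)) (completion (A2 j))) ->
  forall alpha,
  (exists theta, forall i j,
    equiv_rank theta (completion (A2 i)) (completion (A2 j)) ->
    equiv_rank alpha (completion (A1 i)) (completion (A1 j))) /\
  (exists theta, forall i j,
    equiv_rank theta (completion (A1 i)) (completion (A1 j)) ->
    equiv_rank alpha (completion (A2 i)) (completion (A2 j))).
Proof.
move=> cL1 cL2 [Z [cZ sZ [B [f [bB fB gE]]]]] iso alpha.
have f1B U : open U -> borel (B `&` (fun x => (f x).1) @^-1` U).
  move=> oU; have : open (fst @^-1` U : set (coding_space L1 * coding_space L2)).
    by apply: open_comp oU => x _; exact: cvg_fst.
  by move=> /open_borel /fB.
have f2B U : open U -> borel (B `&` (fun x => (f x).2) @^-1` U).
  move=> oU; have : open (snd @^-1` U : set (coding_space L1 * coding_space L2)).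
    by apply: open_comp oU => x _; exact: cvg_snd.
  by move=> /open_borel /fB.
have cover i : exists x, [/\ B x, (f x).1 = sval (A1 i) & (f x).2 = sval (A2 i)].
  have : (f @` B) (sval (A1 i), sval (A2 i)) by rewrite -gE; exists i.
  by move=> [x Bx fx]; exists x; rewrite fx.
have onto x : B x -> exists i, (f x).1 = sval (A1 i) /\ (f x).2 = sval (A2 i).
  move=> Bx; have : (f @` B) (f x) by exists x.
  by rewrite -gE => -[i _ <-]; exists i.
split.
  apply: (equiv_rank_transfer cL1 cL2 cZ sZ bB f1B f2B) => // i j; exact: (iso i j).2.
apply: (equiv_rank_transfer cL2 cL1 cZ sZ bB f2B f1B) => [i|x Bx|i j].
- by have [x [? ? ?]] := cover i; exists x.
- by have [i [? ?]] := onto x Bx; exists i.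
- exact: (iso i j).1.
Qed.

End graph.

Theorem corollary3 (R : realType) (L1 L2 : language R)
  (countable_L1 : countable_language L1) (countable_L2 : countable_language L2)
  (X : set (Mod L1)) (Y : set (Mod L2))
  (analytic_X : analytic R [set sval A | A in X])
  (analytic_Y : analytic R [set sval B | B in Y])
  (K : X -> Y)
  (analytic_K : analytic R
     [set (sval (sval A), sval (sval (K A))) | A in [set: X]])
  (K_iso : forall A B : X,
     isomorphic (completion (sval (K A))) (completion (sval (K B))) <->
     isomorphic (completion (sval A)) (completion (sval B))) :
  exists theta theta' : omega1 -> omega1, forall (A B : X) (alpha : omega1),
    (equiv_rank (theta alpha) (completion (sval (K A))) (completion (sval (K B))) ->
     equiv_rank alpha (completion (sval A)) (completion (sval B))) /\
    (equiv_rank (theta' alpha) (completion (sval A)) (completion (sval B)) ->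
     equiv_rank alpha (completion (sval (K A))) (completion (sval (K B)))).
Proof.
have h alpha := graph_transfer countable_L1 countable_L2 analytic_K
  (fun A B => iff_sym (K_iso A B)) alpha.
exists (fun alpha => sval (cid (h alpha).1)), (fun alpha => sval (cid (h alpha).2)).
move=> A B alpha; split; first exact: (svalP (cid (h alpha).1) A B).
exact: (svalP (cid (h alpha).2) A B).
Qed.
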